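(* Let $L>0$, let $M^2$ be a connected surface, and let $\phi:(M^2,\bar g)\to \mathrm{AdS}_3(L)$ be a two-sided spacelike conformal immersion with induced metric $g=\phi^*h=\lambda^2\bar g$, $\lambda>0$. Assume that $\phi:(M^2,\bar g)\to\mathrm{AdS}_3(L)$ is biharmonic and that its scalar mean curvature $H$ is a nonzero constant. Then the associated induced isometric immersion $\phi:(M^2,g)\to\mathrm{AdS}_3(L)$ is biharmonic and locally totally umbilical. More precisely, $$A=\pm\frac1L\,\mathrm{id},\qquad H=\mp\frac1L,\qquad K=-\frac{2}{L^2},$$ where $A$ is the shape operator and $K$ is the Gaussian curvature of $g$. Consequently, up to reversal of the unit normal and an ambient isometry, every point of $M$ has a neighbourhood congruent to an open subset of the standard totally umbilical hyperbolic plane $\mathbb H^2(L/\sqrt2)\subset\mathrm{AdS}_3(L)$ (of constant curvature $-2/L^2$). Thus (the dilation $\lambda$ being constant) such conformal biharmonic immersions are exactly constant homothetic reparametrizations of the standard proper biharmonic isometric immersion.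
   Context: $\mathrm{AdS}_3(L)=\{X\in\mathbb R^{2,2}:\langle X,X\rangle=-L^2\}$ with $\langle X,X\rangle=-X_0^2-X_1^2+X_2^2+X_3^2$, carrying the induced Lorentzian metric $h$ (signature $(-,+,+)$) of constant sectional curvature $-1/L^2$. An immersion $\phi:M^2\to\mathrm{AdS}_3(L)$ is spacelike if $g=\phi^*h$ is Riemannian; its unit normal $\xi$ then satisfies $h(\xi,\xi)=-1$. Two-sided means that a global unit normal field $\xi$ exists. The shape operator is defined by $\nabla^N_X\xi=-AX$ with $\nabla^N$ the Levi-Civita connection of $h$. The scalar mean curvature $H$ is defined by $\mathbf H=H\xi$, where $\mathbf H$ is half the trace of the second fundamental form of the isometric immersion $\phi:(M,g)\to\mathrm{AdS}_3(L)$, so $H=-\frac12\operatorname{tr}_gA$. The map $\phi:(M,\bar g)\to\mathrm{AdS}_3(L)$ is conformal with dilation $\lambda$ if $\phi^*h=\lambda^2\bar g$. For a smooth map $\phi:(M,g')\to(N,h)$ between pseudo-Riemannian manifolds, $\tau_{g'}(\phi)=\operatorname{tr}_{g'}\nabla d\phi$ is the tension field, and the bitension field is $\tau_{2,g'}(\phi)=\Delta^\phi_{g'}\tau_{g'}(\phi)-\sum_i\epsilon_iR^N(d\phi(e_i),\tau_{g'}(\phi))d\phi(e_i)$, where $\{e_i\}$ is a local $g'$-pseudo-orthonormal frame with $g'(e_i,e_j)=\epsilon_i\delta_{ij}$, $\Delta^\phi_{g'}V=\sum_i\epsilon_i(\nabla^\phi_{e_i}\nabla^\phi_{e_i}V-\nabla^\phi_{\nabla_{e_i}e_i}V)$,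 and $R^N(X,Y)=[\nabla^N_X,\nabla^N_Y]-\nabla^N_{[X,Y]}$. The map is biharmonic (with respect to $g'$) if $\tau_{2,g'}(\phi)=0$, and proper biharmonic if it is biharmonic but not harmonic (harmonic means $\tau_{g'}(\phi)=0$). *)

(* Defs.v *)
From mathcomp Require Import all_boot all_order all_algebra.
From mathcomp Require Import lra.
From mathcomp Require Import all_classical all_reals all_analysis.

Set Implicit Arguments.
Unset Strict Implicit.
Unset Printing Implicit Defensive.

Import Order.TTheory GRing.Theory Num.Theory.
Import numFieldNormedType.Exports.

Local Open Scope classical_set_scope.
Local Open Scope ring_scope.

Section Smooth.
Context {R : realType} {V W : normedModType R}.

Fixpoint Ck_on (k : nat) (U : set V) (f : V -> W) : Prop :=
  match k with
  | 0 => forall x, U x -> {for x, continuous f}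
  | k'.+1 => (forall x, U x -> differentiable f x) /\
             (forall v, Ck_on k' U (fun x => 'D_v f x))
  end.

Definition smooth_on (U : set V) (f : V -> W) : Prop := forall k, Ck_on k U f.

End Smooth.

Section Surfaces.
Context {R : realType}.

(* [cinv] is a total function; only its values on [crange] are meaningful. *)
Record chart (M : topologicalType) := Chart {
  cdom : set M;
  cfun : M -> 'rV[R]_2;
  cinv : 'rV[R]_2 -> M;
  crange := cfun @` cdom;
  cdom_open : open cdom;
  crange_open : open crange;
  cfunK : forall p, cdom p -> cinv (cfun p) = p;
  cfun_continuous : forall p, cdom p -> {for p, continuous cfun};
  cinv_continuous : forall x, crange x -> {for x, continuous cinv} }.

Record surface (M : topologicalType) := Surface {
  atlas : set (chart M);
  surface_hausdorff : hausdorff_space M;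
  surface_second_countable : @second_countable M;
  surface_nonempty : [set: M] !=set0;
  atlas_cover : forall p, exists2 c, atlas c & cdom c p;
  atlas_smooth : forall c c', atlas c -> atlas c' ->
    smooth_on (cfun c @` (cdom c `&` cdom c')) (cfun c' \o cinv c) }.

Definition smooth_map (M : topologicalType) (S : surface M)
    (W : normedModType R) (f : M -> W) : Prop :=
  forall c, atlas S c -> smooth_on (crange c) (f \o cinv c).

(* The bilinear form with Gram matrix [G x]; vectors are rows. *)
Definition gip (G : 'rV[R]_2 -> 'M[R]_2) (x u v : 'rV[R]_2) : R :=
  (u *m G x *m v^T) 0 0.

(* [metric_mx c x] is the matrix of the metric in the coordinates of the chart
   [c], at the point of coordinates [x].  Tangent vectors being rows, a
   coordinate change with Jacobian J sends v to v *m J, whence the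
   compatibility law. *)
Record riemannian_metric (M : topologicalType) (S : surface M) :=
  RiemannianMetric {
  metric_mx :> chart M -> 'rV[R]_2 -> 'M[R]_2;
  metric_smooth : forall c, atlas S c -> smooth_on (crange c) (metric_mx c);
  metric_sym : forall c, atlas S c ->
    forall x, crange c x -> (metric_mx c x)^T = metric_mx c x;
  metric_pos : forall c, atlas S c ->
    forall x, crange c x -> forall v, v != 0 -> 0 < gip (metric_mx c) x v v;
  metric_compat : forall c c', atlas S c -> atlas S c' ->
    forall x, (cfun c @` (cdom c `&` cdom c')) x ->
    let J := jacobian (cfun c' \o cinv c) x in
    metric_mx c x = J *m metric_mx c' (cfun c' (cinv c x)) *m J^T }.

End Surfaces.

Section Connections.
Context {R : realType}.

Definition lie_bracket n (X Y : 'rV[R]_n -> 'rV[R]_n) : 'rV[R]_n -> 'rV[R]_n :=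
  fun x => 'D_(X x) Y x - 'D_(Y x) X x.

Definition curvature n
    (nabla : ('rV[R]_n -> 'rV[R]_n) -> ('rV[R]_n -> 'rV[R]_n) ->
             'rV[R]_n -> 'rV[R]_n)
    (X Y Z : 'rV[R]_n -> 'rV[R]_n) : 'rV[R]_n -> 'rV[R]_n :=
  fun x => nabla X (nabla Y Z) x - nabla Y (nabla X Z) x
           - nabla (lie_bracket X Y) Z x.

Definition evec (i : 'I_2) : 'rV[R]_2 := delta_mx 0 i.

Variable G : 'rV[R]_2 -> 'M[R]_2.

(* Koszul formula for constant fields u, v, w in coordinates:
   2 g(Gamma(u,v), w) = D_u g(v,w) + D_v g(u,w) - D_w g(u,v). *)
Definition christoffel (x u v : 'rV[R]_2) : 'rV[R]_2 :=
  (\row_k (2^-1 * ('D_u (fun y => gip G y v (evec k)) x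
                   + 'D_v (fun y => gip G y u (evec k)) x
                   - 'D_(evec k) (fun y => gip G y u v) x))) *m invmx (G x).

Definition levi_civita (X Y : 'rV[R]_2 -> 'rV[R]_2) : 'rV[R]_2 -> 'rV[R]_2 :=
  fun x => 'D_(X x) Y x + christoffel x (X x) (Y x).

Definition gauss_curvature (x : 'rV[R]_2) : R :=
  gip G x (curvature levi_civita (cst (evec 0)) (cst (evec 1))
             (cst (evec 1)) x) (evec 0) / \det (G x).

Definition metric_trace (W : lmodType R) (x : 'rV[R]_2)
    (B : 'rV[R]_2 -> 'rV[R]_2 -> W) : W :=
  \sum_(i < 2) \sum_(j < 2) invmx (G x) i j *: B (evec i) (evec j).

Definition orthonormal_frame (U : set 'rV[R]_2)
    (E : 'I_2 -> 'rV[R]_2 -> 'rV[R]_2) : Prop :=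
  (forall a, smooth_on U (E a)) /\
  (forall x, U x -> forall a b, gip G x (E a x) (E b x) = (a == b)%:R).

End Connections.

Section AntiDeSitter.
Context {R : realType}.

Definition mink (X Y : 'rV[R]_4) : R :=
  \sum_(i < 4) (if (i < 2)%N then -1 else 1) * X 0 i * Y 0 i.

Definition ads (L : R) : set 'rV[R]_4 := [set X | mink X X = - L ^+ 2].

(* Orthogonal projection onto the tangent space of AdS_3(L) at q, that is onto
   the complement of q, where <q, q> = - L^2. *)
Definition tproj (L : R) (q w : 'rV[R]_4) : 'rV[R]_4 :=
  w + (L ^- 2 * mink w q) *: q.

(* Levi-Civita connection of the metric induced by R^{2,2} (Gauss formula);
   at points of AdS_3(L) it only depends on the restrictions of tangent
   fields to AdS_3(L). *)
Definition ads_connection (L : R) (X Y : 'rV[R]_4 -> 'rV[R]_4) :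
    'rV[R]_4 -> 'rV[R]_4 :=
  fun q => tproj L q ('D_(X q) Y q).

(* The curvature tensor at q on tangent vectors u, v, w, which are extended to
   the tangent fields q' |-> tproj L q' u, etc. *)
Definition ads_curvature (L : R) (q u v w : 'rV[R]_4) : 'rV[R]_4 :=
  curvature (ads_connection L) (tproj L ^~ u) (tproj L ^~ v) (tproj L ^~ w) q.

(* The isometries of AdS_3(L): restrictions of elements of O(2,2). *)
Definition ambient_isometry (T : 'M[R]_4) : Prop :=
  forall X Y, mink (X *m T) (Y *m T) = mink X Y.

End AntiDeSitter.

(* Maps into AdS_3(L) written in coordinates: [f] is the map, [G] the matrix of
   a metric on the domain. *)
Section MapsInCoordinates.
Context {R : realType}.
Variables (L : R) (G : 'rV[R]_2 -> 'M[R]_2) (f : 'rV[R]_2 -> 'rV[R]_4).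

Definition pullback_mx : 'rV[R]_2 -> 'M[R]_2 :=
  fun x => \matrix_(i, j) mink ('D_(evec i) f x) ('D_(evec j) f x).

Definition cov_along (X : 'rV[R]_2 -> 'rV[R]_2) (V : 'rV[R]_2 -> 'rV[R]_4) :
    'rV[R]_2 -> 'rV[R]_4 :=
  fun x => tproj L (f x) ('D_(X x) V x).

Definition nabla_d (x u v : 'rV[R]_2) : 'rV[R]_4 :=
  cov_along (cst u) (fun y => 'D_v f y) x
  - 'D_(levi_civita G (cst u) (cst v) x) f x.

Definition tension (x : 'rV[R]_2) : 'rV[R]_4 := metric_trace G x (nabla_d x).

(* The signs epsilon_i are 1, the metric of the domain being Riemannian. *)
Definition rough_laplacian (E : 'I_2 -> 'rV[R]_2 -> 'rV[R]_2)
    (V : 'rV[R]_2 -> 'rV[R]_4) (x : 'rV[R]_2) : 'rV[R]_4 :=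
  \sum_(a < 2) (cov_along (E a) (cov_along (E a) V) x
                - cov_along (levi_civita G (E a) (E a)) V x).

Definition bitension (E : 'I_2 -> 'rV[R]_2 -> 'rV[R]_2) (x : 'rV[R]_2) :
    'rV[R]_4 :=
  rough_laplacian E tension x
  - \sum_(a < 2) ads_curvature L (f x) ('D_(E a x) f x) (tension x)
                                       ('D_(E a x) f x).

(* Vanishing in every local orthonormal frame; such frames exist near every
   point where [G] is a Riemannian metric, by Gram-Schmidt. *)
Definition biharmonic_on (U : set 'rV[R]_2) : Prop :=
  forall (V : set 'rV[R]_2) E, open V -> V `<=` U -> orthonormal_frame G V E ->
  forall x, V x -> bitension E x = 0.

Definition harmonic_on (U : set 'rV[R]_2) : Prop :=
  forall x, U x -> tension x = 0.

(* The matrix A with dphi (A v) = - nabla^N_v nu; endomorphisms act on rows by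
   right multiplication, so the equation is A *m 'J f = - nabla^N nu. *)
Definition shape_mx (nu : 'rV[R]_2 -> 'rV[R]_4) (x : 'rV[R]_2) : 'M[R]_2 :=
  (\matrix_(i < 2) - cov_along (cst (evec i)) nu x) *m pinvmx (jacobian f x).

End MapsInCoordinates.

(* Half the trace of the second fundamental form nabla d(phi) of the isometric
   immersion [f], the domain carrying the induced metric. *)
Definition mean_curvature_vector {R : realType} (L : R)
    (f : 'rV[R]_2 -> 'rV[R]_4) (x : 'rV[R]_2) : 'rV[R]_4 :=
  2^-1 *: metric_trace (pullback_mx f) x (nabla_d L (pullback_mx f) f x).

Section ImmersedSurfaces.
Context {R : realType} {M : topologicalType}.
Variables (S : @surface R M) (L : R).

Definition induced_metric (phi : M -> 'rV[R]_4) (c : @chart R M) :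
    'rV[R]_2 -> 'M[R]_2 := pullback_mx (phi \o cinv c).

Definition biharmonic (g : @chart R M -> 'rV[R]_2 -> 'M[R]_2)
    (phi : M -> 'rV[R]_4) : Prop :=
  forall c, atlas S c -> biharmonic_on L (g c) (phi \o cinv c) (crange c).

Record spacelike_immersion (phi : M -> 'rV[R]_4) : Prop := SpacelikeImmersion {
  simm_smooth : smooth_map S phi;
  simm_ads : forall p, ads L (phi p);
  simm_immersion : forall c, atlas S c ->
    forall x, crange c x -> row_free (jacobian (phi \o cinv c) x);
  simm_spacelike : forall c, atlas S c ->
    forall x, crange c x ->
    forall v, v != 0 -> 0 < gip (induced_metric phi c) x v v }.

Record unit_normal (phi xi : M -> 'rV[R]_4) : Prop := UnitNormal {
  unormal_smooth : smooth_map S xi;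
  unormal_tangent : forall p, mink (xi p) (phi p) = 0;
  unormal_normal : forall c, atlas S c -> forall x, crange c x ->
    forall v, mink (xi (cinv c x)) ('D_v (phi \o cinv c) x) = 0;
  unormal_unit : forall p, mink (xi p) (xi p) = -1 }.

Record conformal (gbar : riemannian_metric S) (phi : M -> 'rV[R]_4)
    (lam : M -> R) : Prop := Conformal {
  dilation_smooth : smooth_map S lam;
  dilation_gt0 : forall p, 0 < lam p;
  conformal_eq : forall c, atlas S c -> forall x, crange c x ->
    induced_metric phi c x = lam (cinv c x) ^+ 2 *: gbar c x }.

Definition scalar_mean_curvature (phi xi : M -> 'rV[R]_4) (H : M -> R) : Prop :=
  forall c, atlas S c -> forall x, crange c x ->
    mean_curvature_vector L (phi \o cinv c) x = H (cinv c x) *: xi (cinv c x).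

Definition shape_operator (phi xi : M -> 'rV[R]_4) (c : @chart R M) :
    'rV[R]_2 -> 'M[R]_2 := shape_mx L (phi \o cinv c) (xi \o cinv c).

Definition locally_totally_umbilical (phi xi : M -> 'rV[R]_4) : Prop :=
  forall p, exists U : set M, [/\ open U, U p &
    exists kappa : M -> R, forall c, atlas S c ->
      forall x, crange c x -> U (cinv c x) ->
      shape_operator phi xi c x = (kappa (cinv c x))%:M].

Record biharmonic_conformal_cmc (gbar : riemannian_metric S)
    (phi xi : M -> 'rV[R]_4) (lam : M -> R) (H : R) : Prop :=
  BiharmonicConformalCmc {
  bcc_immersion : spacelike_immersion phi;
  bcc_two_sided : unit_normal phi xi;
  bcc_conformal : conformal gbar phi lam;
  bcc_biharmonic : biharmonic gbar phi;
  bcc_cmc : scalar_mean_curvature phi xi (fun=> H);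
  bcc_cmc_neq0 : H != 0 }.

End ImmersedSurfaces.

Section StandardHyperbolicPlane.
Context {R : realType}.
Variable L : R.

(* H^2(L/sqrt 2) as the slice X_1 = L/sqrt 2 of AdS_3(L), where
   - X_0^2 + X_2^2 + X_3^2 = - L^2/2, X_0 > 0. *)
Definition std_plane : set 'rV[R]_4 :=
  [set X | [/\ ads L X, 0 < X 0 (inord 0) & X 0 (inord 1) = L / Num.sqrt 2]].

(* The normalized component tangent to AdS_3(L) of the basis vector e_1. *)
Definition std_normal (X : 'rV[R]_4) : 'rV[R]_4 :=
  Num.sqrt 2 *: delta_mx 0 (inord 1) - L^-1 *: X.

(* The inclusion of [std_plane], in the global coordinates (X_2, X_3). *)
Definition std_immersion (u : 'rV[R]_2) : 'rV[R]_4 :=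
  \row_(i < 4) [:: Num.sqrt (L ^+ 2 / 2 + u 0 0 ^+ 2 + u 0 1 ^+ 2);
                   L / Num.sqrt 2; u 0 0; u 0 1]`_i.

Definition std_metric : 'rV[R]_2 -> 'M[R]_2 := pullback_mx std_immersion.

End StandardHyperbolicPlane.

Section Congruence.
Context {R : realType} {M : topologicalType}.
Variables (S : @surface R M) (L : R).

(* After the isometry T and the choice of unit normal eps *: xi, the map phi
   is near every point a homeomorphism onto an open subset of the standard
   plane, with matching unit normals. *)
Definition congruent_to_std (phi xi : M -> 'rV[R]_4) (T : 'M[R]_4) (eps : R) :
    Prop :=
  forall p, (eps *: xi p) *m T = std_normal L (phi p *m T) /\
    exists U : set M, [/\ open U, U p,
      (forall q r, U q -> U r -> phi q *m T = phi r *m T -> q = r) &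
      (forall V : set M, open V -> V `<=` U ->
         exists2 W : set 'rV[R]_4, open W &
           [set phi q *m T | q in V] = std_plane L `&` W)].

(* T o phi = std_immersion o psi, where psi : (M, gbar) -> H^2(L/sqrt 2) is a
   homothety of constant factor lam: psi^* std_metric = lam^2 gbar.  The last
   equation makes psi a local diffeomorphism. *)
Definition homothetic_reparametrization (gbar : riemannian_metric S)
    (phi : M -> 'rV[R]_4) (lam : R) : Prop :=
  exists T, exists psi : M -> 'rV[R]_2,
    [/\ ambient_isometry T, smooth_map S psi,
        (forall p, phi p *m T = std_immersion L (psi p)) &
        forall c, atlas S c -> forall x, crange c x ->
          let J := jacobian (psi \o cinv c) x in
          J *m std_metric L (psi (cinv c x)) *m J^T = lam ^+ 2 *: gbar c x].

End Congruence.

Lemma std_immersion_range {R : realType} (L : R) :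
  0 < L -> range (std_immersion L) = std_plane L.
Proof.
move=> L0.
have s0 : (0 : R) < Num.sqrt 2 by rewrite sqrtr_gt0.
have sl : (L / Num.sqrt 2) ^+ 2 = L ^+ 2 / 2.
  by rewrite exprMn exprVn sqr_sqrtr// ler0n.
have l2 : 0 < L ^+ 2 / 2 by rewrite divr_gt0// exprn_gt0.
have i0 : (inord 0 : 'I_4) = ord0 by apply/val_inj; rewrite /= inordK.
have i1 : (inord 1 : 'I_4) = lift ord0 ord0 by apply/val_inj; rewrite /= inordK.
apply/seteqP; split=> [X [u _ <-]|X [Xads X0 X1]].
  have pos : 0 < L ^+ 2 / 2 + u 0 0 ^+ 2 + u 0 1 ^+ 2.
    by rewrite -addrA ltr_pwDl// addr_ge0// sqr_ge0.
  split.
  - rewrite /ads /= /mink !big_ord_recl big_ord0 !mxE /=.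
    set s := Num.sqrt (_ + _); have := sqr_sqrtr (ltW pos); rewrite -/s => hs.
    set l := _ / _ in sl *.
    by move: hs sl; lra.
  - by rewrite mxE i0 /= sqrtr_gt0.
  - by rewrite mxE i1.
rewrite i0 in X0; rewrite i1 in X1.
exists (\row_i [:: X 0 (inord 2); X 0 (inord 3)]`_i) => //.
have i2 : (inord 2 : 'I_4) = lift ord0 (lift ord0 ord0) by apply/val_inj; rewrite /= inordK.
have i3 : (inord 3 : 'I_4) = lift ord0 (lift ord0 (lift ord0 ord0)) by apply/val_inj; rewrite /= inordK.
move: Xads; rewrite /ads /= /mink !big_ord_recl big_ord0 /= X1 => Xads.
apply/rowP => i; rewrite !mxE /= i2 i3.
case: i => -[|[|[|[|//]]]] hi /=.
- rewrite (_ : Ordinal hi = ord0); last exact/val_inj.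
  rewrite -[RHS](gtr0_norm X0) -sqrtr_sqr; congr Num.sqrt.
  by set l := _ / _ in sl Xads; move: sl Xads; lra.
- by rewrite -X1; congr (X _ _); exact/val_inj.
- by congr (X _ _); exact/val_inj.
- by congr (X _ _); exact/val_inj.
Qed.

(* Main.v *)
Require Import Defs.
From HB Require Import structures.
From mathcomp Require Import all_boot all_order all_algebra.
From mathcomp Require Import ring lra.
From mathcomp Require Import all_classical all_reals all_analysis.

Set Implicit Arguments.
Unset Strict Implicit.
Unset Printing Implicit Defensive.

Import Order.TTheory GRing.Theory Num.Theory.
Import numFieldNormedType.Exports.

Local Open Scope classical_set_scope.
Local Open Scope ring_scope.

(** In a chart the immersion is a map [f] from a plane domain, with timelike
    unit normal [nu].  The Gauss formula and the two-dimensional conformal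
    invariance of traces of Hessians ([trace_hessian_conformal]) turn the
    tension field for [gbar] into [p nu], with [p = 2 H lam ^ 2]; the bitension
    field is then, up to a factor, the Laplacian of [p nu] for the induced metric
    minus [2 L^-2 p nu] ([bitension_conformal]).

    For constant [H] the second fundamental form has divergence zero by the
    Codazzi equation.  Hence the tangential part of the biharmonic equation says
    that the shape operator kills the gradient of [p]
    ([derive_p_det_form2]); where [p] is constant, the normal part says that the
    shape operator has squared norm [2 / L ^ 2] ([trace_form3_biharmonic]).

    Everything then rests on [principal_product]: distinct constant principal
    curvatures have product [- 1 / L ^ 2].  If [p] were not constant, the
    principal curvatures would be [0] and [2 H] on an open set, against this
    product; so [p] and [lam] are locally constant.  The principal curvatures
    now have a constant sum [2 H] and a constant sum of squares [2 / L ^ 2]; if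
    they were distinct, the value of their product would give [H = 0].  So the
    surface is umbilical with [H ^ 2 = 1 / L ^ 2] ([local_classification]), and
    the Gauss equation gives [K = - 2 / L ^ 2].

    Globally [xi - H phi] is a constant vector of norm [- 2], because [M] is
    connected.  An ambient isometry moves it, up to sign, to [sqrt 2 e1], which
    fixes the coordinate [X_1] of [phi]; as [X_0] does not vanish, [phi] lands in
    the standard plane after a possible reflection ([std_isometry_exists]).  The
    plane is a graph over [X_2], [X_3], and by the inverse function theorem these
    coordinates of [phi] form a local homeomorphism
    ([model_local_homeomorphism]).

    Conversely the unit normal of the standard plane is affine in the position.
    This makes the plane, and every homothetic reparametrization of it,
    umbilical with the principal curvature for which both parts of the bitension
    field vanish ([umbilical_biharmonic]). *)

(** * Differentiation and smoothness *)

Section Differentiation.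
Context {R : realType} {V W : normedModType R}.

(** Maps are only controlled on open sets, so differentials are transported
    along eventual equality. *)
Lemma near_eq_diff (f g : V -> W) (x : V) :
  (\near x, f x = g x) -> differentiable f x -> is_diff x g ('d f x).
Proof.
move=> fg df.
have gE : g \o shift x = cst (g x) + 'd f x +o_ 0 id.
  apply/eqaddoE/eqaddoP => _/posnumP[e].
  have /eqaddoP/(_ e%:num (gt0 _)) := diff_locally df.
  have fg0 : \forall h \near (0 : V), f (h + x) = g (h + x).
    by move: fg; rewrite [X in X -> _](near_shift 0) /= subr0.
  rewrite -(nbhs_singleton fg); apply: filterS2 fg0 => h /= fgh.
  by rewrite !fctE /= fgh.
have dg := diff_unique (diff_continuous df) gE.
apply: DiffDef => //.
by apply/diff_locallyP; rewrite dg; split=> //; exact: diff_continuous.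
Qed.

End Differentiation.

Section Schwarz.
Context {R : realType} {V : normedModType R}.

Lemma derive_line (W : normedModType R) (f : V -> W) (x u : V) (s : R) :
  differentiable f (x + s *: u) ->
  is_derive s 1 (fun t => f (x + t *: u)) ('D_u f (x + s *: u)).
Proof.
move=> df.
have dl : is_diff s (fun t : R => x + t *: u) ( *:%R^~ u).
  by apply: is_diff_eq; rewrite funeqE => t /=; rewrite add0r.
have dc : is_diff s (f \o (fun t : R => x + t *: u))
    ('d f (x + s *: u) \o *:%R^~ u).
  by apply: is_diff_comp; exact: differentiableP.
split; first by apply: diff_derivable; exact: ex_diff.
by rewrite deriveE ?diff_val; [rewrite /= scale1r deriveE|exact: ex_diff].
Qed.

(** The mean value theorem reduces the second difference to a difference of
    first derivatives, which differentiability at the single point [x]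
    controls. *)
Lemma second_difference (f : V -> R) (x u v : V) (e : R) : 0 < e ->
  (\forall y \near x, differentiable f y) -> differentiable ('D_u f) x ->
  \forall t \near (0 : R)^'+,
    `|f (x + t *: u + t *: v) - f (x + t *: u) - f (x + t *: v) + f x
      - t ^+ 2 * 'D_v ('D_u f) x| <= e * t ^+ 2.
Proof.
move=> e0 df ddf.
pose M := `|u| + `|v| + 1.
have M0 : 0 < M by rewrite ltr_wpDl// addr_ge0.
have e1 : 0 < e / (2 * M) by rewrite divr_gt0// mulr_gt0.
have /eqaddoP/(_ _ e1) := diff_locally ddf.
move=> /nbhs_ballP[d /= d0 Hd].
move: df => /nbhs_ballP[d' /= d'0 Hd'].
near=> t.
have t0 : 0 < t by near: t; exact: nbhs_right_gt.
have tM : t * M < Num.min d d'.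
  rewrite -ltr_pdivlMr//; near: t; apply: nbhs_right_lt.
  by rewrite divr_gt0// lt_min d0.
move: tM; rewrite lt_min => /andP[tMd tMd'].
have bnd (a b : R) : 0 <= a <= t -> 0 <= b <= t -> `|a *: u + b *: v| <= t * M.
  move=> /andP[a0 at_] /andP[b0 bt].
  rewrite (le_trans (ler_normD _ _))// !normrZ !ger0_norm// /M !mulrDr mulr1.
  by rewrite ler_wpDr ?(ltW t0)// lerD// ler_wpM2r.
have tt : 0 <= t <= t by rewrite lexx ltW.
have t00 : 0 <= (0 : R) <= t by rewrite lexx ltW.
have diff (a b : R) : 0 <= a <= t -> 0 <= b <= t ->
    differentiable f (x + a *: u + b *: v).
  move=> ha hb; apply: Hd'; rewrite -ball_normE /= -addrA opprD addNKr normrN.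
  exact: le_lt_trans (bnd _ _ ha hb) tMd'.
pose phi s := f (x + t *: v + s *: u) - f (x + s *: u).
have dphi s : 0 <= s <= t -> is_derive s 1 phi
   ('D_u f (x + t *: v + s *: u) - 'D_u f (x + s *: u)).
  move=> hs; apply: is_deriveB; apply: derive_line.
    by rewrite addrAC; exact: diff.
  by have := diff _ _ hs t00; rewrite scale0r addr0.
have [c /andP[c0 ct] phiE] : exists2 c, 0 <= c <= t &
    phi t - phi 0 =
      ('D_u f (x + t *: v + c *: u) - 'D_u f (x + c *: u)) * (t - 0).
  have [||c] := @MVT_segment _ phi (fun s =>
     'D_u f (x + t *: v + s *: u) - 'D_u f (x + s *: u)) 0 t (ltW t0).
  - by move=> s /itvP sI; apply: dphi; rewrite !sI.
  - apply: derivable_within_continuous => s /itvP sI.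
    by apply: ex_derive; apply: dphi; rewrite !sI.
  - by move=> /itvP cI E; exists c => //; rewrite !cI.
rewrite subr0 in phiE.
have -> : f (x + t *: u + t *: v) - f (x + t *: u) - f (x + t *: v) + f x
    = phi t - phi 0.
  by rewrite /phi !scale0r !addr0 (addrAC x (t *: v)); ring.
have ex (a b : R) : 0 <= a <= t -> 0 <= b <= t ->
   `|'D_u f (x + a *: u + b *: v) - 'D_u f x - 'd ('D_u f) x (a *: u + b *: v)|
     <= e / 2 * t.
  move=> ha hb; have := Hd (a *: u + b *: v).
  rewrite -ball_normE /= sub0r normrN => /(_ (le_lt_trans (bnd _ _ ha hb) tMd)).
  rewrite -![(_ - _) _]/(_ - _) -![(_ + _ : V -> _) _]/(_ + _) /cst /=.
  rewrite [_ + x]addrC addrA opprD addrA => /le_trans; apply.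
  have := bnd _ _ ha hb.
  rewrite -(ler_pM2l e1) => /le_trans; apply.
  have -> : e / (2 * M) * (t * M) = e / 2 * t by field; rewrite gt_eqF.
  exact: lexx.
have hc : 0 <= c <= t by rewrite c0.
have h1 := ex c t hc tt; have h2 := ex c 0 hc t00.
have lD : 'd ('D_u f) x (c *: u + t *: v)
    = 'd ('D_u f) x (c *: u) + t * 'd ('D_u f) x v by rewrite linearD !linearZ.
rewrite scale0r !addr0 in h2; rewrite lD in h1.
rewrite phiE (deriveE v ddf) [x + t *: v + _]addrAC.
set dv := 'd _ _ v in h1 *; set A := 'D_u f _ in h1 *; set B := 'D_u f _ in h2 *.
set D := 'D_u f x in h1 h2; set cu := 'd _ _ _ in h1 h2.
have -> : (A - B) * t - t ^+ 2 * dv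
    = t * ((A - D - (cu + t * dv)) - (B - D - cu)) by ring.
rewrite normrM (ger0_norm (ltW t0)) expr2 mulrCA ler_pM2l//.
rewrite (le_trans (ler_normB _ _))// (le_trans (lerD h1 h2))//.
by rewrite -mulrDl -splitr.
Unshelve. all: by end_near. Qed.

(** Both mixed derivatives are limits of the same second difference quotient. *)
Lemma schwarz (f : V -> R) (x u v : V) :
  (\forall y \near x, differentiable f y) ->
  differentiable ('D_u f) x -> differentiable ('D_v f) x ->
  'D_u ('D_v f) x = 'D_v ('D_u f) x.
Proof.
move=> df du dv; apply/eqP; rewrite -subr_eq0 -normr_le0.
apply/ler_addgt0Pl => e e0; rewrite addr0.
have e2 : 0 < e / 2 by rewrite divr_gt0.
have S1 := second_difference v e2 df du.
have S2 := second_difference u e2 df dv.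
have [t [[h1 h2] t0]] :=
  filter_ex (filterI (filterI S1 S2) (nbhs_right_gt (0 : R))).
rewrite -(ler_pM2r (exprn_gt0 2 t0)) [e in leRHS]splitr [leRHS]mulrDl.
apply: le_trans (lerD h1 h2); apply: le_trans (ler_normB _ _).
rewrite -[in leLHS](ger0_norm (ltW (exprn_gt0 2 t0))) -normrM.
rewrite (addrAC x (t *: v)).
have key (p q r s a b : R) : (b - a) * t ^+ 2 =
    (p - q - r + s - t ^+ 2 * a) - (p - r - q + s - t ^+ 2 * b) by ring.
rewrite (key (f (x + t *: u + t *: v)) (f (x + t *: u)) (f (x + t *: v)) (f x)).
exact: lexx.
Qed.

End Schwarz.

Section SmoothClosure.
Context {R : realType} {V : normedModType R}.
Variable U : set V.
Hypothesis openU : open U.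

Lemma near_open (P : V -> Prop) x : U x -> (forall y, U y -> P y) ->
  \near x, P x.
Proof. by move=> Ux UP; apply: filterS UP _; exact: open_nbhs_nbhs. Qed.

Section General.
Context {W : normedModType R}.
Implicit Types f g : V -> W.

Lemma Ck_ext k f g : (forall x, U x -> f x = g x) ->
  Ck_on k U f -> Ck_on k U g.
Proof.
elim: k f g => [|k IH] f g fg /=.
  move=> cf x Ux; rewrite /prop_for /continuous_at -(fg _ Ux).
  apply: cvg_trans (cf x Ux); apply: near_eq_cvg.
  exact: near_open.
move=> [df cf]; split=> [x Ux|v].
  by have [] := near_eq_diff (near_open Ux fg) (df x Ux).
apply: IH (cf v) => x Ux.
by apply: near_eq_derive; exact: near_open.
Qed.

Lemma CkS k f : Ck_on k.+1 U f -> Ck_on k U f.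
Proof.
elim: k f => [|k IH] f [df cf].
  by move=> x Ux; exact/differentiable_continuous/df.
by split=> // v; exact/IH/cf.
Qed.

Lemma smooth_derive f v : smooth_on U f -> smooth_on U ('D_v f).
Proof. by move=> sf k; exact: (sf k.+1).2. Qed.

Lemma smooth_diff f x : smooth_on U f -> U x -> differentiable f x.
Proof. by move=> sf Ux; exact: (sf 1%N).1. Qed.

Lemma smooth_derivable f x v : smooth_on U f -> U x -> derivable f x v.
Proof. by move=> sf Ux; exact/diff_derivable/smooth_diff. Qed.

Lemma smooth_continuous f x : smooth_on U f -> U x -> {for x, continuous f}.
Proof. by move=> sf Ux; exact/differentiable_continuous/smooth_diff. Qed.

Lemma smooth_ext f g : (forall x, U x -> f x = g x) ->
  smooth_on U f -> smooth_on U g.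
Proof. by move=> fg sf k; exact: Ck_ext (sf k). Qed.

Lemma Ck_cst k (a : W) : Ck_on k U (cst a).
Proof.
elim: k a => [|k IH] a; first by move=> x _; exact: cst_continuous.
split=> [x _|v]; first exact: differentiable_cst.
by apply: Ck_ext (IH 0) => x _; rewrite derive_cst.
Qed.

Lemma CkD k f g : Ck_on k U f -> Ck_on k U g ->
  Ck_on k U (fun x => f x + g x).
Proof.
elim: k f g => [|k IH] f g /=.
  by move=> cf cg x Ux; apply: cvgD; [exact: cf|exact: cg].
move=> [df cf] [dg cg]; split=> [x Ux|v].
  by apply: differentiableD; [exact: df|exact: dg].
apply: Ck_ext (IH _ _ (cf v) (cg v)) => x Ux; rewrite deriveD//.
  by apply: diff_derivable; exact: df.
by apply: diff_derivable; exact: dg.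
Qed.

Lemma Ck_sum (I : Type) (r : seq I) k (F : I -> V -> W) :
  (forall i, Ck_on k U (F i)) -> Ck_on k U (fun x => \sum_(i <- r) F i x).
Proof.
move=> CF; elim: r => [|i r IH].
  by apply: Ck_ext (Ck_cst k 0) => x _; rewrite big_nil.
by apply: Ck_ext (CkD (CF i) IH) => x _; rewrite big_cons.
Qed.

End General.

(** Composition with a bounded linear map [h], which enters only through its
    effect on derivatives; [h] will be a coordinate or [r |-> r *: w]. *)
Lemma Ck_comp_linear (W W' : normedModType R) (h : W -> W') k f : continuous h ->
  (forall (f : V -> W) x, differentiable f x -> differentiable (h \o f) x) ->
  (forall (f : V -> W) x v, differentiable f x -> 'D_v (h \o f) x = h ('D_v f x)) ->
  Ck_on k U f -> Ck_on k U (h \o f).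
Proof.
move=> ch dh Dh; elim: k f => [|k IH] f /=.
  by move=> cf x Ux; apply: continuous_comp; [exact: cf|exact: ch].
move=> [df cf]; split=> [x Ux|v]; first exact/dh/df.
by apply: (Ck_ext _ (IH _ (cf v))) => x Ux; rewrite Dh//; exact: df.
Qed.

Section Scalar.
Implicit Types f g : V -> R.

Lemma CkM k f g : Ck_on k U f -> Ck_on k U g ->
  Ck_on k U (fun x => f x * g x).
Proof.
elim: k f g => [|k IH] f g.
  by move=> cf cg x Ux; apply: cvgM; [exact: cf|exact: cg].
move=> Cf Cg; have [df cf] := Cf; have [dg cg] := Cg; split=> [x Ux|v].
  by apply: differentiableM; [exact: df|exact: dg].
apply: Ck_ext (CkD (IH _ _ (CkS Cf) (cg v)) (IH _ _ (CkS Cg) (cf v))) => x Ux.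
rewrite deriveM//; first by apply: diff_derivable; exact: df.
by apply: diff_derivable; exact: dg.
Qed.

Lemma CkV k f : (forall x, U x -> f x != 0) -> Ck_on k U f ->
  Ck_on k U (fun x => (f x)^-1).
Proof.
move=> f0; elim: k => [|k IH].
  by move=> cf x Ux; apply: cvgV; [exact: f0|exact: cf].
move=> Cf; have [df cf] := Cf; split=> [x Ux|v].
  by apply: differentiableV; [exact: df|exact: f0].
have Cv := IH (CkS Cf).
apply: Ck_ext (CkM (CkM (Ck_cst k (-1 : R)) (CkM Cv Cv)) (cf v)) => x Ux.
rewrite deriveV ?f0//; last by apply: diff_derivable; exact: df.
by rewrite /cst /= mulN1r -invfM -expr2.
Qed.

Lemma diff_sqrt f x : 0 < f x -> differentiable f x ->
  differentiable (fun y => Num.sqrt (f y)) x /\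
  forall v, 'D_v (fun y => Num.sqrt (f y)) x
    = (2 * Num.sqrt (f x))^-1 * 'D_v f x.
Proof.
move=> f0 df; have [dsq sqE] := is_derive1_sqrt f0.
have dsq' : differentiable (@Num.sqrt R) (f x) by exact/derivable1_diffP.
have dc : differentiable (@Num.sqrt R \o f) x by exact: differentiable_comp.
split=> // v; rewrite deriveE// diff_comp//= deriv1E//= derive1E sqE -deriveE//.
exact: mulrC.
Qed.

Lemma Ck_sqrt k f : (forall x, U x -> 0 < f x) -> Ck_on k U f ->
  Ck_on k U (fun x => Num.sqrt (f x)).
Proof.
move=> f0; elim: k => [|k IH].
  by move=> cf x Ux; apply: continuous_comp; [exact: cf|exact: sqrt_continuous].
move=> Cf; have [df cf] := Cf; split=> [x Ux|v].
  by have [] := diff_sqrt (f0 x Ux) (df x Ux).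
have Cs := CkM (Ck_cst k (2 : R)) (IH (CkS Cf)).
have s0 x : U x -> 2 * Num.sqrt (f x) != 0.
  by move=> Ux; rewrite mulf_neq0// gt_eqF// sqrtr_gt0 f0.
apply: (Ck_ext _ (CkM (CkV s0 Cs) (cf v))) => x Ux.
by have [_ ->] := diff_sqrt (f0 x Ux) (df x Ux).
Qed.

End Scalar.

Section Matrices.
Context {m n : nat}.
Implicit Type F : V -> 'M[R]_(m, n).

Lemma derive_coord F x v i j :
  derivable F x v -> 'D_v (fun y => F y i j) x = ('D_v F x) i j.
Proof. by move=> dF; rewrite (derive_mx dF) mxE. Qed.

Lemma Ck_coord k F i j : Ck_on k U F -> Ck_on k U (fun x => F x i j).
Proof.
apply: (@Ck_comp_linear _ _ (fun A : 'M[R]_(m, n) => A i j)).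
- exact: coord_continuous.
- move=> f x df; apply: differentiable_comp => //.
  exact: differentiable_coord.
- by move=> f x v df; rewrite derive_coord//; exact: diff_derivable.
Qed.

Lemma Ck_scalel (W : normedModType R) (w : W) k (p : V -> R) :
  Ck_on k U p -> Ck_on k U (fun x => p x *: w).
Proof.
move=> Cp; apply: (Ck_comp_linear (h := fun a : R => a *: w)) Cp.
- exact: scalel_continuous.
- by move=> f x df; exact: differentiableZl.
- move=> f x v df; rewrite deriveE; last exact: differentiableZl.
  by rewrite diffZl//= deriveE.
Qed.

Lemma Ck_mx k F : (forall i j, Ck_on k U (fun x => F x i j)) -> Ck_on k U F.
Proof.
move=> CF; apply: (@Ck_ext _ _
  (fun x => \sum_i \sum_j F x i j *: delta_mx i j)) => [x _|].
  by rewrite -matrix_sum_delta.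
by do 2!(apply: Ck_sum => ?); exact: Ck_scalel.
Qed.

Lemma CkZ k (p : V -> R) F : Ck_on k U p -> Ck_on k U F ->
  Ck_on k U (fun x => p x *: F x).
Proof.
move=> Cp CF; apply: Ck_mx => i j.
by apply: (Ck_ext _ (CkM Cp (Ck_coord i j CF))) => x _; rewrite mxE.
Qed.

End Matrices.

Lemma Ck_mulmx m n p k (F : V -> 'M[R]_(m, n)) (G : V -> 'M[R]_(n, p)) :
  Ck_on k U F -> Ck_on k U G -> Ck_on k U (fun x => F x *m G x).
Proof.
move=> CF CG; apply: Ck_mx => i j.
apply: (@Ck_ext _ _ (fun x => \sum_l F x i l * G x l j)) => [x _|].
  by rewrite mxE.
by apply: Ck_sum => l; apply: CkM; exact: Ck_coord.
Qed.

Lemma smooth_deriveC m n (F : V -> 'M[R]_(m, n)) x u v :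
  smooth_on U F -> U x -> 'D_u ('D_v F) x = 'D_v ('D_u F) x.
Proof.
move=> sF Ux; apply/matrixP => i j.
have sc : smooth_on U (fun x => F x i j) by move=> k; exact/Ck_coord.
have DD a b : ('D_a ('D_b F) x) i j = 'D_a ('D_b (fun x => F x i j)) x.
  rewrite -derive_coord; last exact/smooth_derivable/Ux/smooth_derive.
  apply: near_eq_derive; apply: near_open => // y Uy.
  by rewrite derive_coord//; exact: smooth_derivable.
apply: (etrans (DD u v)); apply: (etrans _ (esym (DD v u))).
apply: (schwarz (f := fun y => F y i j)).
- by apply: near_open => // y Uy; exact: smooth_diff.
- by apply: smooth_diff => //; exact: smooth_derive.
- by apply: smooth_diff => //; exact: smooth_derive.
Qed.

End SmoothClosure.

(** * The ambient bilinear form *)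

Section Mink.
Context {R : realType}.
Implicit Types X Y Z W : 'rV[R]_4.

Lemma minkC X Y : mink X Y = mink Y X.
Proof. by apply: eq_bigr => i _; rewrite mulrAC. Qed.

Lemma minkDl X Y Z : mink (X + Y) Z = mink X Z + mink Y Z.
Proof. by rewrite -big_split; apply: eq_bigr => i _; rewrite mxE mulrDr mulrDl. Qed.

Lemma minkZl a X Z : mink (a *: X) Z = a * mink X Z.
Proof.
by rewrite /mink mulr_sumr; apply: eq_bigr => i _; rewrite mxE; ring.
Qed.

Lemma minkDr X Y Z : mink Z (X + Y) = mink Z X + mink Z Y.
Proof. by rewrite minkC minkDl !(minkC _ Z). Qed.

Lemma minkZr a X Z : mink Z (a *: X) = a * mink Z X.
Proof. by rewrite minkC minkZl (minkC X). Qed.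

Lemma mink0l Z : mink 0 Z = 0.
Proof. by rewrite -(scale0r 0) minkZl mul0r. Qed.

Lemma mink0r Z : mink Z 0 = 0. Proof. by rewrite minkC mink0l. Qed.

Lemma minkNl X Z : mink (- X) Z = - mink X Z.
Proof. by rewrite -scaleN1r minkZl mulN1r. Qed.

Lemma minkNr X Z : mink Z (- X) = - mink Z X.
Proof. by rewrite minkC minkNl minkC. Qed.

Lemma mink_suml (I : Type) (r : seq I) (F : I -> 'rV[R]_4) Z :
  mink (\sum_(i <- r) F i) Z = \sum_(i <- r) mink (F i) Z.
Proof.
by elim/big_rec2: _ => [|i y x _ <-]; rewrite ?mink0l ?minkDl.
Qed.

Definition minkE := (minkDl, minkDr, minkZl, minkZr, minkNl, minkNr,
  mink0l, mink0r).

Lemma mink_delta X i :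
  mink X (delta_mx 0 i) = (if (i < 2)%N then -1 else 1) * X 0 i.
Proof.
rewrite /mink (bigD1 i)//= big1 => [|j ji]; last by rewrite mxE (negPf ji) mulr0.
by rewrite mxE !eqxx mulr1 addr0.
Qed.

Lemma mink_nondegenerate X : (forall Y, mink X Y = 0) -> X = 0.
Proof.
move=> X0; apply/rowP => i; rewrite mxE; have := X0 (delta_mx 0 i).
rewrite mink_delta => /eqP; rewrite mulf_eq0 => /orP[|/eqP//].
by case: ifP => _; rewrite ?oppr_eq0 oner_eq0.
Qed.

Lemma mink_mulmx n W (c : 'rV[R]_n) (B : 'M[R]_(n, 4)) :
  mink W (c *m B) = \sum_i c 0 i * mink W (row i B).
Proof.
rewrite mulmx_sum_row minkC mink_suml; apply: eq_bigr => i _.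
by rewrite minkZl minkC.
Qed.

(** The Gram matrix of [p, q, a, b] is block diagonal and invertible, so these
    four vectors form a basis. *)
Lemma mink_basis (p q a b : 'rV[R]_4) :
  mink p p != 0 -> mink q q != 0 -> mink p q = 0 ->
  mink p a = 0 -> mink p b = 0 -> mink q a = 0 -> mink q b = 0 ->
  mink a a * mink b b - mink a b ^+ 2 != 0 ->
  (\matrix_(i < 4) [:: p; q; a; b]`_i) \in unitmx.
Proof.
move=> pp qq pq pa pb qa qb D; rewrite -row_free_unit.
apply: inj_row_free => v v0.
have {v0}E Z : \sum_i v 0 i * mink Z ([:: p; q; a; b]`_i) = 0.
  transitivity (mink Z (v *m \matrix_(i < 4) [:: p; q; a; b]`_i)).
    by rewrite mink_mulmx; apply: eq_bigr => i _; rewrite rowK.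
  by rewrite v0 mink0r.
have {E}E Z : v 0 ord0 * mink Z p + v 0 (lift ord0 ord0) * mink Z q
   + v 0 (lift ord0 (lift ord0 ord0)) * mink Z a
   + v 0 (lift ord0 (lift ord0 (lift ord0 ord0))) * mink Z b = 0.
  by rewrite -(E Z) !big_ord_recl big_ord0 /= addr0 !addrA.
have := E p; have := E q; have := E a; have := E b.
rewrite (minkC q p) (minkC a p) (minkC a q) (minkC b p) (minkC b q) (minkC b a).
rewrite pq pa pb qa qb !mulr0 !add0r !addr0.
set v2 := v 0 _; set v3 := v 0 _; set v1 := v 0 _; set v0 := v 0 _.
move=> Eb Ea Eq Ep.
have z0 : v0 = 0 by apply/eqP; move/eqP: Ep; rewrite mulf_eq0 (negPf pp) orbF.
have z1 : v1 = 0 by apply/eqP; move/eqP: Eq; rewrite mulf_eq0 (negPf qq) orbF.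
have z2 : v2 = 0.
  apply: (mulIf D); rewrite mul0r.
  transitivity (mink b b * (v2 * mink a a + v3 * mink a b)
    - mink a b * (v2 * mink a b + v3 * mink b b)); first by ring.
  by rewrite Ea Eb !mulr0 subrr.
have z3 : v3 = 0.
  apply: (mulIf D); rewrite mul0r.
  transitivity (mink a a * (v2 * mink a b + v3 * mink b b)
    - mink a b * (v2 * mink a a + v3 * mink a b)); first by ring.
  by rewrite Ea Eb !mulr0 subrr.
apply/rowP => -[[|[|[|[|//]]]] i4]; rewrite mxE.
- by rewrite -[RHS]z0; congr (v _ _); exact: val_inj.
- by rewrite -[RHS]z1; congr (v _ _); exact: val_inj.
- by rewrite -[RHS]z2; congr (v _ _); exact: val_inj.
- by rewrite -[RHS]z3; congr (v _ _); exact: val_inj.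
Qed.

Lemma mink_orth_basis W (p q a b : 'rV[R]_4) :
  (\matrix_(i < 4) [:: p; q; a; b]`_i) \in unitmx ->
  mink W p = 0 -> mink W q = 0 -> mink W a = 0 -> mink W b = 0 -> W = 0.
Proof.
move=> B1 Wp Wq Wa Wb; apply: mink_nondegenerate => Y.
rewrite -[Y]mulmx1 -(mulVmx B1) mulmxA mink_mulmx big1// => i _.
by case: i => -[|[|[|[|//]]]] i4; rewrite rowK/= ?Wp ?Wq ?Wa ?Wb mulr0.
Qed.

End Mink.

Section DeriveRules.
Context {R : realType} {V : normedModType R}.
Implicit Types (x v : V).

Lemma derivable_coord m n (F : V -> 'M[R]_(m, n)) x v i j :
  derivable F x v -> derivable (fun y => F y i j) x v.
Proof. by move=> dF; exact: ((derivable_mxP F x v).1 dF i j). Qed.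

Lemma derive_scale m n (p : V -> R) (F : V -> 'M[R]_(m, n)) x v :
  derivable p x v -> derivable F x v ->
  is_derive x v (fun y => p y *: F y) ('D_v p x *: F x + p x *: 'D_v F x).
Proof.
move=> dp dF; have dFij i j : derivable (fun y => F y i j) x v.
  exact: derivable_coord.
have dpF : derivable (fun y => p y *: F y) x v.
  apply/derivable_mxP => i j.
  rewrite (_ : (fun _ => _) = (p * (fun y => F y i j))); last first.
    by apply/funext => y; rewrite mxE.
  exact: derivableM dp (dFij i j).
split=> //; apply/matrixP => i j.
rewrite -derive_coord// (_ : (fun _ => _) = (p * (fun y => F y i j))); last first.
  by apply/funext => y; rewrite mxE.
rewrite (deriveM dp (dFij i j)) !mxE (derive_coord i j dF) addrC /=.
by congr (_ + _); exact: mulrC.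
Qed.

Lemma derive_mull (c : R) (p : V -> R) x v :
  derivable p x v -> is_derive x v (fun y => c * p y) (c * 'D_v p x).
Proof.
move=> dp; split; first exact: (derivableZ (k := c) dp).
exact: (deriveZ c dp).
Qed.

Lemma derive_mulr (c : R) (p : V -> R) x v :
  derivable p x v -> 'D_v (fun y => p y * c) x = 'D_v p x * c.
Proof.
move=> /(derive_mull c)[_ E]; rewrite mulrC -E.
by congr ('D_v _ x); apply/funext => y; exact: mulrC.
Qed.

Lemma derive_mul (p q : V -> R) x v dp dq :
  is_derive x v p dp -> is_derive x v q dq ->
  is_derive x v (fun y => p y * q y) (dp * q x + p x * dq).
Proof.
move=> [hp <-] [hq <-]; split; first exact: derivableM hp hq.
by apply: (etrans (deriveM hp hq)); rewrite addrC mulrC.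
Qed.

Lemma derive_mink (F G : V -> 'rV[R]_4) x v :
  derivable F x v -> derivable G x v ->
  is_derive x v (fun y => mink (F y) (G y))
    (mink ('D_v F x) (G x) + mink (F x) ('D_v G x)).
Proof.
move=> dF dG; have co (H : V -> 'rV[R]_4) i : derivable H x v ->
    is_derive x v (fun y => H y 0 i) (('D_v H x) 0 i).
  by move=> dH; split; [exact: derivable_coord|exact: derive_coord].
pose c (i : 'I_4) : R := if (i < 2)%N then -1 else 1.
have dsum i : is_derive x v (fun y => c i * F y 0 i * G y 0 i)
    (c i * ('D_v F x) 0 i * G x 0 i + c i * F x 0 i * ('D_v G x) 0 i).
  apply: derive_mul (co G i dG).
  apply: is_derive_eq (derive_mul (is_derive_cst (c i) x v) (co F i dF)) _.
  by rewrite mul0r add0r.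
rewrite (_ : (fun y => mink _ _) = \sum_(i < 4)
   (fun y => c i * F y 0 i * G y 0 i)); last first.
  by apply/funext => y; rewrite fct_sumE.
by apply: is_derive_eq; rewrite /mink -big_split.
Qed.

Lemma derive_near (W : normedModType R) (f g : V -> W) x v d :
  (\near x, f x = g x) -> is_derive x v g d -> 'D_v f x = d.
Proof. by move=> fg [_ <-]; exact: near_eq_derive. Qed.

Lemma derive_comb (W : normedModType R) (f g : V -> W) x v a :
  derivable f x v -> derivable g x v ->
  is_derive x v (fun y => a *: f y + g y) (a *: 'D_v f x + 'D_v g x).
Proof.
move=> df dg; have daf : derivable (a *: f) x v by exact: derivableZ.
split; first exact: derivableD daf dg.
by rewrite -(deriveZ a df); exact: deriveD daf dg.
Qed.

Lemma derive_sum2 (W : normedModType R) (f g : V -> W) x v d e :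
  is_derive x v f d -> is_derive x v g e ->
  is_derive x v (fun y => f y + g y) (d + e).
Proof. by move=> df dg; exact: is_deriveD. Qed.

Lemma derive_lin (W : normedModType R) (F : V -> W) x a u v :
  differentiable F x ->
  'D_(a *: u + v) F x = a *: 'D_u F x + 'D_v F x.
Proof. by move=> dF; rewrite !deriveE// linearP. Qed.

Lemma smooth_mink (U : set V) (F G : V -> 'rV[R]_4) : open U ->
  smooth_on U F -> smooth_on U G -> smooth_on U (fun y => mink (F y) (G y)).
Proof.
move=> oU sF sG k; apply: Ck_sum => // i.
apply: CkM => //; last by apply: Ck_coord => //; exact: sG.
apply: CkM => //; first exact: Ck_cst.
by apply: Ck_coord => //; exact: sF.
Qed.

End DeriveRules.

(** * The curvature of anti-de Sitter space *)

Section TangentProjection.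
Context {R : realType}.
Variable L : R.
Hypothesis L0 : L != 0.
Implicit Types q u v w : 'rV[R]_4.

Lemma tprojD q u v : tproj L q (u + v) = tproj L q u + tproj L q v.
Proof. by rewrite /tproj minkDl mulrDr scalerDl addrACA. Qed.

Lemma tprojZ q a u : tproj L q (a *: u) = a *: tproj L q u.
Proof. by rewrite /tproj minkZl scalerDr scalerA mulrCA. Qed.

Lemma tproj_comb q a b u v :
  tproj L q (a *: u + b *: v) = a *: tproj L q u + b *: tproj L q v.
Proof. by rewrite tprojD !tprojZ. Qed.

Lemma tproj0 q : tproj L q 0 = 0.
Proof. by rewrite -(scale0r 0) tprojZ !scale0r. Qed.

Lemma tproj_id q u : mink u q = 0 -> tproj L q u = u.
Proof. by move=> uq; rewrite /tproj uq mulr0 scale0r addr0. Qed.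

Lemma tproj_self q : mink q q = - L ^+ 2 -> tproj L q q = 0.
Proof.
by move=> qq; rewrite /tproj qq mulrN mulVf ?expf_neq0// scaleN1r subrr.
Qed.

Lemma mink_tproj q u v : mink v q = 0 -> mink (tproj L q u) v = mink u v.
Proof. by move=> vq; rewrite /tproj !minkE (minkC q) vq mulr0 addr0. Qed.

Lemma tproj_orth q u : mink q q = - L ^+ 2 -> mink (tproj L q u) q = 0.
Proof.
by move=> qq; rewrite /tproj !minkE qq mulrAC mulrN mulVf ?expf_neq0// mulN1r subrr.
Qed.

Lemma derive_tproj (V : normedModType R) (Q F : V -> 'rV[R]_4) x a :
  derivable Q x a -> derivable F x a ->
  is_derive x a (fun y => tproj L (Q y) (F y))
    ('D_a F x + (L ^- 2 * (mink ('D_a F x) (Q x) + mink (F x) ('D_a Q x))) *: Q x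
     + (L ^- 2 * mink (F x) (Q x)) *: 'D_a Q x).
Proof.
move=> dQ dF; have [dm mE] := derive_mink dF dQ.
have [dp pE] := derive_mull (L ^- 2) dm.
have [ds sE] := derive_scale dp dQ.
split; first exact: derivableD dF ds.
by rewrite -addrA -mE -pE -sE; exact: deriveD dF ds.
Qed.

(** For the projected constant fields [nabla_a (nabla_b w)] is
    [(L ^- 2 <w, a>) b] at [q], which is constant curvature [- L ^- 2]. *)
Lemma ads_curvatureE q u v w : mink q q = - L ^+ 2 ->
  mink u q = 0 -> mink v q = 0 -> mink w q = 0 ->
  ads_curvature L q u v w
    = (L ^- 2 * mink w u) *: v - (L ^- 2 * mink w v) *: u.
Proof.
move=> qq uq vq wq.
have did a x : derivable (@id 'rV[R]_4) x a by exact: derivable_id.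
have dT z x a : is_derive x a (tproj L ^~ z)
    ((L ^- 2 * mink z a) *: x + (L ^- 2 * mink z x) *: a).
  apply: (is_derive_eq (derive_tproj (did a x) (derivable_cst z x a))).
  by rewrite derive_cst derive_id mink0l !add0r.
have DT z x a : 'D_a (tproj L ^~ z) x
    = (L ^- 2 * mink z a) *: x + (L ^- 2 * mink z x) *: a.
  by have [_ ->] := dT z x a.
have main a b : mink a q = 0 -> mink b q = 0 ->
  ads_connection L (tproj L ^~ a)
    (ads_connection L (tproj L ^~ b) (tproj L ^~ w)) q = (L ^- 2 * mink w a) *: b.
  move=> aq bq; rewrite /ads_connection.
  pose F y := (L ^- 2 * mink w (tproj L y b)) *: y
               + (L ^- 2 * mink w y) *: tproj L y b.
  rewrite (_ : (fun y => _) = (fun y => tproj L y (F y))); last first.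
    by apply/funext => y; rewrite DT.
  rewrite (tproj_id aq).
  have [dY YE] := dT b q a.
  have [dw wE] := derive_mink (derivable_cst w q a) (did a q).
  have [dwY wYE] := derive_mink (derivable_cst w q a) dY.
  have [dp pE] := derive_mull (L ^- 2) dwY.
  have [dr rE] := derive_mull (L ^- 2) dw.
  have [d1 E1] := derive_scale dp (did a q).
  have [d2 E2] := derive_scale dr dY.
  have dF : derivable F q a by exact: derivableD d1 d2.
  have FE : 'D_a F q = (L ^- 2 * mink w b) *: a + (L ^- 2 * mink w a) *: b.
    transitivity ('D_a (fun y => (L ^- 2 * mink w (tproj L y b)) *: y) q
       + 'D_a (fun y => (L ^- 2 * mink w y) *: tproj L y b) q).
      exact: deriveD d1 d2.
    rewrite E1 E2 pE rE wE wYE YE !derive_cst derive_id /cst.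
    rewrite !mink0l !add0r bq mulr0 scale0r addr0.
    by rewrite (tproj_id bq) minkZr wq !mulr0 !scale0r add0r addr0.
  have Fq : F q = (L ^- 2 * mink w b) *: q.
    by rewrite /F wq mulr0 scale0r addr0 (tproj_id bq).
  have [_ ->] := derive_tproj (did a q) dF.
  rewrite derive_id FE Fq !(tprojD, tprojZ) tproj_self// !scaler0 addr0.
  rewrite (tproj_id aq) (tproj_id bq) minkZl qq addrAC -scalerDl.
  rewrite (_ : L ^- 2 * mink w b + _ = 0) ?scale0r ?add0r//.
  by field; exact: L0.
rewrite /ads_curvature /curvature !main// /lie_bracket.
rewrite [X in _ - X](_ : _ = 0) ?subr0//.
rewrite /ads_connection !DT (tproj_id uq) (tproj_id vq) uq vq.
rewrite !mulr0 !scale0r !addr0 (minkC u v) subrr mink0r mulr0 scale0r scaler0.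
by rewrite addr0 tproj0.
Qed.

End TangentProjection.

(** * Metrics on plane domains *)

Section PlaneMetric.
Context {R : realType}.
Implicit Types (G : 'rV[R]_2 -> 'M[R]_2) (u v x : 'rV[R]_2).

Lemma sum2 (W : nmodType) (F : 'I_2 -> W) : \sum_(i < 2) F i = F 0 + F 1.
Proof.
by rewrite big_ord_recl big_ord1; congr (_ + F _); exact: val_inj.
Qed.

Lemma ord2P (k : 'I_2) : k = 0 \/ k = 1.
Proof.
by case: k => -[|[|//]] h; [left|right]; exact: val_inj.
Qed.

Lemma rV2_sum u : u = \sum_(i < 2) u 0 i *: evec i.
Proof. exact: row_sum_delta. Qed.

Definition bilinear2 (W : lmodType R) (B : 'rV[R]_2 -> 'rV[R]_2 -> W) : Prop :=
  (forall a u u' v, B (a *: u + u') v = a *: B u v + B u' v) /\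
  (forall a u v v', B u (a *: v + v') = a *: B u v + B u v').

Lemma linear_rV2 (W : lmodType R) (l : 'rV[R]_2 -> W) u :
  (forall a v v', l (a *: v + v') = a *: l v + l v') ->
  l u = u 0 0 *: l (evec 0) + u 0 1 *: l (evec 1).
Proof.
move=> ll; have l0 : l 0 = 0.
  by have := ll (-1) 0 0; rewrite scaler0 addr0 scaleN1r addNr.
rewrite [in LHS](rV2_sum u) sum2 ll; congr (_ + _).
by rewrite -[_ *: evec 1]addr0 ll l0 addr0.
Qed.

Lemma bilinear2_sum (W : lmodType R) (B : 'rV[R]_2 -> 'rV[R]_2 -> W) u v :
  bilinear2 B ->
  B u v = \sum_(i < 2) \sum_(j < 2) (u 0 i * v 0 j) *: B (evec i) (evec j).
Proof.
move=> [Bl Br]; rewrite !sum2 (linear_rV2 (l := B^~ v)); last first.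
  by move=> a y y'; exact: Bl.
have Bi i : B (evec i) v = v 0 0 *: B (evec i) (evec 0)
    + v 0 1 *: B (evec i) (evec 1).
  by apply: linear_rV2 => a y y'; exact: Br.
by rewrite !Bi !scalerDr !scalerA.
Qed.

Lemma gip_bilinear G x : bilinear2 (fun u v => gip G x u v : R^o).
Proof.
split=> [a u u' v|a u v v']; rewrite /gip.
  by rewrite !mulmxDl -!scalemxAl !mxE.
by rewrite linearP /= mulmxDr -scalemxAr !mxE.
Qed.

Lemma gip_evec G x i j : gip G x (evec i) (evec j) = G x i j.
Proof.
by rewrite /gip -rowE trmx_delta -colE !mxE.
Qed.

Lemma gip_sum G x u v : gip G x u v
  = \sum_(i < 2) \sum_(j < 2) u 0 i * v 0 j * G x i j.
Proof.
rewrite (bilinear2_sum u v (gip_bilinear G x)).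
by apply: eq_bigr => i _; apply: eq_bigr => j _; rewrite gip_evec.
Qed.

(** The rows of [P] below are the frame, and [P G P^T = 1] gives
    [P^T P = G^-1]. *)
Lemma metric_trace_frame (W : lmodType R) (B : 'rV[R]_2 -> 'rV[R]_2 -> W)
    G x (E : 'I_2 -> 'rV[R]_2) : bilinear2 B ->
  (forall a b, gip G x (E a) (E b) = (a == b)%:R) ->
  \sum_(a < 2) B (E a) (E a) = metric_trace G x B.
Proof.
move=> Bb EE; pose P := \matrix_(a < 2) E a.
have PGP : P *m G x *m P^T = 1%:M.
  apply/matrixP => a b; rewrite [RHS]mxE -EE /gip.
  rewrite !mxE; apply: eq_bigr => j _; rewrite !mxE; congr (_ * _).
  by apply: eq_bigr => k _; rewrite mxE.
have GP : G x *m (P^T *m P) = 1%:M.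
  by rewrite mulmxA; apply: mulmx1C; rewrite mulmxA.
have -> : metric_trace G x B =
    \sum_(i < 2) \sum_(j < 2) (P^T *m P) i j *: B (evec i) (evec j).
  have GU : G x \in unitmx by case: (mulmx1_unit GP).
  have <- : invmx (G x) = P^T *m P.
    by rewrite -[RHS]mul1mx -(mulVmx GU) -mulmxA GP mulmx1.
  by [].
under eq_bigr => a _ do rewrite (bilinear2_sum _ _ Bb).
rewrite exchange_big; apply: eq_bigr => i _ /=.
rewrite exchange_big; apply: eq_bigr => j _ /=.
rewrite -scaler_suml; congr (_ *: _); rewrite !mxE.
by apply: eq_bigr => a _; rewrite !mxE.
Qed.

Lemma det2 (A : 'M[R]_2) : \det A = A 0 0 * A 1 1 - A 0 1 * A 1 0.
Proof.
rewrite (expand_det_row _ 0) sum2 /cofactor !det_mx11 !mxE /= expr0 expr1 mul1r.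
rewrite mulN1r mulrN.
by congr (_ * A _ _ - _ * A _ _); exact: val_inj.
Qed.

Lemma invmx2 (A : 'M[R]_2) : \det A != 0 ->
  [/\ invmx A 0 0 = A 1 1 / \det A, invmx A 0 1 = - A 0 1 / \det A,
      invmx A 1 0 = - A 1 0 / \det A & invmx A 1 1 = A 0 0 / \det A].
Proof.
move=> A0; have AU : A \in unitmx by rewrite unitmxE unitfE.
rewrite /invmx AU !mxE /cofactor !det_mx11 !mxE /= ?expr0 ?expr1 ?addn0 ?add0n.
rewrite (_ : (-1) ^+ _ = 1); last by rewrite sqrrN expr1n.
rewrite ?mul1r ?mulN1r; split; rewrite mulrC; congr (_ / _); try congr (- _);
  by congr (A _ _); exact: val_inj.
Qed.

Lemma pos_det (A : 'M[R]_2) : A^T = A ->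
  (forall v, v != 0 -> 0 < (v *m A *m v^T) 0 0) -> 0 < A 0 0 /\ 0 < \det A.
Proof.
move=> sA pA; have gE v : (v *m A *m v^T) 0 0 = gip (fun=> A) 0 v v by [].
have A10 : A 1 0 = A 0 1 by rewrite -[in LHS]sA mxE.
have A00 : 0 < A 0 0.
  have := pA (evec 0); rewrite gE gip_evec; apply.
  apply/eqP => /rowP/(_ 0); rewrite !mxE eqxx; apply/eqP.
  by rewrite oner_eq0.
split=> //; rewrite -(pmulr_rgt0 _ A00).
have := pA (A 0 0 *: evec 1 - A 0 1 *: evec 0).
rewrite gE gip_sum !sum2 !mxE /= !mulr1 !mulr0 ?sub0r ?subr0 A10 det2 A10 => h.
rewrite (_ : _ * _ = - A 0 1 * - A 0 1 * A 0 0 + - A 0 1 * A 0 0 * A 0 1 +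
  (A 0 0 * - A 0 1 * A 0 1 + A 0 0 * A 0 0 * A 1 1)); last by ring.
apply: h; apply/eqP => /rowP/(_ 1).
rewrite !mxE /= !mulr1 !mulr0 subr0 => /eqP.
by rewrite gt_eqF.
Qed.

End PlaneMetric.

Section Christoffel.
Context {R : realType}.
Implicit Types (G : 'rV[R]_2 -> 'M[R]_2) (u v w x : 'rV[R]_2).

(** The form of a single matrix: derivatives of a metric are such matrices. *)
Definition bform (A : 'M[R]_2) u v : R := (u *m A *m v^T) 0 0.

Lemma bformE A u v : bform A u v
  = \sum_(i < 2) \sum_(j < 2) u 0 i * v 0 j * A i j.
Proof. exact: (gip_sum (fun=> A) 0). Qed.

Lemma bform_linearl A v : linear_for *%R (bform A ^~ v).
Proof. by move=> a u u'; exact: (gip_bilinear (fun=> A) 0).1. Qed.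

Lemma bform_linearr A u : linear_for *%R (bform A u).
Proof. by move=> a v v'; exact: (gip_bilinear (fun=> A) 0).2. Qed.

Lemma bform_linear u v : linear_for *%R (fun A => bform A u v).
Proof.
by move=> a A B; rewrite !bformE !sum2 !mxE /=; ring.
Qed.

Lemma derive_bform G x u v w : derivable G x w ->
  is_derive x w (fun y => bform (G y) u v) (bform ('D_w G x) u v).
Proof.
move=> dG; pose h (i j : 'I_2) y := u 0 i * v 0 j * G y i j.
have hE i j : is_derive x w (h i j) (u 0 i * v 0 j * ('D_w G x) i j).
  have [d1 d2] := derive_mull (u 0 i * v 0 j) (derivable_coord (i := i) (j := j) dG).
  split=> //; apply: (etrans d2).
  by congr (_ * _); exact: derive_coord.
rewrite (_ : (fun y => bform (G y) u v)
    = (h 0 0 + h 0 1) + (h 1 0 + h 1 1)); last first.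
  by apply/funext => y; rewrite bformE !sum2.
by rewrite bformE !sum2; do 2!apply: is_deriveD; exact: hE.
Qed.

(** The Christoffel symbols of the first kind, [D u] standing for the
    derivative of the metric in the direction [u]. *)
Definition christoffel1 (D : 'rV[R]_2 -> 'M[R]_2) u v : 'rV[R]_2 :=
  \row_k (2^-1 * (bform (D u) v (evec k) + bform (D v) u (evec k)
                  - bform (D (evec k)) u v)).

Lemma christoffel1_bilinear D : linear D -> bilinear2 (christoffel1 D).
Proof.
move=> lD; split=> [a u u' v|a u v v']; apply/rowP => k;
  by rewrite !mxE lD bform_linear !(bform_linearl, bform_linearr); ring.
Qed.

Lemma derive_linear G x : differentiable G x -> linear (fun u => 'D_u G x).
Proof. by move=> dG a u v; exact: derive_lin. Qed.

Lemma christoffelE G x u v : differentiable G x ->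
  christoffel G x u v = christoffel1 (fun u => 'D_u G x) u v *m invmx (G x).
Proof.
move=> dG; congr (_ *m _); apply/rowP => k; rewrite !mxE.
have E a b c : 'D_a (fun y => gip G y b c) x = bform ('D_a G x) b c.
  by have [_ ->] := derive_bform b c (diff_derivable (v := a) dG).
by rewrite (E u v (evec k)) (E v u (evec k)) (E (evec k) u v).
Qed.

Lemma christoffel_bilinear G x : differentiable G x ->
  bilinear2 (christoffel G x).
Proof.
move=> dG; have [bl br] := christoffel1_bilinear (derive_linear dG).
split=> [a u u' v|a u v v']; rewrite !christoffelE// (bl, br).
  by rewrite mulmxDl scalemxAl.
by rewrite mulmxDl scalemxAl.
Qed.

Lemma christoffel1_conformal (D Dg : 'rV[R]_2 -> 'M[R]_2)
    (dw : 'rV[R]_2 -> R) (G : 'M[R]_2) (w : R) u v :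
  (forall u, Dg u = dw u *: G + w *: D u) ->
  christoffel1 Dg u v = w *: christoffel1 D u v
     + 2^-1 *: (dw u *: (v *m G) + dw v *: (u *m G)
                - bform G u v *: \row_k dw (evec k)).
Proof.
move=> Dg_; have wZ A y z : bform (w *: A) y z = w * bform A y z.
  by rewrite !bformE !sum2 !mxE; ring.
have bk y k : bform G y (evec k) = \sum_j y 0 j * G j k.
  by rewrite /bform trmx_delta -colE !mxE.
by apply/rowP => k; rewrite !mxE !Dg_ !bform_linear !wZ !bk; ring.
Qed.

(** Conformal invariance special to dimension two: under [g = w G] the
    Christoffel symbols change by [(dw(u) v + dw(v) u - G(u, v) grad w) / 2w],
    whose trace vanishes there. *)
Lemma trace_christoffel_conformal G g (w : 'rV[R]_2 -> R) x :
  (\near x, g x = w x *: G x) -> differentiable g x ->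
  differentiable G x -> differentiable w x ->
  (G x)^T = G x -> \det (G x) != 0 -> w x != 0 ->
  metric_trace G x (christoffel G x)
    = w x *: metric_trace g x (christoffel g x).
Proof.
move=> gwG dg dG dw sG G0 w0.
have gx : g x = w x *: G x by exact: nbhs_singleton gwG.
have GU : G x \in unitmx by rewrite unitmxE unitfE.
have dwG u : is_derive x u (fun y => w y *: G y)
    ('D_u w x *: G x + w x *: 'D_u G x).
  by apply: derive_scale; exact: diff_derivable.
have Dg u : 'D_u g x = 'D_u w x *: G x + w x *: 'D_u G x.
  by rewrite (near_eq_derive _ gwG); have [_ ->] := dwG u.
have invg : invmx (g x) = (w x)^-1 *: invmx (G x) 
  by rewrite gx invmxZ// unitmxZ// unitfE.
pose dw' := \row_k 'D_(evec k) w x.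
pose grad := dw' *m invmx (G x).
have C1 u v := christoffel1_conformal (dw := fun u => 'D_u w x)
  (D := fun u => 'D_u G x) u v Dg.
have Cg u v : christoffel g x u v = christoffel G x u v + (2 * w x)^-1 *:
    ('D_u w x *: v + 'D_v w x *: u - bform (G x) u v *: grad).
  rewrite !christoffelE// C1 invg -scalemxAr mulmxDl scalerDr -!scalemxAl.
  rewrite scalerA mulVf// scale1r invfM scalerA; congr (_ + _ *: _).
    by rewrite mulrC.
  rewrite mulmxBl mulmxDl -!scalemxAl -!mulmxA mulmxV// !mulmx1.
  by [].
have trg (W : lmodType R) B :
    metric_trace G x B = w x *: metric_trace (W := W) g x B.
  rewrite /metric_trace scaler_sumr; apply: eq_bigr => i _.
  rewrite scaler_sumr; apply: eq_bigr => j _.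
  by rewrite scalerA invg mxE mulrA mulfV// mul1r.
rewrite -trg; apply/eqP; rewrite eq_sym -subr_eq0; apply/eqP.
rewrite /metric_trace -sumrB; under eq_bigr do rewrite -sumrB.
under eq_bigr => i _ do under eq_bigr => j _ do
  rewrite -scalerBr Cg [_ + _ - _]addrC addKr.
rewrite !sum2 /grad /dw'.
have [i00 i01 i10 i11] := invmx2 G0.
have G10 : G x 1 0 = G x 0 1 by rewrite -[in LHS]sG mxE.
have D0 := G0; rewrite det2 G10 in D0.
apply/rowP => k; rewrite !mxE sum2 !bformE !sum2.
case: (ord2P k) => ->; rewrite !mxE /= i00 i01 i10 i11 det2 G10;
  move: D0 w0 => {i00 i01 i10 i11};
  move: (G x 0 0) (G x 0 1) (G x 1 1) (w x) ('D_(evec 0) w x) ('D_(evec 1) w x);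
  by move=> a b c e d0 d1 D0 e0; field; rewrite D0 e0.
Qed.

End Christoffel.

(** * Frames and covariant derivatives along a map *)

Section SmoothFields.
Context {R : realType} {V : normedModType R}.
Variable U : set V.
Hypothesis openU : open U.

Lemma smooth_cst (W : normedModType R) (a : W) : smooth_on U (cst a).
Proof. by move=> k; exact: Ck_cst. Qed.

Lemma smoothD (W : normedModType R) (f g : V -> W) :
  smooth_on U f -> smooth_on U g -> smooth_on U (fun x => f x + g x).
Proof. by move=> sf sg k; exact: CkD. Qed.

Lemma smoothM (f g : V -> R) :
  smooth_on U f -> smooth_on U g -> smooth_on U (fun x => f x * g x).
Proof. by move=> sf sg k; exact: CkM. Qed.

Lemma smoothZ m n (p : V -> R) (F : V -> 'M[R]_(m, n)) :
  smooth_on U p -> smooth_on U F -> smooth_on U (fun x => p x *: F x).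
Proof. by move=> sp sF k; exact: CkZ. Qed.

Lemma smoothV (f : V -> R) : (forall x, U x -> f x != 0) ->
  smooth_on U f -> smooth_on U (fun x => (f x)^-1).
Proof. by move=> f0 sf k; exact: CkV. Qed.

Lemma smooth_sqrt (f : V -> R) : (forall x, U x -> 0 < f x) ->
  smooth_on U f -> smooth_on U (fun x => Num.sqrt (f x)).
Proof. by move=> f0 sf k; exact: Ck_sqrt. Qed.

Lemma smooth_coord m n (F : V -> 'M[R]_(m, n)) i j :
  smooth_on U F -> smooth_on U (fun x => F x i j).
Proof. by move=> sF k; exact: Ck_coord. Qed.

Lemma smooth_mx m n (F : V -> 'M[R]_(m, n)) :
  (forall i j, smooth_on U (fun x => F x i j)) -> smooth_on U F.
Proof. by move=> sF k; apply: Ck_mx => // i j; exact: sF. Qed.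

Lemma smooth_mulmx m n p (F : V -> 'M[R]_(m, n)) (G : V -> 'M[R]_(n, p)) :
  smooth_on U F -> smooth_on U G -> smooth_on U (fun x => F x *m G x).
Proof. by move=> sF sG k; exact: Ck_mulmx. Qed.

Lemma smooth_sum (I : Type) (r : seq I) (W : normedModType R)
    (F : I -> V -> W) :
  (forall i, smooth_on U (F i)) -> smooth_on U (fun x => \sum_(i <- r) F i x).
Proof. by move=> sF k; apply: Ck_sum => // i; exact: sF. Qed.

Lemma smooth_tproj (L : R) (Q F : V -> 'rV[R]_4) :
  smooth_on U Q -> smooth_on U F -> smooth_on U (fun y => tproj L (Q y) (F y)).
Proof.
move=> sQ sF; apply: smoothD => //; apply: smoothZ => //.
by apply: smoothM; [exact: smooth_cst|exact: smooth_mink].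
Qed.

Lemma smooth_det2 (G : V -> 'M[R]_2) :
  smooth_on U G -> smooth_on U (fun x => \det (G x)).
Proof.
move=> sG; have sc i j := smooth_coord i j sG.
apply: (@smooth_ext _ _ _ openU _
  (fun x => G x 0 0 * G x 1 1 + -1 * (G x 0 1 * G x 1 0))) => [x _|].
  by rewrite det2 mulN1r.
apply: smoothD; first exact: smoothM.
by apply: smoothM; [exact: smooth_cst|exact: smoothM].
Qed.

Lemma smooth_invmx2 (G : V -> 'M[R]_2) :
  smooth_on U G -> (forall x, U x -> \det (G x) != 0) ->
  smooth_on U (fun x => invmx (G x)).
Proof.
move=> sG G0; have sc i j := smooth_coord i j sG.
have sd := smoothV G0 (smooth_det2 sG).
have sN i j : smooth_on U (fun x => - G x i j).
  apply: (@smooth_ext _ _ _ openU _ (fun x => -1 * G x i j)) => [x _|].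
    by rewrite mulN1r.
  by apply: smoothM; [exact: smooth_cst|].
apply: smooth_mx => i j; case: (ord2P i) (ord2P j) => -> [] ->.
- apply: (@smooth_ext _ _ _ openU _ (fun x => G x 1 1 * (\det (G x))^-1)).
    by move=> x Ux; have [-> _ _ _] := invmx2 (G0 x Ux).
  exact: smoothM.
- apply: (@smooth_ext _ _ _ openU _ (fun x => - G x 0 1 * (\det (G x))^-1)).
    by move=> x Ux; have [_ -> _ _] := invmx2 (G0 x Ux).
  exact: smoothM.
- apply: (@smooth_ext _ _ _ openU _ (fun x => - G x 1 0 * (\det (G x))^-1)).
    by move=> x Ux; have [_ _ -> _] := invmx2 (G0 x Ux).
  exact: smoothM.
- apply: (@smooth_ext _ _ _ openU _ (fun x => G x 0 0 * (\det (G x))^-1)).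
    by move=> x Ux; have [_ _ _ ->] := invmx2 (G0 x Ux).
  exact: smoothM.
Qed.

End SmoothFields.

Section Frames.
Context {R : realType}.
Variables (U : set 'rV[R]_2) (G : 'rV[R]_2 -> 'M[R]_2).
Hypotheses (openU : open U) (sG : smooth_on U G).
Hypothesis symG : forall x, U x -> (G x)^T = G x.
Hypothesis posG : forall x, U x -> forall v, v != 0 -> 0 < gip G x v v.

Lemma metric_gt0 x : U x -> 0 < G x 0 0 /\ 0 < \det (G x).
Proof. by move=> Ux; exact: pos_det (symG Ux) (posG Ux). Qed.

Lemma metric_det_neq0 x : U x -> \det (G x) != 0.
Proof. by move=> /metric_gt0[_ /lt0r_neq0]. Qed.

Lemma smooth_christoffel u v : smooth_on U (fun y => christoffel G y u v).
Proof.
apply: smooth_mulmx => //; last by apply: smooth_invmx2 => //; exact: metric_det_neq0.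
have sgip a b : smooth_on U (fun y => gip G y a b).
  apply: (@smooth_ext _ _ _ openU _
    (fun y => \sum_(i < 2) \sum_(j < 2) a 0 i * b 0 j * G y i j)) => [y _|].
    by rewrite gip_sum.
  do 2!apply: smooth_sum => // ?.
  by apply: smoothM => //; [exact: smooth_cst|exact: smooth_coord].
apply: smooth_mx => // i k.
have sN (h : 'rV[R]_2 -> R) : smooth_on U h -> smooth_on U (fun y => - h y).
  move=> sh; apply: (@smooth_ext _ _ _ openU _ (fun x => -1 * h x)) => [x _|].
    by rewrite mulN1r.
  by apply: smoothM => //; exact: smooth_cst.
pose S y := 'D_u (fun y => gip G y v (evec k)) y
  + 'D_v (fun y => gip G y u (evec k)) y + - 'D_(evec k) (fun y => gip G y u v) y.
apply: (@smooth_ext _ _ _ openU _ (fun y => 2^-1 * S y)) => [y _|].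
  by rewrite [RHS]mxE.
apply: smoothM => //; first exact: smooth_cst.
apply: smoothD => //; last by apply: sN; apply: smooth_derive.
by apply: smoothD => //; apply: smooth_derive.
Qed.

(** Gram-Schmidt for the coordinate fields.  Biharmonicity quantifies over
    orthonormal frames, so it has content only where one exists. *)
Lemma orthonormal_frame_exists :
  exists E : 'I_2 -> 'rV[R]_2 -> 'rV[R]_2, orthonormal_frame G U E.
Proof.
pose E0 y : 'rV[R]_2 := (Num.sqrt (G y 0 0))^-1 *: evec 0.
pose E1 y : 'rV[R]_2 := (Num.sqrt (G y 0 0 * \det (G y)))^-1 *:
  (G y 0 0 *: evec 1 + (- 1 * G y 0 1) *: evec 0).
have p1 y : U y -> 0 < G y 0 0 * \det (G y).
  by move=> /metric_gt0[? ?]; exact: mulr_gt0.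
have sc i j : smooth_on U (fun y => G y i j) by exact: smooth_coord.
have scal (p : 'rV[R]_2 -> R) (i : 'I_2) : smooth_on U p ->
    smooth_on U (fun y => p y *: (evec i : 'rV[R]_2)).
  by move=> sp; apply: smoothZ => //; exact: smooth_cst.
exists (fun a => if a == 0 then E0 else E1); split.
  move=> a; case: (ord2P a) => -> /=.
    apply: scal; apply: smoothV => // [y Uy|].
      by rewrite gt_eqF// sqrtr_gt0; case: (metric_gt0 Uy).
    by apply: smooth_sqrt => // y /metric_gt0[].
  apply: smoothZ => //.
    apply: smoothV => // [y Uy|]; first by rewrite gt_eqF// sqrtr_gt0 p1.
    by apply: smooth_sqrt => //; apply: smoothM => //; exact: smooth_det2.
  apply: smoothD => //; apply: scal => //.
  by apply: smoothM => //; exact: smooth_cst.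
move=> y Uy a b; have [g0 d0] := metric_gt0 Uy.
have s0 := sqr_sqrtr (ltW g0); have s1 := sqr_sqrtr (ltW (p1 y Uy)).
have n0 : Num.sqrt (G y 0 0) != 0 by rewrite gt_eqF// sqrtr_gt0.
have n1 : Num.sqrt (G y 0 0 * \det (G y)) != 0.
  by rewrite gt_eqF// sqrtr_gt0 p1.
have G10 : G y 1 0 = G y 0 1 by rewrite -[in LHS](symG Uy) mxE.
rewrite /E0 /E1; move: n0 n1 s0 s1 => {sc scal p1 E0 E1}.
set s := Num.sqrt _; set t := Num.sqrt _ => n0 n1 s0 s1.
case: (ord2P a) (ord2P b) => -> [] -> /=;
  rewrite gip_sum !sum2 !mxE /= G10 ?(mulr0, mulr1, addr0, add0r, mul0r) -/s -/t.
- by rewrite -s0; field.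
- by field; rewrite n0 n1.
- by field; rewrite n0 n1.
- transitivity (t^-1 * t^-1 * t ^+ 2); last by field.
  by rewrite s1 det2 G10; ring.
Qed.

End Frames.

Section CovariantDerivatives.
Context {R : realType}.
Variables (L : R) (U : set 'rV[R]_2) (f : 'rV[R]_2 -> 'rV[R]_4).
Variables (G : 'rV[R]_2 -> 'M[R]_2).
Hypotheses (L0 : L != 0) (openU : open U) (sf : smooth_on U f).
Hypothesis fads : forall y, U y -> mink (f y) (f y) = - L ^+ 2.
Hypothesis sG : smooth_on U G.

Section SecondDerivative.
Variable Z : 'rV[R]_2 -> 'rV[R]_4.
Hypothesis sZ : smooth_on U Z.

(** The second covariant derivative of [Z] along [f]: unlike its two terms it
    is tensorial in [u] and [v]. *)
Definition ddcov x u v : 'rV[R]_4 :=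
  cov_along L f (cst u) (cov_along L f (cst v) Z) x
  - tproj L (f x) ('D_(christoffel G x u v) Z x).

Lemma cov_linear x a u v : U x -> tproj L (f x) ('D_(a *: u + v) Z x)
  = a *: tproj L (f x) ('D_u Z x) + tproj L (f x) ('D_v Z x).
Proof.
by move=> Ux; rewrite (derive_lin a u v (smooth_diff sZ Ux)) tprojD tprojZ.
Qed.

Lemma smooth_cov v : smooth_on U (cov_along L f (cst v) Z).
Proof. by apply: smooth_tproj => //; exact: smooth_derive. Qed.

Lemma ddcov_bilinear x : U x -> bilinear2 (ddcov x).
Proof.
move=> Ux; have [bl br] := christoffel_bilinear (smooth_diff sG Ux).
have cl a u v := cov_linear a u v Ux.
split=> [a u u' v|a u v v'].
  rewrite /ddcov bl; move: (christoffel G x u v) (christoffel G x u' v) => g g'.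
  rewrite cl scalerBr addrACA -opprD; congr (_ - _).
  have dc := smooth_diff (smooth_cov v) Ux.
  rewrite /cov_along /= -/(cov_along L f (cst v) Z).
  by rewrite (derive_lin a u u' dc) tprojD tprojZ.
rewrite /ddcov br; move: (christoffel G x u v) (christoffel G x u v') => g g'.
rewrite cl scalerBr addrACA -opprD; congr (_ - _).
rewrite /cov_along -tprojZ -tprojD; congr (tproj _ _ _) => /=.
have dv := smooth_derivable (v := u) (smooth_cov v) Ux.
have dv' := smooth_derivable (v := u) (smooth_cov v') Ux.
apply: (derive_near _ (derive_comb a dv dv')).
by apply: near_open Ux _ => // y Uy; exact: cov_linear.
Qed.

(** The derivatives of the frame cancel against the first term of
    [levi_civita G (E a) (E a)], so that the rough Laplacian is a trace. *)
Lemma rough_laplacianE (V : set 'rV[R]_2) E x : open V -> V `<=` U ->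
  orthonormal_frame G V E -> V x ->
  rough_laplacian L G f E Z x = metric_trace G x (ddcov x).
Proof.
move=> oV VU [sE oE] Vx; have Ux := VU _ Vx.
rewrite -(metric_trace_frame (ddcov_bilinear Ux) (oE x Vx)).
apply: eq_bigr => a _; set e := E a x.
have dE := smooth_derivable (v := e) (sE a) Vx.
have [C CE] : exists C : 'I_2 -> 'rV[R]_2 -> 'rV[R]_4,
  forall i, C i = cov_along L f (cst (evec i)) Z by eexists.
have sC i : smooth_on U (C i) by rewrite CE; exact: smooth_cov.
have cl y v : U y -> tproj L (f y) ('D_v Z y)
    = v 0 0 *: C 0 y + v 0 1 *: C 1 y.
  move=> Uy; rewrite !CE.
  apply: (linear_rV2 (l := fun v => tproj L (f y) ('D_v Z y))).
  by move=> a' u' v'; exact: cov_linear.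
have dEC i : is_derive x e (fun y => E a y 0 i *: C i y)
    (('D_e (E a) x) 0 i *: C i x + e 0 i *: 'D_e (C i) x).
  rewrite -(derive_coord 0 i dE); apply: derive_scale.
    exact: derivable_coord.
  exact: smooth_derivable (sC i) Ux.
have -> : cov_along L f (E a) (cov_along L f (E a) Z) x =
   tproj L (f x) (('D_e (E a) x) 0 0 *: C 0 x + ('D_e (E a) x) 0 1 *: C 1 x)
   + (e 0 0 *: tproj L (f x) ('D_e (C 0) x)
      + e 0 1 *: tproj L (f x) ('D_e (C 1) x)).
  have near_sum : \forall y \near x, cov_along L f (E a) Z y
      = E a y 0 0 *: C 0 y + E a y 0 1 *: C 1 y.
    by apply: near_open Vx _ => // y Vy; rewrite /cov_along cl//; exact: VU.
  rewrite {1}/cov_along -/e.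
  have DE := derive_near near_sum (derive_sum2 (dEC 0) (dEC 1)).
  apply: (etrans (congr1 (tproj L (f x)) DE)).
  have alg (p p' q q' : R) (c c' d d' : 'rV[R]_4) :
      tproj L (f x) (p *: c + q *: d + (p' *: c' + q' *: d'))
      = tproj L (f x) (p *: c + p' *: c')
        + (q *: tproj L (f x) d + q' *: tproj L (f x) d').
    by rewrite addrACA tprojD [X in _ + X]tprojD !tprojZ.
  exact: alg.
have tC i : tproj L (f x) (C i x) = C i x.
  by rewrite tproj_id// CE /cov_along tproj_orth// fads.
have tCC p p' : tproj L (f x) (p *: C 0 x + p' *: C 1 x)
    = p *: C 0 x + p' *: C 1 x.
  by rewrite tproj_comb !tC.
rewrite tCC.
have -> : cov_along L f (levi_civita G (E a) (E a)) Z x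
  = ('D_e (E a) x) 0 0 *: C 0 x + ('D_e (E a) x) 0 1 *: C 1 x
    + tproj L (f x) ('D_(christoffel G x e e) Z x).
  rewrite -cl// /cov_along /levi_civita -/e.
  move: ('D_e (E a) x) (christoffel G x e e) => p q.
  by have := cov_linear 1 p q Ux; rewrite !scale1r.
have DC : cov_along L f (cst e) (cov_along L f (cst e) Z) x
  = e 0 0 *: tproj L (f x) ('D_e (C 0) x)
    + e 0 1 *: tproj L (f x) ('D_e (C 1) x).
  have near_sum : \forall y \near x, cov_along L f (cst e) Z y
      = e 0 0 *: C 0 y + e 0 1 *: C 1 y.
    by apply: near_open Ux _ => // y Uy; exact: cl.
  have d0 := smooth_derivable (v := e) (sC 0) Ux.
  have d1 := smooth_derivable (v := e) (sC 1) Ux.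
  have dc c : derivable (C c) x e -> is_derive x e (fun y => e 0 c *: C c y)
     (e 0 c *: 'D_e (C c) x).
    by move=> dC; split; [exact: (derivableZ (k := e 0 c) dC)|exact: deriveZ].
  have DE := derive_near near_sum (derive_sum2 (dc 0 d0) (dc 1 d1)).
  apply: (etrans (congr1 (tproj L (f x)) DE)).
  have alg (q q' : R) (d d' : 'rV[R]_4) : tproj L (f x) (q *: d + q' *: d')
      = q *: tproj L (f x) d + q' *: tproj L (f x) d' by rewrite tprojD !tprojZ.
  exact: alg.
rewrite /ddcov DC.
have alg (a1 a2 a3 : 'rV[R]_4) : a1 + a2 - (a1 + a3) = a2 - a3.
  by rewrite opprD addrACA subrr add0r.
exact: alg.
Qed.

End SecondDerivative.

Lemma nabla_dE x u v : nabla_d L G f x u v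
  = tproj L (f x) ('D_u ('D_v f) x) - 'D_(christoffel G x u v) f x.
Proof.
rewrite /nabla_d /levi_civita; congr (_ - 'D_(_) f x).
by rewrite derive_cst add0r.
Qed.

End CovariantDerivatives.

(** * Spacelike patches and the Gauss formula *)

(** A two-sided spacelike immersion into AdS, read in one chart. *)
Record spacelike_patch (R : realType) (L : R) (U : set 'rV[R]_2)
    (f nu : 'rV[R]_2 -> 'rV[R]_4) : Prop := SpacelikePatch {
  patch_L : L != 0;
  patch_open : open U;
  patch_f : smooth_on U f;
  patch_nu : smooth_on U nu;
  patch_ads : forall x, U x -> mink (f x) (f x) = - L ^+ 2;
  patch_tangent : forall x, U x -> mink (nu x) (f x) = 0;
  patch_normal : forall x, U x -> forall v, mink (nu x) ('D_v f x) = 0;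
  patch_unit : forall x, U x -> mink (nu x) (nu x) = -1;
  patch_pos : forall x, U x -> forall v, v != 0 ->
    0 < gip (pullback_mx f) x v v }.

Section Patch.
Context {R : realType}.
Variables (L : R) (U : set 'rV[R]_2) (f nu : 'rV[R]_2 -> 'rV[R]_4).
Hypothesis P : spacelike_patch L U f nu.
Implicit Types (x u v w : 'rV[R]_2).

Let openU := patch_open P.
Let sf := patch_f P.
Let sn := patch_nu P.

Definition form1 x u v : R := mink ('D_u f x) ('D_v f x).
(** As [nu] has norm [-1], this is the coefficient of [nu] in the Gauss formula;
    for [A = - D nu] it is minus the form of the shape operator. *)
Definition form2 x u v : R := mink ('D_u nu x) ('D_v f x).
Definition form3 x u v : R := mink ('D_u nu x) ('D_v nu x).

Lemma derive_mink_eq (F G : 'rV[R]_2 -> 'rV[R]_4) (p : 'rV[R]_2 -> R) x v :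
  smooth_on U F -> smooth_on U G ->
  (forall y, U y -> mink (F y) (G y) = p y) -> U x ->
  'D_v p x = mink ('D_v F x) (G x) + mink (F x) ('D_v G x).
Proof.
move=> sF sG Ep Ux; apply: derive_near; last first.
  by apply: derive_mink; exact: smooth_derivable Ux.
by apply: near_open Ux _ => // y Uy; rewrite Ep.
Qed.

Lemma derive_mink_cst (F G : 'rV[R]_2 -> 'rV[R]_4) (c : R) x v :
  smooth_on U F -> smooth_on U G ->
  (forall y, U y -> mink (F y) (G y) = c) -> U x ->
  mink (F x) ('D_v G x) = - mink ('D_v F x) (G x).
Proof.
move=> sF sG Ec Ux; have := derive_mink_eq v sF sG Ec Ux.
by rewrite (derive_cst c) => /esym/eqP; rewrite addr_eq0 => /eqP ->; rewrite opprK.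
Qed.

Lemma mink_f_df x v : U x -> mink (f x) ('D_v f x) = 0.
Proof.
move=> Ux; have := derive_mink_cst v sf sf (patch_ads P) Ux.
rewrite minkC => /eqP; rewrite -addr_eq0 -mulr2n mulrn_eq0 /= => /eqP.
by rewrite minkC.
Qed.

Lemma mink_f_ddf x u v : U x -> mink (f x) ('D_u ('D_v f) x) = - form1 x u v.
Proof.
move=> Ux; apply: (derive_mink_cst (c := 0)) Ux => // [|y Uy].
  exact: smooth_derive.
exact: mink_f_df.
Qed.

Lemma mink_nu_dnu x v : U x -> mink (nu x) ('D_v nu x) = 0.
Proof.
move=> Ux; have := derive_mink_cst v sn sn (patch_unit P) Ux.
rewrite minkC => /eqP; rewrite -addr_eq0 -mulr2n mulrn_eq0 /= => /eqP.
by rewrite minkC.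
Qed.

Lemma mink_f_dnu x v : U x -> mink (f x) ('D_v nu x) = 0.
Proof.
move=> Ux; rewrite minkC -[LHS]opprK.
rewrite -(derive_mink_cst v sn sf (patch_tangent P) Ux).
by rewrite (patch_normal P) ?oppr0.
Qed.

Lemma mink_nu_ddf x u v : U x -> mink (nu x) ('D_u ('D_v f) x) = - form2 x u v.
Proof.
move=> Ux; apply: (derive_mink_cst (c := 0)) Ux => // [|y Uy].
  exact: smooth_derive.
exact: (patch_normal P).
Qed.

Lemma mink_nu_ddnu x u v : U x -> mink (nu x) ('D_u ('D_v nu) x) = - form3 x u v.
Proof.
move=> Ux; apply: (derive_mink_cst (c := 0)) Ux => // [|y Uy].
  exact: smooth_derive.
exact: mink_nu_dnu.
Qed.

Lemma form1C x u v : form1 x u v = form1 x v u. Proof. exact: minkC. Qed.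

Lemma form3C x u v : form3 x u v = form3 x v u. Proof. exact: minkC. Qed.

Lemma ddfC x u v : U x -> 'D_u ('D_v f) x = 'D_v ('D_u f) x.
Proof. exact: smooth_deriveC. Qed.

Lemma form2C x u v : U x -> form2 x u v = form2 x v u.
Proof.
move=> Ux; apply: oppr_inj; apply: (etrans (esym (mink_nu_ddf u v Ux))).
apply: (etrans _ (mink_nu_ddf v u Ux)).
exact: (congr1 (mink (nu x)) (ddfC u v Ux)).
Qed.

Lemma bilinear2_mink (F G : 'rV[R]_2 -> 'rV[R]_4) x :
  differentiable F x -> differentiable G x ->
  bilinear2 (fun u v => mink ('D_u F x) ('D_v G x) : R^o).
Proof.
move=> dF dG; split=> [a u u' v|a u v v'].
  by rewrite (derive_lin a u u' dF) minkDl minkZl.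
by rewrite (derive_lin a v v' dG) minkDr minkZr.
Qed.

Let g := pullback_mx f.

Lemma gip_pullback_diff (h : 'rV[R]_2 -> 'rV[R]_4) x u v :
  differentiable h x -> gip (pullback_mx h) x u v = mink ('D_u h x) ('D_v h x).
Proof.
move=> dh; rewrite gip_sum.
apply: (etrans _ (esym (bilinear2_sum u v (bilinear2_mink dh dh)))).
by apply: eq_bigr => i _; apply: eq_bigr => j _; rewrite mxE.
Qed.

Lemma gip_pullback x u v : U x -> gip g x u v = form1 x u v.
Proof. by move=> Ux; apply: gip_pullback_diff; exact: smooth_diff Ux. Qed.

Lemma pullbackE x i j : g x i j = form1 x (evec i) (evec j).
Proof. exact: mxE. Qed.

Lemma smooth_pullback : smooth_on U g.
Proof.
apply: smooth_mx => // i j.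
apply: (@smooth_ext _ _ _ openU _
  (fun x => mink ('D_(evec i) f x) ('D_(evec j) f x))) => [x _|].
  by rewrite pullbackE.
by apply: smooth_mink => //; exact: smooth_derive.
Qed.

Lemma pullback_sym x : (g x)^T = g x.
Proof. by apply/matrixP => i j; rewrite mxE !pullbackE form1C. Qed.

Lemma pullback_det x : U x -> 0 < \det (g x).
Proof. by move=> Ux; have [] := pos_det (pullback_sym x) (patch_pos P Ux). Qed.

Lemma pullback_gram x : \det (g x)
  = form1 x (evec 0) (evec 0) * form1 x (evec 1) (evec 1)
    - form1 x (evec 0) (evec 1) ^+ 2.
Proof.
have E10 : g x 1 0 = g x 0 1.
  by rewrite -[in LHS](pullback_sym x) mxE.
by rewrite det2 E10 -expr2 (pullbackE x 0 0) (pullbackE x 1 1) (pullbackE x 0 1).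
Qed.

Lemma patch_basis x : U x -> (\matrix_(i < 4)
  [:: f x; nu x; 'D_(evec 0) f x; 'D_(evec 1) f x]`_i) \in unitmx.
Proof.
move=> Ux; apply: mink_basis.
- by rewrite (patch_ads P)// oppr_eq0 expf_neq0// (patch_L P).
- by rewrite (patch_unit P)// oppr_eq0 oner_eq0.
- by rewrite minkC (patch_tangent P).
- exact: mink_f_df.
- exact: mink_f_df.
- exact: (patch_normal P).
- exact: (patch_normal P).
- by rewrite -pullback_gram//; apply: lt0r_neq0; exact: pullback_det.
Qed.

(** [f], [nu] and the two coordinate fields span the ambient space. *)
Lemma patch_ext x X Y : U x ->
  mink X (f x) = mink Y (f x) -> mink X (nu x) = mink Y (nu x) ->
  (forall v, mink X ('D_v f x) = mink Y ('D_v f x)) -> X = Y.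
Proof.
move=> Ux Ef En Ed; apply/eqP; rewrite -subr_eq0; apply/eqP.
apply: (mink_orth_basis (patch_basis Ux)); rewrite minkDl minkNl.
- by rewrite Ef subrr.
- by rewrite En subrr.
- by rewrite Ed subrr.
- by rewrite Ed subrr.
Qed.

(** The Koszul formula for the metric [<D f, D f>]. *)
Lemma christoffel_pullback x u v w : U x ->
  form1 x (christoffel g x u v) w = mink ('D_u ('D_v f) x) ('D_w f x).
Proof.
move=> Ux; have dg := smooth_diff smooth_pullback Ux.
have gU : g x \in unitmx.
  by rewrite unitmxE unitfE; apply: lt0r_neq0; exact: pullback_det.
have [m mE] : exists m : 'rV[R]_2 -> 'rV[R]_2 -> 'rV[R]_2 -> R,
  forall a b c, m a b c = mink ('D_a ('D_b f) x) ('D_c f x) by eexists.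
have mC a b c : m a b c = m b a c.
  apply: (etrans (mE _ _ _)); apply: (etrans _ (esym (mE _ _ _))).
  exact: (congr1 (fun X => mink X ('D_c f x)) (ddfC a b Ux)).
have Dg a b c : bform ('D_a g x) b c = m a b c + m a c b.
  have [_ <-] := derive_bform b c (diff_derivable (v := a) dg).
  apply: etrans (f_equal2 +%R (esym (mE a b c))
    (etrans (minkC _ _) (esym (mE a c b)))).
  apply: derive_mink_eq Ux; [exact: smooth_derive|exact: smooth_derive|].
  by move=> y Uy; rewrite -[RHS]/(gip g y b c) gip_pullback.
have key k : form1 x (christoffel g x u v) (evec k)
    = mink ('D_u ('D_v f) x) ('D_(evec k) f x).
  rewrite -gip_pullback// christoffelE// /gip mulmxKV// trmx_delta -colE !mxE.
  apply: (etrans (f_equal3 (fun p q r => 2^-1 * (p + q - r))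
    (Dg u v (evec k)) (Dg v u (evec k)) (Dg (evec k) u v))).
  apply: etrans (mE u v (evec k)).
  rewrite (mC v u (evec k)) (mC (evec k) u v) (mC (evec k) v u).
  by move: (m _ _ _) (m _ _ _) (m _ _ _) => p q r; field.
have df := smooth_diff sf Ux.
have l1 a y z : form1 x (christoffel g x u v) (a *: y + z)
  = a *: (form1 x (christoffel g x u v) y : R^o) + form1 x (christoffel g x u v) z.
  exact: (bilinear2_mink df df).2.
have l2 a y z : mink ('D_u ('D_v f) x) ('D_(a *: y + z) f x)
  = a *: (mink ('D_u ('D_v f) x) ('D_y f x) : R^o) + mink ('D_u ('D_v f) x) ('D_z f x).
  by rewrite (derive_lin a y z df) minkDr minkZr.
rewrite (linear_rV2 w l1); apply: (etrans _ (esym (linear_rV2 w l2))).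
by rewrite !key.
Qed.

(** The Christoffel term is the tangential part, by the Koszul formula; the
    last term is normal to AdS. *)
Lemma gauss_formula x u v : U x -> 'D_u ('D_v f) x =
  'D_(christoffel g x u v) f x + form2 x u v *: nu x
  + (L ^- 2 * form1 x u v) *: f x.
Proof.
move=> Ux; have L0 := patch_L P.
apply: (patch_ext Ux) => [||w]; rewrite !minkDl !minkZl.
- have e1 : mink ('D_u ('D_v f) x) (f x) = - form1 x u v.
    by rewrite minkC; exact: mink_f_ddf.
  have e2 y : mink ('D_y f x) (f x) = 0 by rewrite minkC; exact: mink_f_df.
  by rewrite e1 e2 (patch_tangent P)// (patch_ads P)//; field.
- have e1 : mink ('D_u ('D_v f) x) (nu x) = - form2 x u v.
    by rewrite minkC; exact: mink_nu_ddf.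
  have e2 y : mink ('D_y f x) (nu x) = 0.
    by rewrite minkC; exact: (patch_normal P).
  by rewrite e1 e2 (patch_unit P)// (minkC (f x)) (patch_tangent P)//; ring.
- rewrite (patch_normal P)// mink_f_df// -/(form1 _ _ _) christoffel_pullback//.
  by ring.
Qed.

End Patch.

(** * Codazzi equation and bitension field *)

Section MetricTrace.
Context {R : realType}.
Implicit Types (G : 'rV[R]_2 -> 'M[R]_2) (x : 'rV[R]_2).

Lemma eq_metric_trace (W : lmodType R) G x (B C : 'rV[R]_2 -> 'rV[R]_2 -> W) :
  (forall i j, B (evec i) (evec j) = C (evec i) (evec j)) ->
  metric_trace G x B = metric_trace G x C.
Proof. by move=> BC; do 2!apply: eq_bigr => ? _; rewrite BC. Qed.

Lemma metric_traceD (W : lmodType R) G x (B C : 'rV[R]_2 -> 'rV[R]_2 -> W) :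
  metric_trace G x (fun u v => B u v + C u v)
    = metric_trace G x B + metric_trace G x C.
Proof.
rewrite -big_split; apply: eq_bigr => i _; rewrite -big_split.
by apply: eq_bigr => j _; rewrite scalerDr.
Qed.

Lemma metric_traceZ (W : lmodType R) G x a (B : 'rV[R]_2 -> 'rV[R]_2 -> W) :
  metric_trace G x (fun u v => a *: B u v) = a *: metric_trace G x B.
Proof.
rewrite scaler_sumr; apply: eq_bigr => i _; rewrite scaler_sumr.
by apply: eq_bigr => j _; rewrite !scalerA mulrC.
Qed.

Lemma metric_traceN (W : lmodType R) G x (B : 'rV[R]_2 -> 'rV[R]_2 -> W) :
  metric_trace G x (fun u v => - B u v) = - metric_trace G x B.
Proof.
rewrite -scaleN1r -metric_traceZ; apply: eq_metric_trace => i j.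
by rewrite scaleN1r.
Qed.

Lemma metric_trace_linear (W W' : lmodType R) G x (l : W -> W')
    (B : 'rV[R]_2 -> 'rV[R]_2 -> W) :
  (forall a u v, l (a *: u + v) = a *: l u + l v) ->
  l (metric_trace G x B) = metric_trace G x (fun u v => l (B u v)).
Proof.
move=> ll; have l0 : l 0 = 0.
  by have := ll (-1) 0 0; rewrite scaler0 addr0 scaleN1r addNr.
have lD u v : l (u + v) = l u + l v by have := ll 1 u v; rewrite !scale1r.
have lZ a u : l (a *: u) = a *: l u by have := ll a u 0; rewrite l0 !addr0.
by rewrite /metric_trace !sum2 !lD !lZ.
Qed.

Lemma mink_metric_trace G x (B : 'rV[R]_2 -> 'rV[R]_2 -> 'rV[R]_4) X :
  mink (metric_trace G x B) X
  = metric_trace G x (fun u v => mink (B u v) X : R^o).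
Proof.
apply: (metric_trace_linear G x (l := fun Y => mink Y X : R^o)) => a Y Y'.
by rewrite minkDl minkZl.
Qed.

Lemma metric_trace_scalel (W : lmodType R) G x (n : W)
    (b : 'rV[R]_2 -> 'rV[R]_2 -> R^o) :
  metric_trace G x (fun u v => b u v *: n) = metric_trace G x b *: n.
Proof.
apply/esym/(@metric_trace_linear R^o W G x (fun a : R^o => a *: n)) => a u v.
by rewrite scalerDl scalerA.
Qed.

Lemma metric_trace_conformal (W : lmodType R) G g (a : R) x
    (B : 'rV[R]_2 -> 'rV[R]_2 -> W) :
  g x = a *: G x -> a != 0 -> G x \in unitmx ->
  metric_trace G x B = a *: metric_trace g x B.
Proof.
move=> gx a0 GU; have invg : invmx (g x) = a^-1 *: invmx (G x).
  by rewrite gx invmxZ// unitmxZ// unitfE.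
rewrite /metric_trace scaler_sumr; apply: eq_bigr => i _.
rewrite scaler_sumr; apply: eq_bigr => j _.
by rewrite scalerA invg mxE mulrA mulfV// mul1r.
Qed.

(** [Q] stands for second derivatives and [l] for the differential of a map: the
    Christoffel symbols of [G] and [g] have the same trace up to the factor [w]. *)
Lemma trace_hessian_conformal (W : lmodType R) G g (w : 'rV[R]_2 -> R) x
    (Q : 'rV[R]_2 -> 'rV[R]_2 -> W) (l : 'rV[R]_2 -> W) :
  (forall a u v, l (a *: u + v) = a *: l u + l v) ->
  (\near x, g x = w x *: G x) -> differentiable g x ->
  differentiable G x -> differentiable w x ->
  (G x)^T = G x -> \det (G x) != 0 -> w x != 0 ->
  metric_trace G x (fun u v => Q u v - l (christoffel G x u v))
  = w x *: metric_trace g x (fun u v => Q u v - l (christoffel g x u v)).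
Proof.
move=> ll gG dg dG dw sG G0 w0; have gx := nbhs_singleton gG.
have GU : G x \in unitmx by rewrite unitmxE unitfE.
rewrite -(metric_trace_conformal _ gx w0 GU).
rewrite !metric_traceD !metric_traceN.
rewrite -(@metric_trace_linear _ _ G x l (christoffel G x))//.
rewrite -(@metric_trace_linear _ _ G x l (christoffel g x))//.
congr (_ - l _); rewrite (trace_christoffel_conformal gG)//.
by rewrite (metric_trace_conformal _ gx w0 GU).
Qed.

End MetricTrace.

Section Tension.
Context {R : realType}.
Variables (L : R) (U : set 'rV[R]_2) (f nu : 'rV[R]_2 -> 'rV[R]_4).
Hypothesis P : spacelike_patch L U f nu.
Implicit Types (x u v : 'rV[R]_2).
Local Notation g := (pullback_mx f).

(** Twice the mean curvature in the direction [nu]. *)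
Definition trace2 x : R := metric_trace g x (form2 f nu x : _ -> _ -> R^o).

Lemma tproj_ddf x u v : U x -> tproj L (f x) ('D_u ('D_v f) x)
  = 'D_(christoffel g x u v) f x + form2 f nu x u v *: nu x.
Proof.
move=> Ux; rewrite (gauss_formula P u v Ux).
have df y : mink ('D_y f x) (f x) = 0 by rewrite minkC (mink_f_df P).
move: (df (christoffel g x u v)); move: ('D_(_) f x) => X Xf.
rewrite !tprojD !tprojZ (tproj_self (patch_L P) (patch_ads P Ux)) scaler0 addr0.
by rewrite (tproj_id _ Xf) (tproj_id _ (patch_tangent P Ux)).
Qed.

Lemma nabla_d_induced x u v : U x ->
  nabla_d L g f x u v = form2 f nu x u v *: nu x.
Proof.
move=> Ux; rewrite nabla_dE tproj_ddf//.
by move: ('D_(_) f x) => X; rewrite addrAC subrr add0r.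
Qed.

Lemma mean_curvature_patch x : U x ->
  mean_curvature_vector L f x = (2^-1 * trace2 x) *: nu x.
Proof.
move=> Ux; rewrite /mean_curvature_vector -scalerA; congr (_ *: _).
rewrite -metric_trace_scalel; apply: eq_metric_trace => i j.
exact: nabla_d_induced.
Qed.

Lemma form2_linearl x a u u' v : U x ->
  form2 f nu x (a *: u + u') v = a * form2 f nu x u v + form2 f nu x u' v.
Proof.
move=> Ux; exact: (bilinear2_mink (smooth_diff (patch_nu P) Ux)
  (smooth_diff (patch_f P) Ux)).1.
Qed.

Lemma form1_linearl x a u u' v : U x ->
  form1 f x (a *: u + u') v = a * form1 f x u v + form1 f x u' v.
Proof.
move=> Ux; exact: (bilinear2_mink (smooth_diff (patch_f P) Ux)
  (smooth_diff (patch_f P) Ux)).1.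
Qed.

(** [D_w nu] is tangent, so it only sees the tangential part of the Gauss
    formula. *)
Lemma form2_christoffel x u v w : U x ->
  form2 f nu x (christoffel g x u v) w = mink ('D_w nu x) ('D_u ('D_v f) x).
Proof.
move=> Ux; apply: (etrans (form2C P _ _ Ux)).
apply: (etrans _ (congr1 (mink _) (esym (gauss_formula P u v Ux)))).
have n1 := mink_nu_dnu P w Ux; have n2 := mink_f_dnu P w Ux.
rewrite minkC in n1; rewrite minkC in n2.
rewrite /form2; move: (form1 f x u v) (mink ('D_u nu x) _) => a b.
move: ('D_w nu x) ('D_(_) f x) n1 n2 => X Y n1 n2.
by rewrite !minkDr !minkZr n1 n2 !mulr0 !addr0.
Qed.

Lemma form2_christoffelC x u v w : U x ->
  form2 f nu x (christoffel g x u v) w = form2 f nu x (christoffel g x v u) w.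
Proof.
move=> Ux; apply: (etrans (form2_christoffel u v w Ux)).
apply: (etrans _ (esym (form2_christoffel v u w Ux))).
exact: (congr1 (mink _) (ddfC P u v Ux)).
Qed.

(** The covariant derivative of [form2], by [derive_form2]; written in this way
    it is visibly symmetric in [u] and [v]. *)
Definition cov_form2 x u v w : R :=
  mink ('D_u ('D_v nu) x) ('D_w f x)
  - form2 f nu x (christoffel g x u v) w.

Lemma derive_form2 x u v w : U x ->
  'D_u (fun y => form2 f nu y v w) x = cov_form2 x u v w
    + form2 f nu x (christoffel g x u v) w
    + form2 f nu x (christoffel g x u w) v.
Proof.
move=> Ux; rewrite /cov_form2 subrK form2_christoffel//.
apply: (derive_mink_eq P) Ux => //; apply: smooth_derive.
  exact: patch_nu P.
exact: patch_f P.
Qed.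

Lemma cov_form2C x u v w : U x -> cov_form2 x u v w = cov_form2 x v u w.
Proof.
move=> Ux; apply: (f_equal2 (fun a b : R => a - b)) (form2_christoffelC u v w Ux).
apply: (congr1 (fun X => mink X ('D_w f x))).
exact: (smooth_deriveC (patch_open P) _ _ (patch_nu P)).
Qed.

(** The symmetry of [form2] passes to its covariant derivative; with
    [cov_form2C] this is total symmetry, the Codazzi equation. *)
Lemma codazzi_equation x u v w : U x -> cov_form2 x u v w = cov_form2 x u w v.
Proof.
move=> Ux; have E : 'D_u (fun y => form2 f nu y v w) x
    = 'D_u (fun y => form2 f nu y w v) x.
  apply: near_eq_derive; apply: (near_open (patch_open P) Ux) => y Uy.
  exact: (form2C P).
have := etrans (esym (derive_form2 u v w Ux)) (etrans E (derive_form2 u w v Ux)).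
have alg (a b c d : R) : a + c + d = b + d + c -> a = b.
  by rewrite -!addrA [d + c]addrC => /addIr.
exact: alg.
Qed.

Lemma metric_trace2E x (B : 'rV[R]_2 -> 'rV[R]_2 -> R) : U x ->
  (forall u v, B u v = B v u) ->
  metric_trace g x (B : _ -> _ -> R^o)
  = (B (evec 0) (evec 0) * form1 f x (evec 1) (evec 1)
     - 2 * B (evec 0) (evec 1) * form1 f x (evec 0) (evec 1)
     + B (evec 1) (evec 1) * form1 f x (evec 0) (evec 0)) / \det (g x).
Proof.
move=> Ux BC; have [i00 i01 i10 i11] := invmx2 (lt0r_neq0 (pullback_det P Ux)).
have E10 : g x 1 0 = g x 0 1 by rewrite -[in LHS](pullback_sym f x) mxE.
rewrite /metric_trace !sum2 i00 i01 i10 i11 E10 (BC (evec 1) (evec 0)).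
rewrite (pullbackE f x 0 0) (pullbackE f x 1 1) (pullbackE f x 0 1).
move: (B _ _) (B _ _) (B _ _) (form1 f x _ _) (form1 f x _ _) (form1 f x _ _).
move=> b00 b01 b11 g11 g01 g00; move: (\det _)^-1 => d.
by rewrite /GRing.scale /=; ring.
Qed.

Lemma trace2E x : U x -> trace2 x * \det (g x)
  = form2 f nu x (evec 0) (evec 0) * form1 f x (evec 1) (evec 1)
     - 2 * form2 f nu x (evec 0) (evec 1) * form1 f x (evec 0) (evec 1)
     + form2 f nu x (evec 1) (evec 1) * form1 f x (evec 0) (evec 0).
Proof.
move=> Ux; have d0 := lt0r_neq0 (pullback_det P Ux).
apply: (etrans (congr1 ( *%R^~ (\det (g x)))
  (metric_trace2E Ux (fun u v => form2C P u v Ux)))).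
exact: divfK.
Qed.

Lemma derive_trace_relation (b00 b01 b11 g00 g01 g11 : 'rV[R]_2 -> R) t x k
    (db00 db01 db11 dg00 dg01 dg11 : R) :
  is_derive x k b00 db00 -> is_derive x k b01 db01 -> is_derive x k b11 db11 ->
  is_derive x k g00 dg00 -> is_derive x k g01 dg01 -> is_derive x k g11 dg11 ->
  (\forall y \near x, b00 y * g11 y + (-2 * b01 y) * g01 y + b11 y * g00 y
    = t * (g00 y * g11 y + (-1 * g01 y) * g01 y)) ->
  db00 * g11 x + b00 x * dg11 - 2 * (db01 * g01 x + b01 x * dg01)
    + (db11 * g00 x + b11 x * dg00)
  = t * (dg00 * g11 x + g00 x * dg11 - 2 * g01 x * dg01).
Proof.
move=> hb00 hb01 hb11 hg00 hg01 hg11 E.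
have mull (c : R) p dp : is_derive x k p dp -> is_derive x k (fun y => c * p y) (c * dp).
  by move=> [dP <-]; exact: derive_mull.
have hl := derive_sum2 (derive_sum2 (derive_mul hb00 hg11)
  (derive_mul (mull (-2) _ _ hb01) hg01)) (derive_mul hb11 hg00).
have hr := mull t _ _ (derive_sum2 (derive_mul hg00 hg11)
  (derive_mul (mull (-1) _ _ hg01) hg01)).
have := derive_near E hr; have [_ ->] := hl => El; lra.
Qed.

(** The [p i j] are the coordinates of the Christoffel symbols, and [t] is the
    trace of [b] with respect to [g]. *)
Lemma contracted_codazzi_algebra (t b00 b01 b11 g00 g01 g11 c00 c01 c11
    p00 p01 p10 p11 m00 m01 m10 m11 n00 n01 n10 n11 : R) :
  m00 = p00 * g00 + p01 * g01 -> m01 = p00 * g01 + p01 * g11 ->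
  m10 = p10 * g00 + p11 * g01 -> m11 = p10 * g01 + p11 * g11 ->
  n00 = p00 * b00 + p01 * b01 -> n01 = p00 * b01 + p01 * b11 ->
  n10 = p10 * b00 + p11 * b01 -> n11 = p10 * b01 + p11 * b11 ->
  t * (g00 * g11 - g01 ^+ 2) = b00 * g11 - 2 * b01 * g01 + b11 * g00 ->
  (c00 + n00 + n00) * g11 + b00 * (m11 + m11)
    - 2 * ((c01 + n01 + n10) * g01 + b01 * (m01 + m10))
    + ((c11 + n11 + n11) * g00 + b11 * (m00 + m00))
  = t * ((m00 + m00) * g11 + g00 * (m11 + m11) - 2 * g01 * (m01 + m10)) ->
  c00 * g11 - 2 * c01 * g01 + c11 * g00 = 0.
Proof.
move=> -> -> -> -> -> -> -> -> N K.
transitivity (((c00 + (p00 * b00 + p01 * b01) + (p00 * b00 + p01 * b01)) * g11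
  + b00 * ((p10 * g01 + p11 * g11) + (p10 * g01 + p11 * g11))
    - 2 * ((c01 + (p00 * b01 + p01 * b11) + (p10 * b00 + p11 * b01)) * g01
      + b01 * ((p00 * g01 + p01 * g11) + (p10 * g00 + p11 * g01)))
    + ((c11 + (p10 * b01 + p11 * b11) + (p10 * b01 + p11 * b11)) * g00
      + b11 * ((p00 * g00 + p01 * g01) + (p00 * g00 + p01 * g01))))
  - 2 * (p00 + p11) * (b00 * g11 - 2 * b01 * g01 + b11 * g00)).
  by ring.
by rewrite K -N; ring.
Qed.

(** By the Codazzi equation the divergence of the second fundamental form is the
    differential of its trace. *)
Lemma codazzi_trace x k (t : R) : U x -> (forall y, U y -> trace2 y = t) ->
  metric_trace g x (fun u v => cov_form2 x u v k : R^o) = 0.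
Proof.
move=> Ux tr; have openU := patch_open P; have sf := patch_f P.
have alg1 (a b c d e h : R) : t * (d * h - e ^+ 2) = a * h - 2 * b * e + c * d ->
    a * h + (-2 * b) * e + c * d = t * (d * h + (-1 * e) * e).
  by rewrite expr2; lra.
have sn := patch_nu P.
have hg i j : is_derive x k (fun y => form1 f y (evec i) (evec j))
    (form1 f x (christoffel g x k (evec i)) (evec j)
     + form1 f x (christoffel g x k (evec j)) (evec i)).
  rewrite !(christoffel_pullback P)// [X in _ + X]minkC.
  apply: derive_mink; apply: smooth_derivable Ux; exact: smooth_derive.
have hb i j : is_derive x k (fun y => form2 f nu y (evec i) (evec j))
    (cov_form2 x k (evec i) (evec j)
    + form2 f nu x (christoffel g x k (evec i)) (evec j)
    + form2 f nu x (christoffel g x k (evec j)) (evec i)).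
  have E := derive_form2 k (evec i) (evec j) Ux.
  split; last exact: E.
  have [D _] := derive_mink
    (smooth_derivable (v := k) (smooth_derive (evec i) sn) Ux)
    (smooth_derivable (v := k) (smooth_derive (evec j) sf) Ux).
  exact: D.
have key := derive_trace_relation (t := t) (hb 0 0) (hb 0 1) (hb 1 1)
  (hg 0 0) (hg 0 1) (hg 1 1).
have tr_near : \forall y \near x,
    form2 f nu y (evec 0) (evec 0) * form1 f y (evec 1) (evec 1)
    + (-2 * form2 f nu y (evec 0) (evec 1)) * form1 f y (evec 0) (evec 1)
    + form2 f nu y (evec 1) (evec 1) * form1 f y (evec 0) (evec 0)
   = t * (form1 f y (evec 0) (evec 0) * form1 f y (evec 1) (evec 1)
       + (-1 * form1 f y (evec 0) (evec 1)) * form1 f y (evec 0) (evec 1)).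
  apply: (near_open openU Ux) => y Uy.
  have := trace2E Uy; rewrite (tr y Uy) (pullback_gram f y).
  move: (form1 f y _ _) (form1 f y _ _) (form1 f y _ _).
  move: (form2 f nu y _ _) (form2 f nu y _ _) (form2 f nu y _ _).
  by move=> *; exact: alg1.
move: key => /(_ tr_near) key; clear tr_near hg hb.
have N := trace2E Ux; rewrite (tr x Ux) (pullback_gram f x) in N.
have E1 i j : form1 f x (christoffel g x k (evec i)) (evec j)
  = christoffel g x k (evec i) 0 0 * form1 f x (evec 0) (evec j)
    + christoffel g x k (evec i) 0 1 * form1 f x (evec 1) (evec j).
  apply: (linear_rV2 (l := fun u => form1 f x u (evec j) : R^o)) => a u v.
  exact: form1_linearl.
have E2 i j : form2 f nu x (christoffel g x k (evec i)) (evec j)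
  = christoffel g x k (evec i) 0 0 * form2 f nu x (evec 0) (evec j)
    + christoffel g x k (evec i) 0 1 * form2 f nu x (evec 1) (evec j).
  apply: (linear_rV2 (l := fun u => form2 f nu x u (evec j) : R^o)) => a u v.
  exact: form2_linearl.
have E10 i : form1 f x (christoffel g x k (evec i)) (evec 0)
  = christoffel g x k (evec i) 0 0 * form1 f x (evec 0) (evec 0)
    + christoffel g x k (evec i) 0 1 * form1 f x (evec 0) (evec 1).
  exact: (etrans (E1 i 0) (congr1 (fun z => _ + _ * z) (form1C f x _ _))).
have E20 i : form2 f nu x (christoffel g x k (evec i)) (evec 0)
  = christoffel g x k (evec i) 0 0 * form2 f nu x (evec 0) (evec 0)
    + christoffel g x k (evec i) 0 1 * form2 f nu x (evec 0) (evec 1).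
  exact: (etrans (E2 i 0) (congr1 (fun z => _ + _ * z) (form2C P _ _ Ux))).
have -> : metric_trace g x (fun u v => cov_form2 x u v k : R^o)
  = metric_trace g x (fun u v => cov_form2 x k u v : R^o).
  apply: eq_metric_trace => i j.
  exact: (etrans (codazzi_equation _ _ _ Ux) (cov_form2C _ _ _ Ux)).
apply: (etrans (metric_trace2E Ux (fun u v => codazzi_equation k u v Ux))).
have Z := contracted_codazzi_algebra (E10 0) (E1 0 1) (E10 1) (E1 1 1)
  (E20 0) (E2 0 1) (E20 1) (E2 1 1) N key.
by apply: (etrans (congr1 ( *%R^~ _) Z)); exact: mul0r.
Qed.

Section Conformal.
Variables (G : 'rV[R]_2 -> 'M[R]_2) (w : 'rV[R]_2 -> R).
Hypotheses (sw : smooth_on U w) (w_gt0 : forall x, U x -> 0 < w x).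
Hypothesis gwG : forall x, U x -> g x = w x *: G x.

Let openU := patch_open P.
Let w0 x : U x -> w x != 0. Proof. by move=> /w_gt0/lt0r_neq0. Qed.

Let GE x : U x -> G x = (w x)^-1 *: g x.
Proof. by move=> Ux; rewrite gwG// scalerA mulVf ?w0// scale1r. Qed.

Lemma conformal_smooth : smooth_on U G.
Proof.
apply: (@smooth_ext _ _ _ openU _ (fun x => (w x)^-1 *: g x)) => [x Ux|].
  by rewrite GE.
apply: smoothZ => //; last exact: smooth_pullback P.
exact: smoothV.
Qed.

Lemma conformal_sym x : U x -> (G x)^T = G x.
Proof. by move=> Ux; rewrite GE// linearZ /= pullback_sym. Qed.

Lemma conformal_pos x : U x -> forall v, v != 0 -> 0 < gip G x v v.
Proof.
move=> Ux v v0; have := patch_pos P Ux v0.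
by rewrite /gip gwG// -scalemxAr -scalemxAl mxE pmulr_rgt0 ?w_gt0.
Qed.

Lemma conformal_det x : U x -> \det (G x) != 0.
Proof.
by move=> Ux; exact: lt0r_neq0 (pos_det (conformal_sym Ux) (conformal_pos Ux)).2.
Qed.

Lemma conformal_near x : U x -> \near x, g x = w x *: G x.
Proof. by move=> Ux; apply: near_open Ux _. Qed.

Lemma trace_hessian_patch (W : lmodType R) x
    (Q : 'rV[R]_2 -> 'rV[R]_2 -> W) (l : 'rV[R]_2 -> W) : U x ->
  (forall a u v, l (a *: u + v) = a *: l u + l v) ->
  metric_trace G x (fun u v => Q u v - l (christoffel G x u v))
  = w x *: metric_trace g x (fun u v => Q u v - l (christoffel g x u v)).
Proof.
move=> Ux ll; apply: trace_hessian_conformal => //.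
- exact: conformal_near.
- exact: smooth_diff (smooth_pullback P) Ux.
- exact: smooth_diff conformal_smooth Ux.
- exact: smooth_diff sw Ux.
- exact: conformal_sym.
- exact: conformal_det.
- exact: w0.
Qed.

Lemma tension_conformal x : U x ->
  tension L G f x = (w x * trace2 x) *: nu x.
Proof.
move=> Ux; have df := smooth_diff (patch_f P) Ux.
transitivity (metric_trace G x (fun u v => tproj L (f x) ('D_u ('D_v f) x)
    - (fun u => 'D_u f x) (christoffel G x u v))).
  by apply: eq_metric_trace => i j; rewrite nabla_dE.
rewrite trace_hessian_patch//; last by move=> a u v; exact: derive_lin.
rewrite -scalerA; congr (_ *: _); rewrite -metric_trace_scalel.
apply: eq_metric_trace => i j.
by apply: etrans (nabla_d_induced (evec i) (evec j) Ux); rewrite nabla_dE.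
Qed.

(** For a tension field [p nu], the rough Laplacian is conformally covariant and
    the curvature term is [2 L^-2 w p nu]. *)
Lemma bitension_conformal (p : 'rV[R]_2 -> R) (V : set 'rV[R]_2) E x :
  smooth_on U p -> (forall y, U y -> tension L G f y = p y *: nu y) ->
  open V -> V `<=` U -> orthonormal_frame G V E -> V x ->
  bitension L G f E x
  = w x *: (metric_trace g x (ddcov L f g (fun y => p y *: nu y) x)
            - (2 * L ^- 2 * p x) *: nu x).
Proof.
move=> sp tE oV VU oE Vx; have Ux := VU _ Vx.
have sZ : smooth_on U (fun y => p y *: nu y).
  by apply: smoothZ => //; exact: patch_nu P.
have st : smooth_on U (tension L G f).
  by apply: (smooth_ext openU _ sZ) => y Uy; rewrite tE.
rewrite /bitension scalerBr; congr (_ - _).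
  rewrite (rough_laplacianE (patch_L P) openU (patch_f P) (patch_ads P)
    conformal_smooth st oV VU oE Vx).
  have tC v y : U y -> cov_along L f (cst v) (tension L G f) y
      = cov_along L f (cst v) (fun y => p y *: nu y) y.
    move=> Uy; apply: (congr1 (tproj L (f y))).
    apply: near_eq_derive; apply: (near_open openU Uy) => z Uz; exact: tE.
  transitivity (metric_trace G x (fun u v =>
      cov_along L f (cst u) (cov_along L f (cst v) (fun y => p y *: nu y)) x
      - (fun u => tproj L (f x) ('D_u (fun y => p y *: nu y) x))
          (christoffel G x u v))).
    apply: eq_metric_trace => i j; apply: (f_equal2 (fun a b : 'rV[R]_4 => a - b)).
      apply: (congr1 (tproj L (f x))).
      apply: near_eq_derive; apply: (near_open openU Ux) => z Uz; exact: tC.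
    exact: (tC (christoffel G x (evec i) (evec j)) x Ux).
  apply: (@trace_hessian_patch _ x (fun u v =>
      cov_along L f (cst u) (cov_along L f (cst v) (fun y => p y *: nu y)) x)
    (fun u => tproj L (f x) ('D_u (fun y => p y *: nu y) x)) Ux) => a u v.
  by rewrite (derive_lin a u v (smooth_diff sZ Ux)) tprojD tprojZ.
have oEx a b := oE.2 x Vx a b.
have curv a : ads_curvature L (f x) ('D_(E a x) f x) (tension L G f x)
    ('D_(E a x) f x) = (L ^- 2 * w x * p x) *: nu x.
  have fE : mink ('D_(E a x) f x) (f x) = 0 by rewrite minkC; exact: (mink_f_df P).
  have IE : mink ('D_(E a x) f x) ('D_(E a x) f x) = w x.
    rewrite -[LHS]/(form1 f x (E a x) (E a x)) -(gip_pullback P)// /gip gwG//.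
    by rewrite -scalemxAr -scalemxAl mxE -/(gip G x _ _) oEx eqxx mulr1.
  have nE := patch_normal P Ux (E a x).
  rewrite minkC in nE.
  move: ('D_(E a x) f x) fE IE nE => X fE IE nE; rewrite tE//.
  rewrite ads_curvatureE ?(patch_L P) ?(patch_ads P)//; last first.
    by rewrite minkZl (patch_tangent P)// mulr0.
  by rewrite IE minkZr nE !mulr0 scale0r subr0 scalerA.
apply: (etrans (eq_bigr _ (fun a _ => curv a))).
rewrite big_const_ord /= addr0 -scalerDl scalerA; congr (_ *: _).
by ring.
Qed.

End Conformal.

Section NormalField.
Variable p : 'rV[R]_2 -> R.
Hypothesis sp : smooth_on U p.
Local Notation Z := (fun y => p y *: nu y).

Let openU := patch_open P.
Let sf := patch_f P.
Let sn := patch_nu P.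

Lemma derive_normal x v : U x -> 'D_v Z x = 'D_v p x *: nu x + p x *: 'D_v nu x.
Proof.
move=> Ux; have [_ E] := derive_scale (smooth_derivable (v := v) sp Ux)
  (smooth_derivable (v := v) sn Ux).
exact: E.
Qed.

Lemma cov_normal x v : U x ->
  cov_along L f (cst v) Z x = 'D_v p x *: nu x + p x *: 'D_v nu x.
Proof.
move=> Ux; apply: (etrans (congr1 (tproj L (f x)) (derive_normal v Ux))).
apply: tproj_id; have := mink_f_dnu P v Ux; rewrite minkC.
move: ('D_v nu x) => X Xf.
by rewrite minkDl !minkZl Xf (patch_tangent P)// !mulr0 addr0.
Qed.

Lemma derive_cov_normal x u v : U x -> 'D_u (cov_along L f (cst v) Z) x
  = 'D_u ('D_v p) x *: nu x + 'D_v p x *: 'D_u nu x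
    + ('D_u p x *: 'D_v nu x + p x *: 'D_u ('D_v nu) x).
Proof.
move=> Ux.
have nE : \forall y \near x, cov_along L f (cst v) Z y
    = 'D_v p y *: nu y + p y *: 'D_v nu y.
  by apply: (near_open openU Ux) => y Uy; exact: cov_normal.
apply: (derive_near nE); apply: derive_sum2; apply: derive_scale.
- exact: smooth_derivable (smooth_derive v sp) Ux.
- exact: smooth_derivable sn Ux.
- exact: smooth_derivable sp Ux.
- exact: smooth_derivable (smooth_derive v sn) Ux.
Qed.

Lemma mink_ddcov_f x u v : U x -> mink (ddcov L f g Z x u v) (f x) = 0.
Proof.
move=> Ux; have alg A B : mink (tproj L (f x) A - tproj L (f x) B) (f x) = 0.
  by rewrite minkDl minkNl !(tproj_orth (patch_L P)) ?subrr// (patch_ads P).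
exact: alg.
Qed.

Lemma mink_ddcov x u v X : U x -> mink X (f x) = 0 ->
  mink (ddcov L f g Z x u v) X
  = 'D_u ('D_v p) x * mink (nu x) X + 'D_v p x * mink ('D_u nu x) X
    + ('D_u p x * mink ('D_v nu x) X + p x * mink ('D_u ('D_v nu) x) X)
    - ('D_(christoffel g x u v) p x * mink (nu x) X
       + p x * mink ('D_(christoffel g x u v) nu x) X).
Proof.
move=> Ux Xf; have alg A B : mink (tproj L (f x) A - tproj L (f x) B) X
    = mink A X - mink B X.
  by rewrite minkDl minkNl !(mink_tproj _ _ Xf).
apply: (etrans (alg _ _)); apply: (f_equal2 (fun a b : R => a - b)).
  apply: (etrans (congr1 (mink^~ X) (derive_cov_normal u v Ux))).
  have expand (a b c d : R) (A B C D : 'rV[R]_4) :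
      mink (a *: A + b *: B + (c *: C + d *: D)) X
      = a * mink A X + b * mink B X + (c * mink C X + d * mink D X).
    by rewrite !minkDl !minkZl.
  exact: expand.
apply: (etrans (congr1 (mink^~ X) (derive_normal _ Ux))).
have expand (a b : R) (A B : 'rV[R]_4) :
    mink (a *: A + b *: B) X = a * mink A X + b * mink B X.
  by rewrite minkDl !minkZl.
exact: expand.
Qed.

(** With [mink_ddcov_df], the normal and tangential parts of the second covariant
    derivative of [p nu]. *)
Lemma mink_ddcov_nu x u v : U x -> mink (ddcov L f g Z x u v) (nu x)
  = - ('D_u ('D_v p) x - 'D_(christoffel g x u v) p x) - p x * form3 nu x u v.
Proof.
move=> Ux; apply: (etrans (mink_ddcov u v Ux (patch_tangent P Ux))).
have n1 y : mink ('D_y nu x) (nu x) = 0 by rewrite minkC; exact: (mink_nu_dnu P).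
have n2 : mink ('D_u ('D_v nu) x) (nu x) = - form3 nu x u v.
  by rewrite minkC; exact: (mink_nu_ddnu P).
have alg (a b c d e k0 k1 k2 k3 n z : R) : n = -1 -> k0 = 0 -> k1 = 0 ->
    k2 = - z -> k3 = 0 ->
    a * n + b * k0 + (c * k1 + d * k2) - (e * n + d * k3) = - (a - e) - d * z.
  by move=> -> -> -> -> ->; ring.
exact: (alg _ _ _ _ _ _ _ _ _ _ _ (patch_unit P Ux) (n1 u) (n1 v) n2 (n1 _)).
Qed.

Lemma mink_ddcov_df x u v k : U x -> mink (ddcov L f g Z x u v) ('D_k f x)
  = 'D_v p x * form2 f nu x u k + 'D_u p x * form2 f nu x v k
    + p x * cov_form2 x u v k.
Proof.
move=> Ux; have fk : mink ('D_k f x) (f x) = 0.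
  by rewrite minkC; exact: (mink_f_df P).
apply: (etrans (mink_ddcov u v Ux fk)); rewrite /cov_form2.
have alg (a b c d e k0 k1 k2 k3 n : R) : n = 0 ->
    a * n + b * k0 + (c * k1 + d * k2) - (e * n + d * k3)
    = b * k0 + c * k1 + d * (k2 - k3) by move=> ->; ring.
exact: (alg _ _ _ _ _ _ _ _ _ _ (patch_normal P Ux k)).
Qed.

End NormalField.
End Tension.

(** * Gauss equation and constant principal curvatures *)

Section Reals.
Context {R : realType}.
Implicit Types a b : R.

Lemma mulr_eq0l a b : b != 0 -> a * b = 0 -> a = 0.
Proof. by move=> b0 /eqP; rewrite mulf_eq0 (negPf b0) orbF => /eqP. Qed.

Lemma sqr_gt0 a : a != 0 -> 0 < a ^+ 2.
Proof. by move=> a0; rewrite exprn_even_gt0. Qed.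

End Reals.

Section Umbilic.
Context {R : realType}.
Variables (L : R) (U : set 'rV[R]_2) (f nu : 'rV[R]_2 -> 'rV[R]_4).
Hypothesis P : spacelike_patch L U f nu.
Implicit Types (x u v k : 'rV[R]_2).
Local Notation g := (pullback_mx f).

Let openU := patch_open P.
Let sf := patch_f P.
Let sn := patch_nu P.

(** By the Gauss formula the derivative of [f] along its Christoffel field is
    [D_v D_w f] up to normal terms; this identity is differentiated along [u]
    and paired with [D_k f]. *)
Lemma form1_levi_civita x u v w k : U x ->
  form1 f x (levi_civita g (cst u) (fun y => christoffel g y v w) x) k
  = mink ('D_u ('D_v ('D_w f)) x) ('D_k f x)
    - form2 f nu x v w * form2 f nu x u k
    - L ^- 2 * form1 f x v w * form1 f x u k.
Proof.
move=> Ux; set Y := fun y => christoffel g y v w.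
have sg := smooth_pullback P.
have sY : smooth_on U Y.
  apply: smooth_christoffel => // [y Uy|y Uy]; first exact: pullback_sym.
  exact: patch_pos P y Uy.
have dY := smooth_derivable (v := u) sY Ux.
have fY y : U y -> 'D_(Y y) f y
    = Y y 0 0 *: 'D_(evec 0) f y + Y y 0 1 *: 'D_(evec 1) f y.
  move=> Uy; apply: (linear_rV2 (l := fun v => 'D_v f y)) => a z z'.
  exact: derive_lin (smooth_diff sf Uy).
have DfY : is_derive x u (fun y => Y y 0 0 *: 'D_(evec 0) f y
      + Y y 0 1 *: 'D_(evec 1) f y)
    (('D_u Y x) 0 0 *: 'D_(evec 0) f x + Y x 0 0 *: 'D_u ('D_(evec 0) f) x
     + (('D_u Y x) 0 1 *: 'D_(evec 1) f x + Y x 0 1 *: 'D_u ('D_(evec 1) f) x)).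
  rewrite -!(derive_coord _ _ dY).
  apply: derive_sum2; apply: derive_scale; try exact: derivable_coord;
    exact: smooth_derivable (smooth_derive _ sf) Ux.
have near1 : \forall y \near x, 'D_v ('D_w f) y
    = Y y 0 0 *: 'D_(evec 0) f y + Y y 0 1 *: 'D_(evec 1) f y
      + (form2 f nu y v w *: nu y + (L ^- 2 * form1 f y v w) *: f y).
  apply: (near_open openU Ux) => y Uy.
  by rewrite -(fY y Uy) addrA; exact: (gauss_formula P).
have s1 : smooth_on U (fun y => form1 f y v w).
  by apply: smooth_mink => //; exact: smooth_derive.
have s2 : smooth_on U (fun y => form2 f nu y v w).
  by apply: smooth_mink => //; exact: smooth_derive.
have d2 := derive_scale (smooth_derivable (v := u) s2 Ux)
  (smooth_derivable (v := u) sn Ux).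
have [dl dlE] := derive_mull (L ^- 2) (smooth_derivable (v := u) s1 Ux).
have d1 := derive_scale dl (smooth_derivable (v := u) sf Ux).
have E := derive_near near1 (derive_sum2 DfY (derive_sum2 d2 d1)).
have fk := mink_f_df P k Ux; have nk := patch_normal P Ux k.
have Yl : form1 f x (levi_civita g (cst u) Y x) k
  = ('D_u Y x) 0 0 * form1 f x (evec 0) k + ('D_u Y x) 0 1 * form1 f x (evec 1) k
    + (Y x 0 0 * mink ('D_u ('D_(evec 0) f) x) ('D_k f x)
       + Y x 0 1 * mink ('D_u ('D_(evec 1) f) x) ('D_k f x)).
  have l1 (y : 'rV[R]_2) : form1 f x y k
      = y 0 0 * form1 f x (evec 0) k + y 0 1 * form1 f x (evec 1) k.
    apply: (linear_rV2 (l := fun y => form1 f x y k : R^o)) => a z z'.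
    exact: (form1_linearl P).
  have l2 (y : 'rV[R]_2) : form1 f x (christoffel g x u y) k
      = y 0 0 * mink ('D_u ('D_(evec 0) f) x) ('D_k f x)
        + y 0 1 * mink ('D_u ('D_(evec 1) f) x) ('D_k f x).
    apply: (etrans _ (f_equal2 +%R
      (congr1 ( *%R (y 0 0)) (christoffel_pullback P u (evec 0) k Ux))
      (congr1 ( *%R (y 0 1)) (christoffel_pullback P u (evec 1) k Ux)))).
    apply: (linear_rV2 (l := fun y => form1 f x (christoffel g x u y) k : R^o)).
    move=> a z z'; have cb := (christoffel_bilinear (smooth_diff sg Ux)).2.
    apply: (etrans (congr1 (fun z => form1 f x z k) (cb a u z z'))).
    exact: (form1_linearl P).
  have := form1_linearl P 1 ('D_u Y x) (christoffel g x u (Y x)) k Ux.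
  rewrite scale1r mul1r => E1; apply: (etrans E1).
  by apply: (f_equal2 +%R); [exact: l1|exact: l2].
apply: (etrans Yl); have := congr1 (mink^~ ('D_k f x)) E.
have expand (a0 a1 y0 y1 c c' e e' : R) (F0 F1 G0 G1 N N' X X' K : 'rV[R]_4) D :
    mink X K = 0 -> mink N K = 0 ->
    D = mink (a0 *: F0 + y0 *: G0 + (a1 *: F1 + y1 *: G1)
      + (c *: N + c' *: N' + (e *: X + e' *: X'))) K ->
    a0 * mink F0 K + a1 * mink F1 K + (y0 * mink G0 K + y1 * mink G1 K)
    = D - c' * mink N' K - e' * mink X' K.
  by move=> XK NK ->; rewrite !(minkDl, minkZl) XK NK; ring.
exact: expand.
Qed.

(** The third derivatives of [f] in [form1_levi_civita] are symmetric and drop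
    out of the curvature.  The determinant of [form2] comes with a minus sign
    because the normal is timelike. *)
Lemma gauss_equation x : U x -> gauss_curvature g x
  = - L ^- 2 - (form2 f nu x (evec 0) (evec 0) * form2 f nu x (evec 1) (evec 1)
                - form2 f nu x (evec 0) (evec 1) ^+ 2) / \det (g x).
Proof.
move=> Ux; have d0 := lt0r_neq0 (pullback_det P Ux).
have sg := smooth_diff (smooth_pullback P) Ux.
have lcE v w : levi_civita g (cst v) (cst w) = (fun y => christoffel g y v w).
  by apply/funext => y; rewrite /levi_civita derive_cst add0r.
pose A := levi_civita g (cst (evec 0))
  (fun y => christoffel g y (evec 1) (evec 1)) x.
pose B := levi_civita g (cst (evec 1))
  (fun y => christoffel g y (evec 0) (evec 1)) x.
have CE : curvature (levi_civita g) (cst (evec 0)) (cst (evec 1))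
    (cst (evec 1)) x = -1 *: B + A.
  rewrite /curvature !lcE -/A -/B [X in _ - X](_ : _ = 0); last first.
    rewrite /levi_civita /lie_bracket !derive_cst subrr add0r.
    have [bl _] := christoffel_bilinear sg.
    have := bl (-1) 0 0 (evec 1).
    by rewrite scaler0 addr0 scaleN1r addNr.
  by rewrite subr0 scaleN1r addrC.
rewrite /gauss_curvature CE (gip_pullback P)// (form1_linearl P)//.
have EA := form1_levi_civita (evec 0) (evec 1) (evec 1) (evec 0) Ux.
have EB := form1_levi_civita (evec 1) (evec 0) (evec 1) (evec 0) Ux.
apply: (etrans (f_equal2 (fun a b => (-1 * b + a) / \det (g x)) EA EB)).
have sch : mink ('D_(evec 0) ('D_(evec 1) ('D_(evec 1) f)) x) ('D_(evec 0) f x)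
    = mink ('D_(evec 1) ('D_(evec 0) ('D_(evec 1) f)) x) ('D_(evec 0) f x).
  exact: (congr1 (mink^~ _) (smooth_deriveC openU _ _ (smooth_derive _ sf) Ux)).
have g10 := form1C f x (evec 1) (evec 0).
have b10 := form2C P (evec 1) (evec 0) Ux.
have gram := pullback_gram f x.
have alg (D a b b' c b00 b01 b01' b11 m m' l : R) : D != 0 ->
  D = a * c - b ^+ 2 -> m = m' -> b' = b -> b01' = b01 ->
  (-1 * (m' - b01 * b01' - l * b * b') + (m - b11 * b00 - l * c * a)) / D
  = - l - (b00 * b11 - b01 ^+ 2) / D.
  by move=> D0 DE -> -> ->; move: D0; rewrite DE => D0; field.
exact: alg d0 gram sch g10 b10.
Qed.

(** Cramer's rule for the coordinates of the tangent vector [D_u nu]. *)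
Lemma weingarten x u : U x ->
  'D_u nu x = ((form2 f nu x u (evec 0) * form1 f x (evec 1) (evec 1)
     - form2 f nu x u (evec 1) * form1 f x (evec 0) (evec 1)) / \det (g x))
     *: 'D_(evec 0) f x
   + ((form2 f nu x u (evec 1) * form1 f x (evec 0) (evec 0)
     - form2 f nu x u (evec 0) * form1 f x (evec 0) (evec 1)) / \det (g x))
     *: 'D_(evec 1) f x.
Proof.
move=> Ux; have d0 := lt0r_neq0 (pullback_det P Ux).
have f1 := mink_f_df P (evec 1) Ux; have f0 := mink_f_df P (evec 0) Ux.
have n1 := patch_normal P Ux (evec 1); have n0 := patch_normal P Ux (evec 0).
have fu := mink_f_dnu P u Ux; have nu_ := mink_nu_dnu P u Ux.
rewrite minkC in f1; rewrite minkC in f0; rewrite minkC in n1.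
rewrite minkC in n0; rewrite minkC in fu; rewrite minkC in nu_.
have gk (v : 'rV[R]_2) : mink ('D_u nu x) ('D_v f x)
    = v 0 0 * form2 f nu x u (evec 0) + v 0 1 * form2 f nu x u (evec 1).
  apply: (linear_rV2 (l := fun v => mink ('D_u nu x) ('D_v f x) : R^o)).
  move=> a z z'; rewrite (derive_lin a z z' (smooth_diff sf Ux)).
  by rewrite minkDr minkZr.
have fk0 (v : 'rV[R]_2) : mink ('D_(evec 0) f x) ('D_v f x)
    = v 0 0 * form1 f x (evec 0) (evec 0) + v 0 1 * form1 f x (evec 0) (evec 1).
  apply: (linear_rV2 (l := fun v => mink ('D_(evec 0) f x) ('D_v f x) : R^o)).
  move=> a z z'; rewrite (derive_lin a z z' (smooth_diff sf Ux)).
  by rewrite minkDr minkZr.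
have fk1 (v : 'rV[R]_2) : mink ('D_(evec 1) f x) ('D_v f x)
    = v 0 0 * form1 f x (evec 0) (evec 1) + v 0 1 * form1 f x (evec 1) (evec 1).
  apply: etrans (congr1 (fun z => v 0 0 * z + _) (form1C f x (evec 1) (evec 0))).
  apply: (linear_rV2 (l := fun v => mink ('D_(evec 1) f x) ('D_v f x) : R^o)).
  move=> a z z'; rewrite (derive_lin a z z' (smooth_diff sf Ux)).
  by rewrite minkDr minkZr.
have D0 := d0; rewrite (pullback_gram f x) in D0.
have expand a b (X : 'rV[R]_4) : mink (a *: 'D_(evec 0) f x + b *: 'D_(evec 1) f x) X
    = a * mink ('D_(evec 0) f x) X + b * mink ('D_(evec 1) f x) X.
  by move: ('D_(evec 0) f x) ('D_(evec 1) f x) => Y Z; rewrite minkDl !minkZl.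
have zero a b (X : 'rV[R]_4) : mink ('D_(evec 0) f x) X = 0 ->
    mink ('D_(evec 1) f x) X = 0 ->
    mink (a *: 'D_(evec 0) f x + b *: 'D_(evec 1) f x) X = 0.
  move: ('D_(evec 0) f x) ('D_(evec 1) f x) => Y Z YX ZX.
  by rewrite minkDl !minkZl YX ZX !mulr0 addr0.
apply: (patch_ext P Ux) => [||v].
- exact: (etrans fu (esym (zero _ _ _ f0 f1))).
- exact: (etrans nu_ (esym (zero _ _ _ n0 n1))).
- apply: (etrans (gk v)); apply: (etrans _ (esym (expand _ _ _))).
  apply: (etrans _ (esym (f_equal2 (fun a b => _ * a + _ * b) (fk0 v) (fk1 v)))).
  move: D0; rewrite (pullback_gram f x).
  move: (form1 f x _ _) (form1 f x _ _) (form1 f x _ _).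
  move: (form2 f nu x _ _) (form2 f nu x _ _) (v 0 0) (v 0 1).
  by move=> b0 b1 v0 v1 a b c D; field.
Qed.

Section OrthogonalPair.
Variables p q : 'rV[R]_2 -> 'rV[R]_4.
Hypotheses (sp : smooth_on U p) (sq : smooth_on U q).
Hypothesis pq : forall y a b, U y -> mink ('D_a p y) ('D_b q y) = 0.
Hypothesis split_pq : forall y, U y -> exists X1 X2 : 'rV[R]_2,
  [/\ 'D_X1 p y = 0, 'D_X2 q y = 0 &
      forall v, exists a b : R, v = a *: X1 + b *: X2].

Lemma mink_ddp_dq_opp y a b c : U y ->
  mink ('D_c ('D_a p) y) ('D_b q y) = - mink ('D_a p y) ('D_c ('D_b q) y).
Proof.
move=> Uy; apply: (canRL opprK); apply: esym.
apply: (derive_mink_cst P (c := 0)) Uy; [exact: smooth_derive..|].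
by move=> z Uz; exact: pq.
Qed.

(** The trilinear form is symmetric in [a], [b], [c]: an argument [X1] can be
    moved to [p] and an argument [X2] to [q], where it gives [0]. *)
Lemma mink_ddp_dq y a b c : U y -> mink ('D_c ('D_a p) y) ('D_b q y) = 0.
Proof.
move=> Uy; have [X1 [X2 [p1 q2 sp12]]] := split_pq Uy.
have [s [t ->]] := sp12 b.
have DE : 'D_(s *: X1 + t *: X2) q y = s *: 'D_X1 q y.
  apply: (etrans (derive_lin s X1 (t *: X2) (smooth_diff sq Uy))).
  have alg (A B C D : 'rV[R]_4) : B = t *: C + D -> C = 0 -> D = 0 -> A + B = A.
    by move=> -> -> ->; rewrite scaler0 !addr0.
  apply: alg q2 (derive0 q y).
  by have := derive_lin t X2 0 (smooth_diff sq Uy); rewrite addr0.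
apply: (etrans (congr1 (mink _) DE)); rewrite minkZr.
suff -> : mink ('D_c ('D_a p) y) ('D_X1 q y) = 0 by rewrite mulr0.
apply: (etrans (mink_ddp_dq_opp a X1 c Uy)).
apply: (etrans (congr1 (fun Z => - mink _ Z) (smooth_deriveC openU c X1 sq Uy))).
apply: (etrans (esym (mink_ddp_dq_opp a c X1 Uy))).
apply: (etrans (congr1 (mink^~ _) (smooth_deriveC openU X1 a sp Uy))).
apply: (etrans (mink_ddp_dq_opp X1 c a Uy)).
by rewrite p1 mink0l oppr0.
Qed.

Lemma mink_dp_ddq y a b c : U y -> mink ('D_a p y) ('D_c ('D_b q) y) = 0.
Proof.
move=> Uy; have := mink_ddp_dq_opp a b c Uy.
by rewrite mink_ddp_dq// => /esym/eqP; rewrite oppr_eq0 => /eqP.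
Qed.

Lemma mink_ddp_ddq_opp x a b c d : U x ->
  mink ('D_c ('D_a p) x) ('D_d ('D_b q) x)
  = - mink ('D_d ('D_c ('D_a p)) x) ('D_b q x).
Proof.
move=> Ux; apply: (derive_mink_cst P (c := 0)) Ux.
- by do 2!apply: smooth_derive.
- exact: smooth_derive.
- by move=> z Uz; exact: mink_ddp_dq.
Qed.

(** Exchanging derivatives moves a derivative along [X2] from [p] to [q]. *)
Lemma mink_ddp_ddq x X1 X2 : U x -> 'D_X2 q x = 0 ->
  mink ('D_X2 ('D_X2 p) x) ('D_X1 ('D_X1 q) x) = 0.
Proof.
move=> Ux q2; apply: (etrans (mink_ddp_ddq_opp X2 X1 X2 X1 Ux)).
apply: (etrans (congr1 (fun Z => - mink Z _)
  (smooth_deriveC openU X1 X2 (smooth_derive X2 sp) Ux))).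
apply: (etrans (esym (mink_ddp_ddq_opp X2 X1 X1 X2 Ux))).
apply: (etrans (congr1 (mink _) (smooth_deriveC openU X2 X1 sq Ux))).
apply: (etrans (mink_ddp_ddq_opp X2 X2 X1 X1 Ux)).
by rewrite q2 mink0r oppr0.
Qed.

End OrthogonalPair.

Lemma form1_gt0 x u : U x -> u != 0 -> 0 < form1 f x u u.
Proof. by move=> Ux u0; rewrite -(gip_pullback P)//; exact: (patch_pos P). Qed.

Lemma orthogonal_span x X1 X2 : U x -> X1 != 0 -> X2 != 0 ->
  form1 f x X1 X2 = 0 -> forall v, exists a b : R, v = a *: X1 + b *: X2.
Proof.
move=> Ux X10 X20 X12; pose B : 'M[R]_2 := \matrix_(i < 2) [:: X1; X2]`_i.
have BE (c : 'rV[R]_2) : c *m B = c 0 0 *: X1 + c 0 1 *: X2.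
  by rewrite mulmx_sum_row sum2 !rowK.
have BU : B \in unitmx.
  rewrite -row_free_unit; apply: inj_row_free => c; rewrite BE => c0.
  have E X : c 0 0 * form1 f x X1 X + c 0 1 * form1 f x X2 X = 0.
    have z : form1 f x 0 X = 0 by rewrite /form1 derive0 mink0l.
    rewrite -[RHS]z -c0 (form1_linearl P)//; congr (_ + _).
    by have := form1_linearl P (c 0 1) X2 0 X Ux; rewrite addr0 z addr0.
  have := E X1; have := E X2; rewrite X12 (form1C f x X2 X1) X12 !mulr0 addr0 add0r.
  move=> /(mulr_eq0l (lt0r_neq0 (form1_gt0 Ux X20))) c1.
  move=> /(mulr_eq0l (lt0r_neq0 (form1_gt0 Ux X10))) c0'.
  by apply/rowP => i; rewrite mxE; case: (ord2P i) => ->.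
move=> v; exists ((v *m invmx B) 0 0), ((v *m invmx B) 0 1).
by rewrite -BE mulmxKV.
Qed.

(** Parseval's formula for [A] in the orthogonal basis [F], [N], [Y1], [Y2],
    paired with [B]. *)
Lemma normal_plane_product (m1 m2 : R) (F N Y1 Y2 A B : 'rV[R]_4) :
  mink F F = - L ^+ 2 -> mink N N = -1 -> mink F N = 0 ->
  mink F Y1 = 0 -> mink F Y2 = 0 -> mink N Y1 = 0 -> mink N Y2 = 0 ->
  0 < mink Y1 Y1 -> 0 < mink Y2 Y2 -> mink Y1 Y2 = 0 ->
  mink A Y1 = 0 -> mink B Y2 = 0 -> mink A B = 0 ->
  mink A N = m2 * mink A F -> mink B N = m1 * mink B F ->
  mink A F != 0 -> mink B F != 0 -> m1 * m2 = - L ^- 2.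
Proof.
move=> FF NN FN F1 F2 N1 N2 I1 I2 I12 A1 B2 AB AN BN AF BF.
have L0 := patch_L P.
pose W := A + (- (mink A Y2 / mink Y2 Y2)) *: Y2 + mink A N *: N
  + (L ^- 2 * mink A F) *: F.
have BU : (\matrix_(i < 4) [:: F; N; Y1; Y2]`_i) \in unitmx.
  apply: mink_basis => //; first by rewrite FF oppr_eq0 expf_neq0.
    by rewrite NN oppr_eq0 oner_eq0.
  by rewrite I12 expr0n subr0 mulf_neq0// gt_eqF.
have I20 := lt0r_neq0 I2.
have W0 : W = 0.
  apply: (mink_orth_basis BU); rewrite /W !(minkDl, minkZl).
  - by rewrite (minkC Y2 F) F2 (minkC N F) FN FF; field; rewrite ?L0 ?I20.
  - by rewrite (minkC Y2 N) N2 FN NN; ring.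
  - by rewrite (minkC Y2 Y1) I12 N1 F1 A1; ring.
  - by rewrite N2 F2; field; rewrite ?L0 ?I20.
have := mink0l B; rewrite -W0 /W !(minkDl, minkZl) AB (minkC Y2) B2.
rewrite (minkC N) BN (minkC F) AN => E.
apply: (mulIf (mulf_neq0 AF BF)); apply/eqP; rewrite -subr_eq0; apply/eqP.
by rewrite -[RHS]E; ring.
Qed.

(** By the Codazzi equation [p = nu - m1 f] and [q = nu - m2 f] form an
    orthogonal pair, each constant along one principal direction.  The second
    derivatives of [p] and [q] are then orthogonal, and in the basis [f], [nu]
    of the normal plane this reads [m1 m2 = - L ^- 2], that is, flatness. *)
Lemma principal_product (m1 m2 : R) x : m1 != m2 ->
  (forall y, U y -> exists X1 X2 : 'rV[R]_2, [/\ X1 != 0, X2 != 0,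
     'D_X1 nu y = m1 *: 'D_X1 f y & 'D_X2 nu y = m2 *: 'D_X2 f y]) ->
  U x -> m1 * m2 = - L ^- 2.
Proof.
move=> m12 eig Ux; pose h (m : R) y := (- m) *: f y + nu y.
have sh m : smooth_on U (h m).
  by apply: smoothD => //; apply: smoothZ => //; exact: smooth_cst.
have Dh m y a : U y -> 'D_a (h m) y = (- m) *: 'D_a f y + 'D_a nu y.
  move=> Uy; have [_ E] := derive_comb (- m) (smooth_derivable (v := a) sf Uy)
    (smooth_derivable (v := a) sn Uy).
  exact: E.
have eigh m m' y X : U y -> 'D_X nu y = m' *: 'D_X f y ->
    'D_X (h m) y = (m' - m) *: 'D_X f y.
  move=> Uy; have alg (A B : 'rV[R]_4) : B = m' *: A ->
      (- m) *: A + B = (m' - m) *: A by move=> ->; rewrite addrC -scalerDl.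
  by move=> /alg; apply: etrans; exact: Dh.
have eigh0 m y X : U y -> 'D_X nu y = m *: 'D_X f y -> 'D_X (h m) y = 0.
  move=> Uy E; apply: (etrans (eigh _ _ _ _ Uy E)).
  have alg (A : 'rV[R]_4) : (m - m) *: A = 0 by rewrite subrr scale0r.
  exact: alg.
have ort y X1 X2 : U y -> 'D_X1 nu y = m1 *: 'D_X1 f y ->
    'D_X2 nu y = m2 *: 'D_X2 f y -> form1 f y X1 X2 = 0.
  move=> Uy E1 E2.
  have alg (A1 A2 B1 B2 : 'rV[R]_4) : mink B1 A2 = mink B2 A1 ->
      B1 = m1 *: A1 -> B2 = m2 *: A2 -> mink A1 A2 = 0.
    move=> E B1E B2E; move: E; rewrite B1E B2E !minkZl (minkC A2) => /eqP.
    by rewrite -subr_eq0 -mulrBl mulf_eq0 subr_eq0 (negPf m12) => /eqP.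
  exact: alg (form2C P X1 X2 Uy) E1 E2.
have spl y : U y -> exists X1 X2 : 'rV[R]_2,
  [/\ 'D_X1 (h m1) y = 0, 'D_X2 (h m2) y = 0 &
      forall v, exists a b : R, v = a *: X1 + b *: X2].
  move=> Uy; have [X1 [X2 [n1 n2 E1 E2]]] := eig y Uy; exists X1, X2.
  split; [exact: eigh0 Uy E1|exact: eigh0 Uy E2|].
  exact: (orthogonal_span Uy n1 n2 (ort y X1 X2 Uy E1 E2)).
have hX m y a X : U y -> mink ('D_a f y) X = 0 -> mink ('D_a nu y) X = 0 ->
    mink ('D_a (h m) y) X = 0.
  move=> Uy fX nX; apply: (etrans (congr1 (mink^~ X) (Dh m y a Uy))).
  move: ('D_a f y) ('D_a nu y) fX nX => F N fX nX.
  by rewrite minkDl minkZl fX nX mulr0 addr0.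
have hf m y a : U y -> mink ('D_a (h m) y) (f y) = 0.
  move=> Uy; apply: hX => //; rewrite minkC; first exact: (mink_f_df P).
  exact: (mink_f_dnu P).
have hn m y a : U y -> mink ('D_a (h m) y) (nu y) = 0.
  move=> Uy; apply: hX => //; rewrite minkC; first exact: (patch_normal P).
  exact: (mink_nu_dnu P).
have hh m m' y a : U y -> mink ('D_a (h m) y) (h m' y) = 0.
  move=> Uy; have := hf m y a Uy; have := hn m y a Uy.
  move: ('D_a (h m) y) => X n0 f0.
  by rewrite /h minkDr minkZr f0 n0 mulr0 addr0.
have pq y a b : U y -> mink ('D_a (h m1) y) ('D_b (h m2) y) = 0.
  move=> Uy; have [X1 [X2 [n1 n2 E1 E2]]] := eig y Uy.
  have I12 := ort y X1 X2 Uy E1 E2.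
  have [s [t ->]] := orthogonal_span Uy n1 n2 I12 a.
  have [s' [t' ->]] := orthogonal_span Uy n1 n2 I12 b.
  have lin m c d : 'D_(c *: X1 + d *: X2) (h m) y
      = (c * (m1 - m)) *: 'D_X1 f y + (d * (m2 - m)) *: 'D_X2 f y.
    have dh := smooth_diff (sh m) Uy.
    apply: (etrans (derive_lin c X1 (d *: X2) dh)).
    have := derive_lin d X2 0 dh; rewrite addr0.
    move: (eigh m m1 y X1 Uy E1) (eigh m m2 y X2 Uy E2) (derive0 (h m) y).
    move: ('D_X1 f y) ('D_X2 f y) ('D_X1 (h m) y) ('D_X2 (h m) y).
    move: ('D_0 (h m) y) ('D_(d *: X2) (h m) y) => A0 B A1 A2 B1 B2.
    by move=> -> -> -> ->; rewrite addr0 !scalerA.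
  apply: (etrans (f_equal2 mink (lin m1 s t) (lin m2 s' t'))).
  move: I12; rewrite /form1; move: ('D_X1 f y) ('D_X2 f y) => Y1 Y2 I12.
  rewrite !subrr !mulr0 !scale0r add0r addr0 minkZl minkZr.
  by rewrite minkC I12 !mulr0.
have [X1 [X2 [n1 n2 E1 E2]]] := eig x Ux.
have I12 := ort x X1 X2 Ux E1 E2.
have p2 := eigh m1 m2 x X2 Ux E2; have q1 := eigh m2 m1 x X1 Ux E1.
have q2 := eigh0 m2 x X2 Ux E2.
(* The vectors paired by [normal_plane_product] are the second derivatives of
   [h m1] along [X2] and of [h m2] along [X1]. *)
have AB : mink ('D_X2 ('D_X2 (h m1)) x) ('D_X1 ('D_X1 (h m2)) x) = 0.
  exact: (mink_ddp_ddq (sh m1) (sh m2) pq spl).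
have d12 : m1 - m2 != 0 by rewrite subr_eq0.
have d21 : m2 - m1 != 0 by rewrite subr_eq0 eq_sym.
have Z0 (c : R) (X Y Z : 'rV[R]_4) : c != 0 -> Y = c *: Z -> mink X Y = 0 ->
    mink X Z = 0.
  move=> c0 -> /eqP; rewrite minkZr mulf_eq0 (negPf c0) /=; exact: eqP.
have A1 : mink ('D_X2 ('D_X2 (h m1)) x) ('D_X1 f x) = 0.
  exact: Z0 d12 q1 (mink_ddp_dq (sh m1) (sh m2) pq spl X2 X1 X2 Ux).
have B2 : mink ('D_X1 ('D_X1 (h m2)) x) ('D_X2 f x) = 0.
  apply: Z0 d21 p2 _; rewrite minkC.
  exact: (mink_dp_ddq (sh m1) (sh m2) pq spl X2 X1 X1 Ux).
have dd m m' a b : mink ('D_b ('D_a (h m)) x) (h m' x)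
    = - mink ('D_a (h m) x) ('D_b (h m') x).
  apply: (canRL opprK); apply: esym.
  apply: (derive_mink_cst P (c := 0)) Ux => //; first exact: smooth_derive.
  by move=> y Uy; exact: hh.
have Aq : mink ('D_X2 ('D_X2 (h m1)) x) (h m2 x) = 0.
  by apply: (etrans (dd _ _ _ _)); rewrite pq ?oppr0.
have Bp : mink ('D_X1 ('D_X1 (h m2)) x) (h m1 x) = 0.
  by apply: (etrans (dd _ _ _ _)); rewrite minkC pq ?oppr0.
have sqr (c : R) (X Y : 'rV[R]_4) : X = c *: Y ->
    - mink X X = - (c ^+ 2 * mink Y Y).
  by move=> ->; rewrite minkZl minkZr mulrA -expr2.
have Ap := etrans (dd m1 m1 X2 X2) (sqr _ _ _ p2).
have Bq := etrans (dd m2 m2 X1 X1) (sqr _ _ _ q1).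
have I1 := form1_gt0 Ux n1; have I2 := form1_gt0 Ux n2.
rewrite /form1 in I1 I2.
have final m m' (X : 'rV[R]_4) (c : R) : mink X (h m x) = 0 ->
    mink X (h m' x) = - c -> 0 < c ->
    mink X (nu x) = m * mink X (f x) /\ mink X (f x) != 0.
  rewrite /h !(minkDr, minkZr) => /eqP; rewrite addrC mulNr subr_eq0 => /eqP Xn.
  move=> Xm' c0; split=> //; apply: contra_eq_neq Xm' => Xf.
  by rewrite Xn Xf !mulr0 addr0 eq_sym oppr_eq0 gt_eqF.
have [An Af] := final _ _ _ _ Aq Ap (mulr_gt0 (sqr_gt0 d21) I2).
have [Bn Bf] := final _ _ _ _ Bp Bq (mulr_gt0 (sqr_gt0 d12) I1).
have nf := patch_tangent P Ux; rewrite minkC in nf.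
exact: (normal_plane_product (patch_ads P Ux) (patch_unit P Ux) nf
  (mink_f_df P X1 Ux) (mink_f_df P X2 Ux) (patch_normal P Ux X1)
  (patch_normal P Ux X2) I1 I2 I12 A1 B2 AB An Bn Af Bf).
Qed.

End Umbilic.

(** * Local classification of biharmonic patches *)

Lemma Ck_sub (R : realType) (V W : normedModType R) k (U U' : set V)
  (f : V -> W) : U' `<=` U -> Ck_on k U f -> Ck_on k U' f.
Proof.
move=> UU; elim: k f => [|k IH] f /=; first by move=> cf x /UU; exact: cf.
by move=> [df cf]; split=> [x /UU|v]; [exact: df|exact: IH].
Qed.

Lemma patch_sub (R : realType) (L : R) (U U' : set 'rV[R]_2) f nu :
  open U' -> U' `<=` U -> spacelike_patch L U f nu -> spacelike_patch L U' f nu.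
Proof.
move=> oU' UU P; split; first exact: patch_L P.
- by [].
- by move=> k; exact: Ck_sub UU (patch_f P k).
- by move=> k; exact: Ck_sub UU (patch_nu P k).
- by move=> x /UU; exact: (patch_ads P).
- by move=> x /UU; exact: (patch_tangent P).
- by move=> x /UU; exact: (patch_normal P).
- by move=> x /UU; exact: (patch_unit P).
- by move=> x /UU; exact: (patch_pos P).
Qed.

Section Algebra.
Context {R : realType}.

Lemma bilinear2_sum4 (B : 'rV[R]_2 -> 'rV[R]_2 -> R^o) u v : bilinear2 B ->
  B u v = u 0 0 * v 0 0 * B (evec 0) (evec 0)
    + u 0 0 * v 0 1 * B (evec 0) (evec 1)
    + (u 0 1 * v 0 0 * B (evec 1) (evec 0)
       + u 0 1 * v 0 1 * B (evec 1) (evec 1)).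
Proof. by move=> bB; rewrite (bilinear2_sum u v bB) !sum2. Qed.

(** The matrix [b - m a] is singular. *)
Lemma relative_eigenvector (a00 a01 a11 b00 b01 b11 m : R) :
  (b00 - m * a00) * (b11 - m * a11) - (b01 - m * a01) ^+ 2 = 0 ->
  exists2 X : 'rV[R]_2, X != 0 & forall v : 'rV[R]_2,
    X 0 0 * v 0 0 * b00 + X 0 0 * v 0 1 * b01
    + (X 0 1 * v 0 0 * b01 + X 0 1 * v 0 1 * b11)
    = m * (X 0 0 * v 0 0 * a00 + X 0 0 * v 0 1 * a01
           + (X 0 1 * v 0 0 * a01 + X 0 1 * v 0 1 * a11)).
Proof.
move=> char; pose p := b00 - m * a00; pose q := b01 - m * a01.
pose r := b11 - m * a11.
pose N : 'M[R]_2 := \matrix_(i, j) (if i == 0 then (if j == 0 then p else q)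
   else (if j == 0 then q else r)).
have N0 : \det N = 0 by rewrite det2 !mxE /= -expr2.
have /eqP/det0P[X X0 XN] := N0; exists X => // v.
have := congr1 (fun A : 'rV[R]_2 => A 0 0) XN.
have := congr1 (fun A : 'rV[R]_2 => A 0 1) XN.
rewrite !mxE !sum2 !mxE /= /p /q /r.
move: (X 0 0) (X 0 1) (v 0 0) (v 0 1) => x y s t E1 E0.
apply/eqP; rewrite -subr_eq0; apply/eqP.
set lhs := (X in X = 0).
have -> : lhs = s * (x * (b00 - m * a00) + y * (b01 - m * a01))
    + t * (x * (b01 - m * a01) + y * (b11 - m * a11)) by rewrite /lhs; ring.
by rewrite E0 E1 !mulr0 addr0.
Qed.

Lemma discriminant_relative_ge0 (t D d g0 q r : R) : 0 < D -> 0 < g0 ->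
  g0 ^+ 2 * ((t * D) ^+ 2 - 4 * D * d) = q ^+ 2 + 4 * D * r ^+ 2 ->
  4 * (d / D) <= t ^+ 2.
Proof.
move=> D0 g00 E.
have : 0 <= q ^+ 2 + 4 * D * r ^+ 2.
  apply: addr_ge0; first exact: sqr_ge0.
  by apply: mulr_ge0; [apply: mulr_ge0; [by []|exact: ltW]|exact: sqr_ge0].
rewrite -E pmulr_rge0 ?exprn_gt0// subr_ge0 => h.
rewrite mulrA ler_pdivrMr// -(ler_pM2r D0).
by rewrite exprMn -mulrA in h; move: h; rewrite mulrA mulrA -(mulrA _ D D) -expr2 mulrAC.
Qed.

(** A vanishing sum of squares; [discriminant_form2] provides the identity. *)
Lemma discriminant_relative_eq0 (t D d g0 q r : R) : 0 < D -> 0 < g0 ->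
  g0 ^+ 2 * ((t * D) ^+ 2 - 4 * D * d) = q ^+ 2 + 4 * D * r ^+ 2 ->
  t ^+ 2 = 4 * (d / D) -> q = 0 /\ r = 0.
Proof.
move=> D0 g00 E tE; have D1 := lt0r_neq0 D0; move: E.
rewrite exprMn tE (_ : _ - _ = 0) ?mulr0; last by field.
have p0 : 0 <= 4 * D * r ^+ 2.
  by apply: mulr_ge0; [apply: mulr_ge0; [by []|exact: ltW]|exact: sqr_ge0].
move=> /esym/eqP; rewrite paddr_eq0 ?sqr_ge0// => /andP[/eqP q0 /eqP r0].
split; first by apply/eqP; rewrite -sqrf_eq0 q0.
apply/eqP; rewrite -sqrf_eq0; apply/eqP.
have h4 : 4 * D != 0 by rewrite mulf_neq0// pnatr_eq0.
by apply: (mulr_eq0l h4); rewrite mulrC.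
Qed.

(** The last two hypotheses are the vanishing squares of [discriminant_form2]:
    they make [b] proportional to [a] on an orthogonal basis. *)
Lemma relative_umbilic (a00 a01 a11 b00 b01 b11 t D : R) :
  0 < a00 -> D != 0 -> D = a00 * a11 - a01 ^+ 2 ->
  t * D = b00 * a11 - 2 * b01 * a01 + b11 * a00 ->
  b00 * D - (a00 ^+ 2 * b11 - 2 * a00 * a01 * b01 + a01 ^+ 2 * b00) = 0 ->
  a00 * b01 - a01 * b00 = 0 ->
  [/\ b00 = t / 2 * a00, b01 = t / 2 * a01 & b11 = t / 2 * a11].
Proof.
move=> a0 D0 DE tE e1 e2; have a1 := lt0r_neq0 a0.
have b01E : b01 = b00 / a00 * a01.
  by apply: (mulfI a1); move: e2 => /eqP; rewrite subr_eq0 => /eqP ->; field.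
have b11E : b11 = b00 / a00 * a11.
  apply: (mulfI (expf_neq0 2 a1)); apply/eqP; rewrite -subr_eq0; apply/eqP.
  rewrite -[RHS]oppr0 -e1 DE b01E; field.
  by [].
have tE' : t / 2 = b00 / a00.
  apply: (mulIf D0); rewrite mulrAC tE b11E b01E DE; field.
  by [].
by rewrite tE' b01E b11E; split => //; field.
Qed.

(** In coordinates the hypotheses say that the gradient of a function with
    partial derivatives [p0], [p1] lies in the kernel of [b]. *)
Lemma kernel_det (p0 p1 a00 a01 a11 b00 b01 b11 D : R) : D != 0 ->
  D = a00 * a11 - a01 ^+ 2 ->
  ((p0 * b00 + p0 * b00) * a11 - 2 * (p1 * b00 + p0 * b01) * a01
   + (p1 * b01 + p1 * b01) * a00) / D = 0 ->
  ((p0 * b01 + p0 * b01) * a11 - 2 * (p1 * b01 + p0 * b11) * a01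
   + (p1 * b11 + p1 * b11) * a00) / D = 0 ->
  p0 * (b00 * b11 - b01 ^+ 2) = 0 /\ p1 * (b00 * b11 - b01 ^+ 2) = 0.
Proof.
move=> D0 DE; have Di : D^-1 != 0 by rewrite invr_eq0.
move=> /(mulr_eq0l Di) E0 /(mulr_eq0l Di) E1.
have D2 : 2 * D != 0 by rewrite mulf_neq0// pnatr_eq0.
pose e0 p0 p1 : R := (p0 * b00 + p0 * b00) * a11 - 2 * (p1 * b00 + p0 * b01) * a01
   + (p1 * b01 + p1 * b01) * a00.
pose e1 p0 p1 : R := (p0 * b01 + p0 * b01) * a11 - 2 * (p1 * b01 + p0 * b11) * a01
   + (p1 * b11 + p1 * b11) * a00.
split; apply: (mulr_eq0l D2); rewrite DE.
- set lhs := (X in X = 0); pose e := (a00 * b11 - a01 * b01, a01 * b00 - a00 * b01).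
  have -> : lhs = e.1 * (e0 p0 p1) + e.2 * (e1 p0 p1) by rewrite /lhs /e /e0 /e1 /=; ring.
  by rewrite /e0 /e1 E0 E1 !mulr0 addr0.
- set lhs := (X in X = 0); pose e := (a01 * b11 - a11 * b01, a11 * b00 - a01 * b01).
  have -> : lhs = e.1 * (e0 p0 p1) + e.2 * (e1 p0 p1) by rewrite /lhs /e /e0 /e1 /=; ring.
  by rewrite /e0 /e1 E0 E1 !mulr0 addr0.
Qed.

End Algebra.

Section PrincipalCurvatures.
Context {R : realType}.
Variables (L : R) (U : set 'rV[R]_2) (f nu : 'rV[R]_2 -> 'rV[R]_4).
Hypothesis P : spacelike_patch L U f nu.
Implicit Types (x u v k : 'rV[R]_2).
Local Notation g := (pullback_mx f).

Definition det_form2 x : R :=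
  form2 f nu x (evec 0) (evec 0) * form2 f nu x (evec 1) (evec 1)
  - form2 f nu x (evec 0) (evec 1) ^+ 2.

Lemma form1_sum x u v : U x -> form1 f x u v
  = u 0 0 * v 0 0 * form1 f x (evec 0) (evec 0)
    + u 0 0 * v 0 1 * form1 f x (evec 0) (evec 1)
    + (u 0 1 * v 0 0 * form1 f x (evec 1) (evec 0)
       + u 0 1 * v 0 1 * form1 f x (evec 1) (evec 1)).
Proof.
move=> Ux; have df := smooth_diff (patch_f P) Ux.
exact: (bilinear2_sum4 u v (bilinear2_mink df df)).
Qed.

Lemma form2_sum x u v : U x -> form2 f nu x u v
  = u 0 0 * v 0 0 * form2 f nu x (evec 0) (evec 0)
    + u 0 0 * v 0 1 * form2 f nu x (evec 0) (evec 1)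
    + (u 0 1 * v 0 0 * form2 f nu x (evec 1) (evec 0)
       + u 0 1 * v 0 1 * form2 f nu x (evec 1) (evec 1)).
Proof.
move=> Ux; have df := smooth_diff (patch_f P) Ux.
have dn := smooth_diff (patch_nu P) Ux.
exact: (bilinear2_sum4 u v (bilinear2_mink dn df)).
Qed.

(** Both sides are tangent vectors. *)
Lemma principal_of_form2 x (m : R) u : U x ->
  (forall v, form2 f nu x u v = m * form1 f x u v) ->
  'D_u nu x = m *: 'D_u f x.
Proof.
move=> Ux E; have f1 := mink_f_df P u Ux; have f2 := mink_f_dnu P u Ux.
have n1 := patch_normal P Ux u; have n2 := mink_nu_dnu P u Ux.
have zero (X Y Z : 'rV[R]_4) : mink X Y = 0 -> mink X Z = 0 ->
    mink Y X = mink (m *: Z) X.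
  by move=> XY XZ; rewrite minkZl !(minkC _ X) XY XZ mulr0.
apply: (patch_ext P Ux) => [||v].
- exact: zero.
- exact: zero.
- by apply: (etrans (E v)); rewrite minkZl.
Qed.

Lemma principal_exists x (m : R) : U x ->
  m ^+ 2 - m * trace2 f nu x + det_form2 x / \det (g x) = 0 ->
  exists2 X : 'rV[R]_2, X != 0 & 'D_X nu x = m *: 'D_X f x.
Proof.
move=> Ux char; have tE := trace2E P Ux; have gE := pullback_gram f x.
have D0 := lt0r_neq0 (pullback_det P Ux).
have alg (D t d a00 a01 a11 b00 b01 b11 : R) : D != 0 ->
    m ^+ 2 - m * t + d / D = 0 -> d = b00 * b11 - b01 ^+ 2 ->
    D = a00 * a11 - a01 ^+ 2 ->
    t * D = b00 * a11 - 2 * b01 * a01 + b11 * a00 ->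
    (b00 - m * a00) * (b11 - m * a11) - (b01 - m * a01) ^+ 2 = 0.
  move=> D1 c dE DE E; have : (m ^+ 2 - m * t + d / D) * D = 0.
    by rewrite c mul0r.
  have -> : (m ^+ 2 - m * t + d / D) * D = m ^+ 2 * D - m * (t * D) + d.
    by field.
  by rewrite dE DE in E *; rewrite E => c0; rewrite -[RHS]c0; ring.
have [X X0 XE] := relative_eigenvector (alg _ _ _ _ _ _ _ _ _ D0 char
  (erefl _) gE tE).
exists X => //; apply: principal_of_form2 => // v.
apply: (etrans (form2_sum X v Ux)).
apply: (etrans _ (congr1 ( *%R m) (esym (form1_sum X v Ux)))).
apply: (etrans _ (etrans (XE v) _)).
  exact: (congr1 (fun z => _ + (_ * z + _)) (form2C P (evec 1) (evec 0) Ux)).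
exact: (congr1 (fun z => m * (_ + (_ * z + _))) (form1C f x (evec 0) (evec 1))).
Qed.

(** Up to scaling, the two squares are those of the difference of the diagonal
    entries and of the off-diagonal entry of [form2] in the Gram-Schmidt basis of
    the coordinate vectors: they vanish together at umbilical points only. *)
Lemma discriminant_form2 x : U x ->
  let g00 := form1 f x (evec 0) (evec 0) in
  let g01 := form1 f x (evec 0) (evec 1) in
  let b00 := form2 f nu x (evec 0) (evec 0) in
  let b01 := form2 f nu x (evec 0) (evec 1) in
  let b11 := form2 f nu x (evec 1) (evec 1) in
  let D := \det (g x) in
  let b01' := g00 * b01 - g01 * b00 in
  let b11' := g00 ^+ 2 * b11 - 2 * g00 * g01 * b01 + g01 ^+ 2 * b00 in
  g00 ^+ 2 * ((trace2 f nu x * D) ^+ 2 - 4 * D * det_form2 x)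
    = (b00 * D - b11') ^+ 2 + 4 * D * b01' ^+ 2.
Proof.
move=> Ux /=; rewrite (trace2E P Ux) (pullback_gram f x) /det_form2.
move: (form1 f x _ _) (form1 f x _ _) (form1 f x _ _).
move: (form2 f nu x _ _) (form2 f nu x _ _) (form2 f nu x _ _).
by move=> b11 b01 b00 g11 g01 g00; ring.
Qed.

Lemma form1_gt0_evec x : U x -> 0 < form1 f x (evec 0) (evec 0).
Proof.
move=> Ux; have [+ _] := pos_det (pullback_sym f x) (patch_pos P Ux).
by rewrite (pullbackE f x).
Qed.

Lemma discriminant_ge0 x : U x ->
  4 * (det_form2 x / \det (g x)) <= trace2 f nu x ^+ 2.
Proof.
move=> Ux; exact: (discriminant_relative_ge0 (pullback_det P Ux)
  (form1_gt0_evec Ux) (discriminant_form2 Ux)).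
Qed.

Lemma umbilic_of_discriminant x v : U x ->
  trace2 f nu x ^+ 2 = 4 * (det_form2 x / \det (g x)) ->
  'D_v nu x = (trace2 f nu x / 2) *: 'D_v f x.
Proof.
move=> Ux E; have D0 := pullback_det P Ux.
have [e1 e2] := discriminant_relative_eq0 D0 (form1_gt0_evec Ux)
  (discriminant_form2 Ux) E.
have [b0 b1 b2] := relative_umbilic (form1_gt0_evec Ux) (lt0r_neq0 D0)
  (pullback_gram f x) (trace2E P Ux) e1 e2.
have b10 := etrans (form2C P (evec 1) (evec 0) Ux) b1.
apply: (principal_of_form2 Ux) => u.
apply: (etrans (form2_sum v u Ux)).
apply: (etrans _ (congr1 ( *%R _) (esym (form1_sum v u Ux)))).
rewrite b0 b1 b2 b10 (form1C f x (evec 1) (evec 0)).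
move: (form1 f x _ _) (form1 f x _ _) (form1 f x _ _) => a b c.
move: (trace2 _ _ _ / 2) (v 0 0) (v 0 1) (u 0 0) (u 0 1) => *.
by ring.
Qed.

(** The squared norm of the shape operator, by Cayley-Hamilton. *)
Lemma metric_trace_form3 x : U x ->
  metric_trace g x (form3 nu x : _ -> _ -> R^o)
  = trace2 f nu x ^+ 2 - 2 * (det_form2 x / \det (g x)).
Proof.
move=> Ux; have D0 := lt0r_neq0 (pullback_det P Ux).
have F u v : form3 nu x u v
    = ((form2 f nu x u (evec 0) * form1 f x (evec 1) (evec 1)
        - form2 f nu x u (evec 1) * form1 f x (evec 0) (evec 1)) / \det (g x))
      * form2 f nu x v (evec 0)
    + ((form2 f nu x u (evec 1) * form1 f x (evec 0) (evec 0)
        - form2 f nu x u (evec 0) * form1 f x (evec 0) (evec 1)) / \det (g x))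
      * form2 f nu x v (evec 1).
  have alg (a b : R) (A B C D : 'rV[R]_4) : C = a *: A + b *: B ->
      mink C D = a * mink D A + b * mink D B.
    by move=> ->; rewrite minkDl !minkZl !(minkC D).
  exact: alg (weingarten P u Ux).
apply: (etrans (metric_trace2E P Ux (form3C nu x))).
have b10 := form2C P (evec 1) (evec 0) Ux.
rewrite !F b10 /det_form2; have tE := trace2E P Ux; have gE := pullback_gram f x.
move: D0 tE gE; move: (trace2 _ _ _) (\det _) => t D.
move: (form1 f x _ _) (form1 f x _ _) (form1 f x _ _).
move: (form2 f nu x _ _) (form2 f nu x _ _) (form2 f nu x _ _).
move=> b11 b01 b00 g00 g01 g11 D0 tE gE.
apply: (mulIf (expf_neq0 2 D0)); rewrite [RHS]mulrBl -exprMn tE.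
have -> : (b00 * g11 - 2 * b01 * g01 + b11 * g00) ^+ 2
    - 2 * ((b00 * b11 - b01 ^+ 2) / D) * D ^+ 2
  = (b00 * g11 - 2 * b01 * g01 + b11 * g00) ^+ 2
    - 2 * (b00 * b11 - b01 ^+ 2) * (g00 * g11 - g01 ^+ 2).
  by rewrite -gE; field.
by field.
Qed.

Section Classification.
Variables (G : 'rV[R]_2 -> 'M[R]_2) (w : 'rV[R]_2 -> R) (t : R).
Hypotheses (sw : smooth_on U w) (w_gt0 : forall x, U x -> 0 < w x).
Hypothesis gwG : forall x, U x -> g x = w x *: G x.
Hypothesis t0 : t != 0.
Hypothesis trace_t : forall x, U x -> trace2 f nu x = t.

Let p y := w y * t.
Let Z y := p y *: nu y.

Let sp : smooth_on U p.
Proof. exact: (smoothM (patch_open P) sw (smooth_cst (patch_open P) t)). Qed.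

Lemma bitension_cmc x V E : open V -> V `<=` U -> orthonormal_frame G V E ->
  V x -> bitension L G f E x
  = w x *: (metric_trace g x (ddcov L f g Z x) - (2 * L ^- 2 * p x) *: nu x).
Proof.
move=> oV VU oE Vx.
have tp y : U y -> tension L G f y = p y *: nu y.
  move=> Uy; apply: (etrans (tension_conformal P sw w_gt0 gwG Uy)).
  exact: (congr1 (fun z => (w y * z) *: nu y) (trace_t Uy)).
exact: (bitension_conformal P sw w_gt0 gwG sp tp oV VU oE Vx).
Qed.

Hypothesis bih : biharmonic_on L G f U.

(** The biharmonic equation, freed of the frame and of the conformal factor. *)
Lemma trace_ddcov_normal x : U x ->
  metric_trace g x (ddcov L f g Z x) = (2 * L ^- 2 * p x) *: nu x.
Proof.
move=> Ux; have oU := patch_open P.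
have [E oE] := orthonormal_frame_exists oU
  (conformal_smooth P sw w_gt0 gwG) (fun y Uy => conformal_sym w_gt0 gwG Uy)
  (conformal_pos P w_gt0 gwG).
have := bih oU (@subset_refl _ U) oE Ux.
rewrite (bitension_cmc oU (@subset_refl _ U) oE Ux).
move=> /eqP; rewrite scaler_eq0 (gt_eqF (w_gt0 Ux)) /= subr_eq0.
by move=> /eqP.
Qed.

Lemma trace_ddcov_mink x X : U x ->
  metric_trace g x (fun u v => mink (ddcov L f g Z x u v) X : R^o)
  = 2 * L ^- 2 * p x * mink (nu x) X.
Proof.
by move=> Ux; rewrite -minkZl -(trace_ddcov_normal Ux) mink_metric_trace.
Qed.

(** As [form2] has divergence [0] by [codazzi_trace], the tangential part of the
    biharmonic equation puts the gradient of [p] in the kernel of [form2]. *)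
Lemma derive_p_det_form2 x k : U x -> 'D_k p x * det_form2 x = 0.
Proof.
move=> Ux; have D0 := lt0r_neq0 (pullback_det P Ux).
have [B BE] : exists B : 'rV[R]_2 -> 'rV[R]_2 -> 'rV[R]_2 -> R, forall k u v,
  B k u v = 'D_v p x * form2 f nu x u k + 'D_u p x * form2 f nu x v k by eexists.
have trB j : metric_trace g x (B j : _ -> _ -> R^o) = 0.
  have := trace_ddcov_mink ('D_j f x) Ux.
  rewrite (patch_normal P Ux) mulr0 => E.
  have E2 : metric_trace g x (fun u v => p x * cov_form2 f nu x u v j : R^o) = 0.
    have := metric_traceZ g x (p x) (fun u v => cov_form2 f nu x u v j : R^o).
    rewrite (codazzi_trace P j Ux trace_t) scaler0; exact.
  have S := metric_traceD g x (B j : _ -> _ -> R^o)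
    (fun u v => p x * cov_form2 f nu x u v j : R^o).
  apply: (etrans (esym (etrans S (etrans (congr1 (+%R _) E2) (addr0 _))))).
  apply: (etrans _ E); apply: eq_metric_trace => u v; rewrite BE.
  exact: (esym (mink_ddcov_df P sp (evec u) (evec v) j Ux)).
have BC j u v : B j u v = B j v u.
  exact: (etrans (BE j u v) (etrans (addrC _ _) (esym (BE j v u)))).
have key j := etrans (esym (metric_trace2E P Ux (BC (evec j)))) (trB (evec j)).
have [d0 d1] : 'D_(evec 0) p x * det_form2 x = 0
    /\ 'D_(evec 1) p x * det_form2 x = 0.
  have := key 1; have := key 0; rewrite !BE (form2C P (evec 1) (evec 0) Ux).
  exact: kernel_det D0 (pullback_gram f x).
have lin : 'D_k p x = k 0 0 * 'D_(evec 0) p x + k 0 1 * 'D_(evec 1) p x.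
  apply: (linear_rV2 (l := fun k => 'D_k p x : R^o)) => a z z'.
  exact: (derive_lin a z z' (smooth_diff sp Ux)).
by rewrite lin mulrDl -!mulrA d0 d1 !mulr0 addr0.
Qed.

(** The characteristic polynomial of the shape operator has constant
    coefficients, so its roots serve [principal_product] at all points. *)
Lemma constant_principal_curvatures x (d : R) m1 m2 : m1 != m2 -> m1 + m2 = t ->
  m1 * m2 = d ->
  (forall y, U y -> det_form2 y / \det (g y) = d) -> U x -> d = - L ^- 2.
Proof.
move=> m12 sm pm dE Ux; rewrite -pm; apply: (principal_product P m12 _ Ux).
move=> y Uy; have root m : (m - m1) * (m - m2) = 0 ->
    exists2 X : 'rV[R]_2, X != 0 & 'D_X nu y = m *: 'D_X f y.
  move=> m0; apply: (principal_exists Uy); rewrite (dE y Uy) (trace_t Uy).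
  by rewrite -pm -sm -[RHS]m0; ring.
have [X1 X10 E1] := root m1 (etrans (congr1 ( *%R^~ _) (subrr m1)) (mul0r _)).
have [X2 X20 E2] := root m2 (etrans (congr1 ( *%R _) (subrr m2)) (mulr0 _)).
exists X1, X2; split; [exact: X10|exact: X20|exact: E1|exact: E2].
Qed.

Hypothesis dp0 : forall x k, U x -> 'D_k p x = 0.

(** For constant [p], the normal part of the biharmonic equation fixes the norm
    of the shape operator. *)
Lemma trace_form3_biharmonic x : U x ->
  metric_trace g x (form3 nu x : _ -> _ -> R^o) = 2 * L ^- 2.
Proof.
move=> Ux; have px : p x != 0 by rewrite mulf_neq0// gt_eqF// w_gt0.
have ddp u v : 'D_u ('D_v p) x = 0.
  apply: (derive_near _ (is_derive_cst (0 : R) x u)).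
  by apply: (near_open (patch_open P) Ux) => y Uy; exact: dp0.
have E := trace_ddcov_mink (nu x) Ux; rewrite (patch_unit P Ux) in E.
have S := metric_traceZ g x (- p x) (form3 nu x : _ -> _ -> R^o).
have N0 : - p x != 0 by rewrite oppr_eq0.
apply: (mulfI N0); apply: (etrans (esym S)).
apply: (etrans _ (etrans E _)); last by ring.
apply: eq_metric_trace => i j.
apply: (etrans _ (esym (mink_ddcov_nu P sp (evec i) (evec j) Ux))).
have alg (a b c d : R) : a = 0 -> b = 0 -> - c *: (d : R^o) = - (a - b) - c * d.
  by move=> -> ->; rewrite subrr oppr0 add0r -mulNr.
exact: (alg _ _ _ _ (ddp _ _) (dp0 _ Ux)).
Qed.

(** The principal curvatures have sum [t] and sum of squares [2 L^-2], so they
    are constant.  If they were distinct, their product would be [- L^-2] and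
    [t ^ 2] would vanish. *)
Lemma umbilical_of_biharmonic x v : U x ->
  t ^+ 2 = 4 * L ^- 2 /\ 'D_v nu x = (t / 2) *: 'D_v f x.
Proof.
move=> Ux; have L0 := patch_L P; pose d := (t ^+ 2 - 2 * L ^- 2) / 2.
have dE y : U y -> det_form2 y / \det (g y) = d.
  move=> Uy; have := trace_form3_biharmonic Uy.
  rewrite (metric_trace_form3 Uy) (trace_t Uy) /d => <-.
  by move: (det_form2 _ / _) => z; field.
have := discriminant_ge0 Ux; rewrite (dE x Ux) (trace_t Ux).
rewrite le_eqVlt => /orP[/eqP E|lt0].
  split; first by rewrite -[LHS](addrK (t ^+ 2)) -[X in _ - X]E /d; field.
  rewrite -{1}(trace_t Ux); apply: (umbilic_of_discriminant v Ux).
  by rewrite (dE x Ux) (trace_t Ux).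
pose s := Num.sqrt (t ^+ 2 - 4 * d).
have s0 : s != 0 by rewrite gt_eqF// sqrtr_gt0 subr_gt0.
have s2 : s ^+ 2 = t ^+ 2 - 4 * d by rewrite sqr_sqrtr// subr_ge0 ltW.
have dL : d = - L ^- 2.
  apply: (constant_principal_curvatures (m1 := (t + s) / 2) (m2 := (t - s) / 2)) Ux => //.
  - by apply: contra s0 => /eqP E; apply/eqP; move: E; lra.
  - by field.
  - apply: (etrans (y := (t ^+ 2 - s ^+ 2) / 4)); first by field.
    by rewrite s2; field.
have : t ^+ 2 = 0 by rewrite -[LHS](subrK (2 * L ^- 2)) -[X in X + _](mulfVK (x := 2)) -/d ?dL//; field.
by move=> /eqP; rewrite sqrf_eq0 (negPf t0).
Qed.

End Classification.
End PrincipalCurvatures.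

Section LocalClassification.
Context {R : realType}.
Variables (L : R) (U : set 'rV[R]_2) (f nu : 'rV[R]_2 -> 'rV[R]_4).
Variables (G : 'rV[R]_2 -> 'M[R]_2) (w : 'rV[R]_2 -> R) (t : R).
Hypothesis P : spacelike_patch L U f nu.
Hypotheses (sw : smooth_on U w) (w_gt0 : forall x, U x -> 0 < w x).
Hypothesis gwG : forall x, U x -> pullback_mx f x = w x *: G x.
Hypothesis t0 : t != 0.
Hypothesis trace_t : forall x, U x -> trace2 f nu x = t.
Hypothesis bih : biharmonic_on L G f U.

(** The open set on which the derivative is nonzero is empty: [det_form2]
    vanishes on it, so that [0] and [t] would be its principal curvatures. *)
Lemma dilation_locally_constant x k : U x -> 'D_k (fun y => w y * t) x = 0.
Proof.
move=> Ux; have oU := patch_open P.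
have sp : smooth_on U (fun y => w y * t).
  exact: (smoothM oU sw (smooth_cst oU t)).
apply/eqP; apply: contraT => Dx.
pose U' := U `&` [set y | 'D_k (fun y => w y * t) y != 0].
have U'U : U' `<=` U by exact: subIsetl.
have oU' : open U'.
  rewrite openE => y [Uy ny]; apply: filterI.
    by apply: open_nbhs_nbhs; split.
  have cD := smooth_continuous (smooth_derive k sp) Uy.
  exact: (cD _ (open_nbhs_nbhs (conj (open_neq (y := 0)) ny))).
have P' := patch_sub oU' U'U P.
(* On [U'] the characteristic polynomial is [m ^ 2 - m * t]. *)
have dE y : U' y -> det_form2 f nu y / \det (pullback_mx f y) = 0.
  move=> [Uy ny]; have := derive_p_det_form2 P sw w_gt0 gwG trace_t bih k Uy.
  by rewrite mulrC => /(mulr_eq0l ny) ->; rewrite mul0r.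
have t0' : 0 != t by rewrite eq_sym.
have := constant_principal_curvatures P' (fun y Uy => trace_t (U'U y Uy)) t0' (add0r t)
  (mul0r t) dE (conj Ux Dx).
by move=> /esym/eqP; rewrite oppr_eq0 invr_eq0 expf_eq0 (negPf (patch_L P)).
Qed.

Lemma local_classification x v : U x ->
  [/\ t ^+ 2 = 4 * L ^- 2, 'D_v nu x = (t / 2) *: 'D_v f x & 'D_v w x = 0].
Proof.
move=> Ux.
have [t2 Dn] := umbilical_of_biharmonic P sw w_gt0 gwG t0 trace_t bih
  dilation_locally_constant v Ux.
split=> //; apply: (mulr_eq0l t0).
by rewrite -(derive_mulr t (smooth_derivable (v := v) sw Ux));
  exact: dilation_locally_constant.
Qed.

End LocalClassification.

(** * Umbilical patches *)

Section UmbilicalPatch.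
Context {R : realType}.
Variables (L : R) (U : set 'rV[R]_2) (f nu : 'rV[R]_2 -> 'rV[R]_4) (m : R).
Hypothesis P : spacelike_patch L U f nu.
Hypothesis m2 : m ^+ 2 = L ^- 2.
Hypothesis Dn : forall x v, U x -> 'D_v nu x = m *: 'D_v f x.
Implicit Types (x u v : 'rV[R]_2).
Local Notation g := (pullback_mx f).

Let form2E x u v : U x -> form2 f nu x u v = m * form1 f x u v.
Proof.
move=> Ux; apply: (etrans (congr1 (mink^~ _) (Dn u Ux))); exact: minkZl.
Qed.

Let det_form2E x : U x -> det_form2 f nu x = m ^+ 2 * \det (g x).
Proof.
move=> Ux; rewrite /det_form2 !form2E// (pullback_gram f x).
by move: (form1 f x _ _) (form1 f x _ _) (form1 f x _ _) => a b c; ring.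
Qed.

Lemma umbilical_trace2 x : U x -> trace2 f nu x = 2 * m.
Proof.
move=> Ux; apply: (mulIf (lt0r_neq0 (pullback_det P Ux))).
apply: (etrans (trace2E P Ux)); rewrite !form2E// (pullback_gram f x).
by move: (form1 f x _ _) (form1 f x _ _) (form1 f x _ _) => a b c; ring.
Qed.

Lemma umbilical_mean_curvature x : U x ->
  mean_curvature_vector L f x = m *: nu x.
Proof.
move=> Ux; rewrite (mean_curvature_patch P Ux) (umbilical_trace2 Ux).
by rewrite mulKf// pnatr_eq0.
Qed.

Lemma umbilical_gauss_curvature x : U x ->
  gauss_curvature g x = - (2 / L ^+ 2).
Proof.
move=> Ux; rewrite (gauss_equation P Ux) -/(det_form2 f nu x) det_form2E//.
by rewrite mulfK ?lt0r_neq0 ?(pullback_det P Ux)// m2; ring.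
Qed.

Lemma umbilical_shape x : U x -> row_free (jacobian f x) ->
  shape_mx L f nu x = (- m)%:M.
Proof.
move=> Ux fr; have df := smooth_diff (patch_f P) Ux.
have E : (\matrix_(i < 2) - cov_along L f (cst (evec i)) nu x)
    = (- m)%:M *m jacobian f x.
  apply/row_matrixP => i; rewrite rowK mul_scalar_mx linearZ /=.
  have nE : cov_along L f (cst (evec i)) nu x = m *: 'D_(evec i) f x.
    apply: (etrans (tproj_id _ _) (Dn (evec i) Ux)).
    by rewrite minkC; exact: (mink_f_dnu P).
  by rewrite nE deriveEjacobian// rowE scaleNr.
by rewrite /shape_mx E -mulmxA mulmxVp// mulmx1.
Qed.

(** The tangential part of the bitension field vanishes because [w] and the
    trace of [form2] are constant, the normal part because the shape operator
    has squared norm [2 m ^ 2 = 2 L^-2]. *)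
Lemma umbilical_biharmonic (G : 'rV[R]_2 -> 'M[R]_2) (w : 'rV[R]_2 -> R) :
  smooth_on U w -> (forall x, U x -> 0 < w x) ->
  (forall x, U x -> g x = w x *: G x) ->
  (forall x v, U x -> 'D_v w x = 0) -> biharmonic_on L G f U.
Proof.
move=> sw w0 gwG Dw V E oV VU oE x Vx; have Ux := VU _ Vx.
pose t := 2 * m; pose p y := w y * t.
have trt y : U y -> trace2 f nu y = t by exact: umbilical_trace2.
have sp : smooth_on U p := smoothM (patch_open P) sw (smooth_cst (patch_open P) t).
have dp y v : U y -> 'D_v p y = 0.
  by move=> Uy; rewrite (derive_mulr t (smooth_derivable sw Uy)) Dw// mul0r.
have ddp u v : 'D_u ('D_v p) x = 0.
  apply: (derive_near _ (is_derive_cst (0 : R) x u)).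
  by apply: (near_open (patch_open P) Ux) => y Uy; exact: dp.
rewrite (bitension_cmc P sw w0 gwG trt oV VU oE Vx) -/p.
suff -> : metric_trace g x (ddcov L f g (fun y => p y *: nu y) x)
    = (2 * L ^- 2 * p x) *: nu x by rewrite subrr scaler0.
apply: (patch_ext P Ux) => [||k].
- rewrite mink_metric_trace minkZl (patch_tangent P)// mulr0.
  apply: (etrans (y := metric_trace g x (fun _ _ => 0 : R^o))).
    by apply: eq_metric_trace => i j; exact: (mink_ddcov_f P).
  by have := metric_traceZ g x 0 (fun _ _ => 0 : R^o); rewrite !scale0r.
- rewrite mink_metric_trace minkZl (patch_unit P)//.
  have S := metric_traceZ g x (- p x) (form3 nu x : _ -> _ -> R^o).
  rewrite (metric_trace_form3 P Ux) (trt x Ux) det_form2E// in S.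
  rewrite mulfK ?lt0r_neq0 ?(pullback_det P Ux)// in S.
  apply: (etrans _ (etrans S _)).
    apply: eq_metric_trace => i j.
    apply: (etrans (mink_ddcov_nu P sp (evec i) (evec j) Ux)).
    rewrite ddp dp// subrr oppr0 add0r.
    exact: (esym (mulNr _ _)).
  rewrite -m2 /t; apply: (etrans (y := - p x * ((2 * m) ^+ 2 - 2 * m ^+ 2))) => //.
  by move: (p x) => z; ring.
- rewrite mink_metric_trace minkZl (patch_normal P)// mulr0.
  have S := metric_traceZ g x (p x) (fun u v => cov_form2 f nu x u v k : R^o).
  rewrite (codazzi_trace P k Ux trt) scaler0 in S.
  apply: (etrans _ S); apply: eq_metric_trace => i j.
  apply: (etrans (mink_ddcov_df P sp (evec i) (evec j) k Ux)).
  have alg (a b c d e : R) : a = 0 -> b = 0 -> a * c + b * d + e = e.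
    by move=> -> ->; rewrite !mul0r !add0r.
  exact: alg (dp x (evec j) Ux) (dp x (evec i) Ux).
Qed.

End UmbilicalPatch.

(** * Mean value and inverse function theorems *)

Section MeanValue.
Context {R : realType} {V : normedModType R}.

Lemma mean_value (f : V -> R) (x y : V) :
  (forall t : R, 0 <= t <= 1 -> differentiable f (x + t *: (y - x))) ->
  exists2 t : R, 0 <= t <= 1 & f y - f x = 'D_(y - x) f (x + t *: (y - x)).
Proof.
move=> df; have d (t : R) : 0 <= t <= 1 -> is_derive t (1 : R)
    (fun t => f (x + t *: (y - x))) ('D_(y - x) f (x + t *: (y - x))).
  by move=> /df; exact: derive_line.
have [||c cI E] := @MVT_segment _ (fun t => f (x + t *: (y - x)))
  (fun t => 'D_(y - x) f (x + t *: (y - x))) 0 1 ler01.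
- by move=> t /itvP tI; apply: d; rewrite !tI.
- apply: derivable_within_continuous => t /itvP tI.
  by apply: ex_derive; apply: d; rewrite !tI.
exists c; first by rewrite !(itvP cI).
by move: E; rewrite scale1r scale0r addr0 subr0 mulr1 [x + (_ - _)]addrC subrK.
Qed.

Lemma ball_segment (x0 x y : V) (r t : R) : ball x0 r x -> ball x0 r y ->
  0 <= t <= 1 -> ball x0 r (x + t *: (y - x)).
Proof.
rewrite -!ball_normE /= => xr yr /andP[t0 t1].
have -> : x0 - (x + t *: (y - x)) = (1 - t) *: (x0 - x) + t *: (x0 - y).
  rewrite scalerBl scale1r -addrA [X in _ = _ + X]addrC -scalerBr.
  have -> : x0 - y - (x0 - x) = - (y - x).
    by rewrite !opprB addrC addrA subrK.
  by rewrite scalerN opprD addrA.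
have r0 : 0 < r by exact: le_lt_trans (normr_ge0 _) xr.
apply: (le_lt_trans (ler_normD _ _)); rewrite !normrZ (ger0_norm t0).
rewrite ger0_norm ?subr_ge0//.
have [->|tn] := eqVneq t 0; first by rewrite subr0 mul1r mul0r addr0.
have tp : 0 < t by rewrite lt_neqAle eq_sym tn.
have -> : r = (1 - t) * r + t * r by rewrite -mulrDl subrK mul1r.
apply: ler_ltD; last by rewrite ltr_pM2l.
by apply: ler_wpM2l; [rewrite subr_ge0|exact: ltW].
Qed.

Lemma derive0_near_constant (U : set V) (f : V -> R) x : open U -> U x ->
  (forall y, U y -> differentiable f y) ->
  (forall y v, U y -> 'D_v f y = 0) -> \forall y \near x, f y = f x.
Proof.
move=> oU Ux df Df.
have /nbhs_ballP[r /= r0 rU] : nbhs x U by exact: open_nbhs_nbhs.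
apply/nbhs_ballP; exists r => // y yr; apply/eqP; rewrite -subr_eq0; apply/eqP.
have seg (t : R) : 0 <= t <= 1 -> U (x + t *: (y - x)).
  by move=> tI; apply: rU; apply: ball_segment => //; exact: ballxx.
have [t tI ->] := mean_value (fun t tI => df _ (seg t tI)).
by rewrite Df//; exact: seg.
Qed.

End MeanValue.

Section LinearMaps.
Context {R : realType}.

Lemma smooth_id (V : normedModType R) (U : set V) : smooth_on U id.
Proof.
case=> [|k]; first by move=> x _ B; exact.
split=> [x _|v]; first exact: ex_diff.
have -> : (fun x : V => 'D_v id x) = cst v by apply/funext => x; rewrite derive_id.
elim: k v => [|k IH] v; first by move=> x _; exact: cst_continuous.
split=> [x _|w]; first exact: differentiable_cst.
have -> : (fun x : V => 'D_w (cst v) x) = cst 0.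
  by apply/funext => x; rewrite derive_cst.
exact: IH.
Qed.

Lemma continuous_mulmxr m n (A : 'M[R]_(m, n)) :
  continuous (mulmxr A : 'rV[R]_m -> 'rV[R]_n).
Proof.
move=> x; have oT := @openT 'rV[R]_m.
exact: (smooth_continuous
  (smooth_mulmx oT (@smooth_id _ setT) (smooth_cst oT A)) (I : setT x)).
Qed.

Lemma derive_mulmxr (V : normedModType R) m n (F : V -> 'rV[R]_m)
    (A : 'M[R]_(m, n)) x v : differentiable F x ->
  is_derive x v (fun y => F y *m A) ('D_v F x *m A).
Proof.
move=> dF; have cA := @continuous_mulmxr m n A.
have dA : differentiable (mulmxr A : 'rV[R]_m -> 'rV[R]_n) (F x).
  exact: linear_differentiable.
have dFA : differentiable (mulmxr A \o F) x by exact: differentiable_comp.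
split; first exact: (diff_derivable (f := mulmxr A \o F)).
apply: (etrans (deriveE v dFA)).
by rewrite (diff_comp dF dA) (diff_lin _ cA) /= deriveE.
Qed.

End LinearMaps.

Section InverseFunction.
Context {R : realType}.
Implicit Types (x y v : 'rV[R]_2).

Lemma coord_le_norm v i : `|v 0 i| <= `|v|.
Proof.
rewrite [leRHS]/Num.Def.normr /= mx_normrE.
by apply/bigmax_geP; right => /=; exists (0, i).
Qed.

Lemma norm_le_coord v (c : R) : 0 <= c -> (forall i, `|v 0 i| <= c) -> `|v| <= c.
Proof.
move=> c0 vc; rewrite /Num.Def.normr /= mx_normrE (bigmax_le _ c0)//= => -[i j] _.
by rewrite (ord1 i); exact: vc.
Qed.

(** The norm is the maximum norm, so the two partial derivatives contribute
    [2 q]. *)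
Lemma lipschitz_of_derive (h : 'rV[R]_2 -> 'rV[R]_2) x0 (r q : R) : 0 <= q ->
  (forall x, ball x0 r x -> differentiable h x) ->
  (forall x j, ball x0 r x -> `|'D_(evec j) h x| <= q) ->
  forall x y, ball x0 r x -> ball x0 r y -> `|h y - h x| <= 2 * q * `|y - x|.
Proof.
move=> q0 dh Dh x y xr yr.
apply: norm_le_coord => [|i]; first by rewrite !mulr_ge0.
rewrite !mxE; pose hi x : R := h x 0 i.
have dhi z v : ball x0 r z -> derivable h z v by move=> /dh/diff_derivable.
have dfi (t : R) : 0 <= t <= 1 -> differentiable hi (x + t *: (y - x)).
  move=> tI; apply: (differentiable_comp (f := h) (g := fun z : 'rV_2 => z 0 i)).
    by apply: dh; exact: ball_segment.
  exact: differentiable_coord.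
have [t tI E] := mean_value dfi; rewrite -!/(hi _) E {E}.
have zr := ball_segment xr yr tI; have dfz := dfi t tI.
move: (x + t *: (y - x)) zr dfz => z zr dfz.
have -> : 'D_(y - x) hi z = (y - x) 0 0 * ('D_(evec 0) h z) 0 i
    + (y - x) 0 1 * ('D_(evec 1) h z) 0 i.
  have := linear_rV2 (l := fun k => 'D_k hi z : R^o) (y - x)
    (fun a z1 z2 => derive_lin a z1 z2 dfz).
  move=> ->; rewrite (derive_coord 0 i (dhi z (evec 0) zr)).
  by rewrite (derive_coord 0 i (dhi z (evec 1) zr)).
have bd j : `|(y - x) 0 j * ('D_(evec j) h z) 0 i| <= q * `|y - x|.
  rewrite normrM mulrC ler_pM//; last exact: coord_le_norm.
  exact: le_trans (coord_le_norm _ _) (Dh z j zr).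
apply: (le_trans (ler_normD _ _)); apply: (le_trans (lerD (bd 0) (bd 1))).
by rewrite -mulrA mulr_natl mulr2n.
Qed.

Lemma contraction_fixed_point (A : set 'rV[R]_2) (k : 'rV[R]_2 -> 'rV[R]_2)
    (q : R) x0 : 0 <= q -> q < 1 -> closed A -> A x0 ->
  (forall x, A x -> A (k x)) ->
  (forall x y, A x -> A y -> `|k y - k x| <= q * `|y - x|) ->
  exists2 x, A x & x = k x.
Proof.
move=> q0 q1 cA A0 kA kq.
pose X : completeNormedModType R :=
  HB.pack 'rV[R]_2 (Complete.on 'rV[R]_2) (NormedModule.on 'rV[R]_2).
pose k' : {fun (A : set X) >-> (A : set X)} := mkfun_fun (kA : {homo k : x / A x >-> A x}).
apply: (@banach_fixed_point R X A k') => //; last by exists x0.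
exists (NngNum q0); split => // -[x y] /= [Ax Ay].
exact: kq.
Qed.

(** The inverse function theorem.  With [A] the inverse of the Jacobian at [x0],
    the map [x - F x *m A] contracts distances by half near [x0]; this makes [F]
    injective there, and a fixed point of [x - (F x - z) *m A] is a preimage of
    [z]. *)
Lemma local_homeomorphism (U : set 'rV[R]_2) (F : 'rV[R]_2 -> 'rV[R]_2) x0 :
  open U -> smooth_on U F -> U x0 -> jacobian F x0 \in unitmx ->
  exists B : set 'rV[R]_2, [/\ open B, B x0, B `<=` U,
    (forall x y, B x -> B y -> F x = F y -> x = y) &
    (forall V, open V -> V `<=` B -> open (F @` V))].
Proof.
move=> oU sF Ux0 JU; pose A := invmx (jacobian F x0).
have AU : A \in unitmx by rewrite unitmx_inv.
pose h x := (-1) *: (F x *m A) + x.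
have sFA : smooth_on U (fun x => F x *m A).
  exact: (smooth_mulmx oU sF (smooth_cst oU A)).
have sh : smooth_on U h.
  apply: (smoothD oU); last exact: smooth_id.
  exact: (smoothZ oU (smooth_cst oU (-1 : R)) sFA).
have Dh v : 'D_v h x0 = 0.
  have [_ E] := derive_comb (-1) (smooth_derivable (v := v) sFA Ux0)
    (@derivable_id _ _ x0 v).
  apply: (etrans E); rewrite derive_id.
  have dF := smooth_diff sF Ux0; have [_ ->] := derive_mulmxr A v dF.
  by rewrite deriveEjacobian// mulmxK// scaleN1r addNr.
(* Two partial derivatives bounded by 1/4 give the contraction factor 1/2. *)
have nDh j : \forall z \near x0, `|'D_(evec j) h z| <= 4^-1.
  have := smooth_continuous (smooth_derive (evec j) sh) Ux0.
  move=> /cvgrPdist_lt/(_ (4^-1)); rewrite invr_gt0 ltr0n => /(_ isT).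
  by apply: filterS => z; rewrite Dh sub0r normrN => /ltW.
have /nbhs_ballP[r /= r0 rU] : \forall z \near x0, U z /\
    (`|'D_(evec 0) h z| <= 4^-1 /\ `|'D_(evec 1) h z| <= 4^-1).
  apply: filterI; first exact: open_nbhs_nbhs.
  by apply: filterI; exact: nDh.
have BU : ball x0 r `<=` U by move=> z /rU[].
have lip x y : ball x0 r x -> ball x0 r y -> `|h y - h x| <= 2^-1 * `|y - x|.
  move=> xr yr; have -> : (2^-1 : R) = 2 * 4^-1 by field.
  have q0 : (0 : R) <= 4^-1 by rewrite invr_ge0.
  apply: (@lipschitz_of_derive h x0 r _ q0 _ _ x y xr yr) => [z /BU Uz|z j zr].
  - exact: (smooth_diff sh Uz).
  - by case: (ord2P j) => ->; [exact: (rU z zr).2.1|exact: (rU z zr).2.2].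
exists (ball x0 r); split => //.
- exact: ball_open.
- exact: ballxx.
- move=> x y xr yr Fxy; have := lip x y xr yr.
  rewrite /h Fxy opprD addrACA subrr add0r => le2.
  apply/eqP; rewrite eq_sym -subr_eq0 -normr_le0.
  by move: le2; move: `|y - x| => d; lra.
move=> V oV VB; rewrite openE => _ [y0 Vy0 <-].
have /nbhs_ballP[e /= e0 eV] : nbhs y0 V by exact: open_nbhs_nbhs.
have e2 : 0 < e / 2 by rewrite divr_gt0.
(* The iteration stays in a closed ball inside [V] for [z] near [F y0]. *)
have CV : closed_ball y0 (e / 2) `<=` V.
  apply: subset_trans eV; apply: closed_ball_subset => //.
  by rewrite ltr_pdivrMr// ltr_pMr// ltr1n.
have := @continuous_mulmxr R 2 2 A (F y0).
move=> /cvgrPdist_lt/(_ (e / 2 / 2)); rewrite divr_gt0// => /(_ isT).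
apply: filterS => z zA; pose k x := h x + z *m A.
have [||||||x Cx xE] := @contraction_fixed_point (closed_ball y0 (e / 2)) k 2^-1 y0.
- by rewrite invr_ge0.
- by rewrite invf_lt1// ltr1n.
- exact: closed_ball_closed.
- exact: closed_ballxx.
- move=> x Cx; move: (Cx); rewrite closed_ballE// /closed_ball_ /= => yx.
  rewrite distrC.
  have -> : k x - y0 = (h x - h y0) + (z *m A - F y0 *m A).
    rewrite /k /h !scaleN1r opprD opprK; rewrite [RHS]addrACA -!addrA.
    by do 3! congr (_ + _); rewrite addrCA subrr addr0.
  have := lip y0 x (VB _ Vy0) (VB _ (CV _ Cx)).
  have zA' : `|z *m A - F y0 *m A| < e / 2 / 2 by rewrite distrC.
  move=> l1; apply: (le_trans (ler_normD _ _)).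
  by move: l1 zA' yx; rewrite (distrC x) => l1 zA' yx; lra.
- move=> x y Cx Cy; have := lip x y (VB _ (CV _ Cx)) (VB _ (CV _ Cy)).
  have alg (a b c : 'rV[R]_2) : a + c - (b + c) = a - b.
    by rewrite opprD addrACA subrr addr0.
  by rewrite /k alg.
exists x; first exact: CV.
apply: (can_inj (mulmxK AU)); apply/eqP; rewrite -subr_eq0; apply/eqP.
have alg (a b c : 'rV[R]_2) : c = -1 *: a + c + b -> a - b = 0.
  move=> E; apply/eqP; rewrite subr_eq0 eq_sym -subr_eq0; apply/eqP.
  by apply: (addIr c); rewrite add0r [RHS]E scaleN1r [RHS]addrC addrA.
exact: alg xE.
Qed.

End InverseFunction.

(** * Isometries and the standard plane *)

Section Isometries.
Context {R : realType}.
Implicit Types (X Y n a b : 'rV[R]_4) (T : 'M[R]_4).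

Definition reflection n : 'M[R]_4 :=
  1%:M - (2 / mink n n) *: ((\col_i mink (delta_mx 0 i) n) *m n).

Lemma mul_reflection X n :
  X *m reflection n = X - (2 * mink X n / mink n n) *: n.
Proof.
rewrite mulmxBr mulmx1 -scalemxAr mulmxA.
have -> : X *m (\col_i mink (delta_mx 0 i) n) = (mink X n)%:M.
  apply/matrixP => i j; rewrite !ord1 !mxE eqxx mulr1n; apply: eq_bigr => k _.
  by rewrite mxE minkC mink_delta; ring.
by rewrite mul_scalar_mx scalerA mulrAC.
Qed.

Lemma reflection_isometry n : mink n n != 0 -> ambient_isometry (reflection n).
Proof.
move=> n0 X Y; rewrite !mul_reflection !(minkDl, minkDr, minkNl, minkNr).
by rewrite !minkZl !minkZr (minkC n Y); field.
Qed.

Lemma isometryM T T' :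
  ambient_isometry T -> ambient_isometry T' -> ambient_isometry (T *m T').
Proof. by move=> iT iT' X Y; rewrite !mulmxA iT' iT. Qed.

Lemma isometryN T : ambient_isometry T -> ambient_isometry (- T).
Proof. by move=> iT X Y; rewrite !mulmxN minkNl minkNr opprK iT. Qed.

Lemma isometry_unit T : ambient_isometry T -> T \in unitmx.
Proof.
move=> iT; rewrite -row_free_unit; apply: inj_row_free => X XT.
by apply: mink_nondegenerate => Y; rewrite -iT XT mink0l.
Qed.

(** One of [a - b] and [a + b] is not null, since their norms add up to
    [4 <a, a>]; the corresponding reflection maps [a] to [b] or to [- b]. *)
Lemma isometry_transitive a b : mink a a = mink b b -> mink a a != 0 ->
  exists T, ambient_isometry T /\ a *m T = b.
Proof.
move=> ab a0.
have refl c : mink a a = mink c c -> mink (a - c) (a - c) != 0 ->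
    a *m reflection (a - c) = c.
  move=> ac n0; rewrite mul_reflection.
  have -> : 2 * mink a (a - c) = mink (a - c) (a - c).
    rewrite !(minkDl, minkDr, minkNl, minkNr) (minkC c a) -ac.
    by move: (mink a a) (mink a c) => p q; ring.
  by rewrite divff// scale1r opprB addrC subrK.
have [n0|] := eqVneq (mink (a - b) (a - b)) 0; last first.
  move=> n0; exists (reflection (a - b)).
  by split; [exact: reflection_isometry|exact: refl].
have n1 : mink (a - - b) (a - - b) != 0.
  apply: contra a0 => /eqP n1; apply/eqP; move: n0 n1.
  rewrite !(minkDl, minkDr, minkNl, minkNr) (minkC b a) -ab.
  by move: (mink a a) (mink a b) => p q; lra.
exists (- reflection (a - - b)); split.
  by apply: isometryN; exact: reflection_isometry.
by rewrite mulmxN (refl (- b))// ?opprK// minkNl minkNr opprK.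
Qed.

End Isometries.

Section Pullback.
Context {R : realType}.

Lemma row_free_pullback (f : 'rV[R]_2 -> 'rV[R]_4) x : differentiable f x ->
  (forall v, v != 0 -> 0 < gip (pullback_mx f) x v v) ->
  row_free (jacobian f x).
Proof.
move=> df pos; apply: inj_row_free => v; rewrite -deriveEjacobian// => Dv.
apply/eqP; apply: contraT => /pos.
by rewrite gip_pullback_diff// Dv mink0l ltxx.
Qed.

Lemma pullback_isometry (f : 'rV[R]_2 -> 'rV[R]_4) (T : 'M[R]_4) x :
  ambient_isometry T -> differentiable f x ->
  pullback_mx (fun y => f y *m T) x = pullback_mx f x.
Proof.
move=> iT df; apply/matrixP => i j; rewrite !mxE.
have [_ Ei] := derive_mulmxr T (evec i) df.
have [_ Ej] := derive_mulmxr T (evec j) df.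
by apply: (etrans (f_equal2 mink Ei Ej)); exact: iT.
Qed.

Lemma derive_comp m n p (F : 'rV[R]_n -> 'rV[R]_p) (psi : 'rV[R]_m -> 'rV[R]_n)
    x v : differentiable psi x -> differentiable F (psi x) ->
  'D_v (F \o psi) x = 'D_('D_v psi x) F (psi x).
Proof.
move=> dp dF; rewrite (deriveE _ (differentiable_comp dp dF)) (diff_comp dp dF).
by rewrite (deriveE _ dF) (deriveE _ dp).
Qed.

Lemma pullback_comp (F : 'rV[R]_2 -> 'rV[R]_4) (psi : 'rV[R]_2 -> 'rV[R]_2) x :
  differentiable psi x -> differentiable F (psi x) ->
  pullback_mx (F \o psi) x
  = jacobian psi x *m pullback_mx F (psi x) *m (jacobian psi x)^T.
Proof.
move=> dp dF; apply/matrixP => i j; rewrite [LHS]mxE.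
have D k : 'D_(evec k) (F \o psi) x = 'D_(row k (jacobian psi x)) F (psi x).
  by rewrite rowE -(deriveEjacobian _ dp); exact: derive_comp.
apply: (etrans (f_equal2 mink (D i) (D j))).
rewrite -(gip_pullback_diff _ _ dF) /gip -row_mul !mxE.
by apply: eq_bigr => k _; rewrite !mxE.
Qed.

End Pullback.

Section StandardPlane.
Context {R : realType}.
Variable L : R.
Hypothesis L_gt0 : 0 < L.
Implicit Types (X : 'rV[R]_4) (u v : 'rV[R]_2).
Local Notation e1 := (delta_mx 0 (inord 1) : 'rV[R]_4).

Let L0 : L != 0. Proof. exact: lt0r_neq0. Qed.
Let s2 : Num.sqrt 2 ^+ 2 = 2 :> R. Proof. by rewrite sqr_sqrtr// ler0n. Qed.
Let s0 : Num.sqrt 2 != 0 :> R. Proof. by rewrite gt_eqF// sqrtr_gt0. Qed.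

(** The projection to [X_2], [X_3], over which the standard plane is a graph. *)
Definition std_coords : 'M[R]_(4, 2) := \matrix_(i, j) (i == inord (2 + j))%:R.

Lemma mul_std_coords X j : (X *m std_coords) 0 j = X 0 (inord (2 + j)).
Proof.
rewrite mxE (bigD1 (inord (2 + j)))//= mxE eqxx mulr1 big1 ?addr0// => i ij.
by rewrite mxE (negPf ij) mulr0.
Qed.

Lemma std_immersionK u : std_immersion L u *m std_coords = u.
Proof.
apply/rowP => j; rewrite mul_std_coords mxE inordK; last by case: j => -[|[]].
by case: (ord2P j) => ->.
Qed.

Lemma std_coordsK X : std_plane L X -> std_immersion L (X *m std_coords) = X.
Proof.
by rewrite -(std_immersion_range L_gt0) => -[u _ <-]; rewrite std_immersionK.
Qed.

Lemma std_immersion_plane u : std_plane L (std_immersion L u).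
Proof. by rewrite -(std_immersion_range L_gt0); exists u. Qed.

Lemma mink_e1 X : mink X e1 = - X 0 (inord 1).
Proof. by rewrite mink_delta inordK// mulN1r. Qed.

Lemma mink_e1_plane X : std_plane L X -> mink X e1 = - (L / Num.sqrt 2).
Proof. by move=> [_ _ X1]; rewrite mink_e1 X1. Qed.

Lemma mink4 X Y : mink X Y = - (X 0 (inord 0) * Y 0 (inord 0))
  - X 0 (inord 1) * Y 0 (inord 1) + X 0 (inord 2) * Y 0 (inord 2)
  + X 0 (inord 3) * Y 0 (inord 3).
Proof.
have E k (i : 'I_4) : (k < 4)%N -> i = k :> nat -> inord k = i.
  by move=> k4 ik; apply: val_inj; rewrite /= ik inordK.
rewrite (E 0%N ord0)// (E 1%N (lift ord0 ord0))//.
rewrite (E 2 (lift ord0 (lift ord0 ord0)))//.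
rewrite (E 3 (lift ord0 (lift ord0 (lift ord0 ord0))))//.
rewrite /mink !big_ord_recl big_ord0 /=; set l := lift; move: l => l; ring.
Qed.

Lemma std_normalE X Y : mink (std_normal L X) Y
  = Num.sqrt 2 * mink e1 Y - L^-1 * mink X Y.
Proof. by rewrite /std_normal minkDl minkNl !minkZl. Qed.

Lemma std_normal_tangent X : std_plane L X -> mink (std_normal L X) X = 0.
Proof.
move=> pX; have [aX _ _] := pX.
rewrite std_normalE minkC (mink_e1_plane pX) aX.
by move: s0 L0 => a b; field; rewrite a b.
Qed.

Lemma std_normal_unit X : std_plane L X ->
  mink (std_normal L X) (std_normal L X) = -1.
Proof.
move=> pX; rewrite std_normalE !(minkC _ (std_normal _ _)) std_normal_tangent//.
rewrite std_normalE (mink_e1_plane pX) mink_e1 mxE !eqxx /=.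
move: s2 s0 L0 => E a b; rewrite mulr0 subr0 mulrBr mulrA -expr2 E.
by field; rewrite a b.
Qed.

(** The norm and the coordinate [X_1] are constant on the standard plane. *)
Lemma std_plane_tangent (U : set 'rV[R]_2) (F : 'rV[R]_2 -> 'rV[R]_4) x v :
  open U -> smooth_on U F -> (forall y, U y -> std_plane L (F y)) -> U x ->
  mink (F x) ('D_v F x) = 0 /\ mink e1 ('D_v F x) = 0.
Proof.
move=> oU sF pF Ux; have dF := smooth_derivable (v := v) sF Ux.
have Dcst (p : 'rV[R]_2 -> R) c d : (forall y, U y -> p y = c) ->
    is_derive x v p d -> d = 0.
  move=> pc [_ <-]; apply: (derive_near _ (is_derive_cst c x v)).
  by apply: (near_open oU Ux) => y Uy; exact: pc.
have E1 := Dcst _ _ _ (fun y Uy => (let: And3 a _ _ := pF y Uy in a))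
  (derive_mink dF dF).
have E2 := Dcst _ _ _ (fun y Uy => mink_e1_plane (pF y Uy))
  (derive_mink dF (@derivable_cst _ _ _ e1 x v)).
move: E1 E2; rewrite derive_cst.
move: ('D_v F x) (F x) => D X; rewrite mink0r addr0 (minkC X) => E1.
rewrite (minkC e1) => ->; split=> //.
by move: E1; lra.
Qed.

Lemma std_normal_orth (U : set 'rV[R]_2) (F : 'rV[R]_2 -> 'rV[R]_4) x v :
  open U -> smooth_on U F -> (forall y, U y -> std_plane L (F y)) -> U x ->
  mink (std_normal L (F x)) ('D_v F x) = 0.
Proof.
move=> oU sF pF Ux; have [E1 E2] := std_plane_tangent v oU sF pF Ux.
by rewrite std_normalE E1 E2 !mulr0 subr0.
Qed.

Lemma smooth_std_immersion (U : set 'rV[R]_2) (psi : 'rV[R]_2 -> 'rV[R]_2) :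
  open U -> smooth_on U psi -> smooth_on U (std_immersion L \o psi).
Proof.
move=> oU sp; apply: (smooth_mx oU) => i j; rewrite (ord1 i) {i}.
have sc k : smooth_on U (fun y => psi y 0 k) by exact: smooth_coord.
have sq k : smooth_on U (fun y => psi y 0 k ^+ 2) by exact: (smoothM oU).
have entry (h : 'rV[R]_2 -> R) : smooth_on U h ->
    (forall y, h y = (std_immersion L \o psi) y 0 j) ->
    smooth_on U (fun y => (std_immersion L \o psi) y 0 j).
  by move=> sh E; apply: (smooth_ext oU _ sh) => y _; exact: E.
case: j entry => -[|[|[|[|//]]]] hj entry.
- apply: (entry _ _ (fun y => esym (mxE _ _ _ _))).
  apply: (smooth_sqrt oU) => [y _|].
    by rewrite -addrA ltr_pwDl ?addr_ge0 ?sqr_ge0// divr_gt0// exprn_gt0.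
  by do 2! apply: (smoothD oU) => //; exact: (smooth_cst oU).
- apply: (entry _ _ (fun y => esym (mxE _ _ _ _))); exact: (smooth_cst oU).
- by apply: (entry _ (sc 0)) => y; rewrite [RHS]mxE.
- by apply: (entry _ (sc 1)) => y; rewrite [RHS]mxE.
Qed.

Lemma smooth_std : smooth_on setT (std_immersion L).
Proof. exact: (smooth_std_immersion openT (@smooth_id _ _ setT)). Qed.

(** Completing the square: [X_0 ^ 2] times the squared norm of a tangent vector
    with last coordinates [v] is [L ^ 2 / 2 * |v| ^ 2 + (u0 v1 - u1 v0) ^ 2]. *)
Lemma std_metric_pos u v : v != 0 -> 0 < gip (std_metric L) u v v.
Proof.
move=> v0; have df := smooth_diff smooth_std (I : setT u).
rewrite /std_metric gip_pullback_diff//.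
have Dcoords : 'D_v (std_immersion L) u *m std_coords = v.
  have [_ <-] := derive_mulmxr std_coords v df.
  rewrite -[RHS](@derive_id _ _ u v); congr ('D_v _ u); apply/funext => y.
  exact: std_immersionK.
have [tX t1] := std_plane_tangent v openT smooth_std
  (fun y _ => std_immersion_plane y) (I : setT u).
have [aX X0 X1] := std_immersion_plane u.
have d2 : ('D_v (std_immersion L) u) 0 (inord 2) = v 0 0.
  by rewrite -[in RHS]Dcoords mul_std_coords.
have d3 : ('D_v (std_immersion L) u) 0 (inord 3) = v 0 1.
  by rewrite -[in RHS]Dcoords mul_std_coords.
have d1 : ('D_v (std_immersion L) u) 0 (inord 1) = 0.
  by apply: oppr_inj; rewrite -mink_e1 minkC t1 oppr0.
have vpos : 0 < v 0 0 ^+ 2 + v 0 1 ^+ 2.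
  rewrite lt0r addr_ge0 ?sqr_ge0// andbT.
  apply: contra v0 => /eqP v0; apply/eqP/rowP => i; rewrite mxE.
  move: v0 => /eqP; rewrite paddr_eq0 ?sqr_ge0// !sqrf_eq0 => /andP[/eqP a /eqP b].
  by case: (ord2P i) => ->.
move: aX tX; rewrite /ads /= !mink4 d1 d2 d3 X1 {d1 d2 d3 Dcoords t1 df v0}.
have : (L / Num.sqrt 2) ^+ 2 = L ^+ 2 / 2 by rewrite exprMn exprVn s2.
have := exprn_gt0 2 L_gt0.
move: (std_immersion L u 0 (inord 0)) X0 (std_immersion L u 0 (inord 2))
  (std_immersion L u 0 (inord 3)) => a a0 b c.
move: (('D_v (std_immersion L) u) 0 (inord 0)) (L / Num.sqrt 2) (L ^+ 2) (v 0 0) (v 0 1) vpos.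
move=> d l k x y vpos k0 lk E1 E2.
rewrite -(pmulr_rgt0 _ (exprn_gt0 2 a0)).
have -> : a ^+ 2 * (- (d * d) - 0 * 0 + x * x + y * y)
    = k / 2 * (x ^+ 2 + y ^+ 2) + (b * y - c * x) ^+ 2.
  have ad : a * d = b * x + c * y by move: E2; lra.
  have aa : a ^+ 2 = k / 2 + b ^+ 2 + c ^+ 2.
    by move: E1 lk; rewrite !expr2; lra.
  have -> : a ^+ 2 * (- (d * d) - 0 * 0 + x * x + y * y)
    = - (a * d) ^+ 2 + a ^+ 2 * (x ^+ 2 + y ^+ 2) by ring.
  by rewrite ad aa; ring.
by rewrite ltr_pwDl ?sqr_ge0// mulr_gt0// divr_gt0.
Qed.

Lemma std_normal_affine X :
  std_normal L X = (- L^-1) *: X + Num.sqrt 2 *: e1.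
Proof. by rewrite /std_normal addrC scaleNr. Qed.

Lemma std_patch : spacelike_patch L setT (std_immersion L)
  (std_normal L \o std_immersion L).
Proof.
have oT := @openT 'rV[R]_2; have ss := smooth_std.
split=> //.
- apply: (@smooth_ext _ _ _ oT _
    (fun y => (- L^-1) *: std_immersion L y + Num.sqrt 2 *: e1)) => [y _|].
    by rewrite -std_normal_affine.
  apply: (smoothD oT); last exact: (smooth_cst oT).
  exact: (smoothZ oT (smooth_cst oT (- L^-1)) ss).
- by move=> y _; have [] := std_immersion_plane y.
- by move=> y _; exact: std_normal_tangent (std_immersion_plane y).
- move=> y _ v; apply: (std_normal_orth v oT ss _ (I : setT y)) => z _.
  exact: std_immersion_plane.
- by move=> y _; exact: std_normal_unit (std_immersion_plane y).
- by move=> y _ v; exact: std_metric_pos.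
Qed.

End StandardPlane.

(** A normal field affine in the position makes all points umbilical. *)
Lemma derive_affine (R : realType) (V : normedModType R) (U : set V)
    (f nu : V -> 'rV[R]_4) (m : R) (a : 'rV[R]_4) x v :
  open U -> smooth_on U f -> (forall y, U y -> nu y = m *: f y + a) -> U x ->
  'D_v nu x = m *: 'D_v f x.
Proof.
move=> oU sf nuE Ux.
have := derive_comb m (smooth_derivable (v := v) sf Ux) (@derivable_cst _ _ _ a x v).
rewrite derive_cst addr0 => E.
by apply: (derive_near _ E); apply: (near_open oU Ux) => y Uy; exact: nuE.
Qed.

(** * From charts to the surface *)

Section Charts.
Context {R : realType} {M : topologicalType}.
Variable S : @surface R M.
Implicit Types (c : @chart R M) (p q : M).

Lemma crange_cfun c p : cdom c p -> crange c (cfun c p).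
Proof. by move=> cp; exists p. Qed.

Lemma near_chart c p (Q : M -> Prop) : cdom c p ->
  (\forall x \near cfun c p, Q (cinv c x)) -> \forall q \near p, Q q.
Proof.
move=> cp nQ; have n1 := cfun_continuous cp nQ.
have n2 : nbhs p (cdom c) by apply: open_nbhs_nbhs; split=> //; exact: cdom_open.
near=> q.
have cq : cdom c q by near: q.
have Qq : Q (cinv c (cfun c q)) by near: q.
by rewrite (cfunK cq) in Qq.
Unshelve. all: by end_near. Qed.

Lemma smooth_map_continuous (W : normedModType R) (h : M -> W) :
  smooth_map S h -> continuous h.
Proof.
move=> sh p A nA; have [c ac cp] := atlas_cover S p.
apply: (near_chart (Q := fun q => A (h q)) cp).
have := smooth_continuous (sh c ac) (crange_cfun cp).
by apply; rewrite /= (cfunK cp).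
Qed.

Lemma smooth_map_mulmxr m n (h : M -> 'rV[R]_m) (A : 'M[R]_(m, n)) :
  smooth_map S h -> smooth_map S (fun p => h p *m A).
Proof.
move=> sh c ac; have oc := @crange_open _ _ c.
exact: (smooth_mulmx oc (sh c ac) (smooth_cst oc A)).
Qed.

Hypothesis M_connected : connected [set: M].

(** The fibres of a locally constant map are open and closed. *)
Lemma locally_constant_constant (T : Type) (h : M -> T) :
  (forall p, \forall q \near p, h q = h p) -> forall p q, h q = h p.
Proof.
move=> lc p q; pose B := [set q | h q = h p].
have E : B = setT; last by have : B q by rewrite E.
have oB : open B.
  rewrite openE => r Br; apply: filterS (lc r) => s E; exact: etrans E Br.
have oC : open (~` B).
  rewrite openE => r Br; apply: filterS (lc r) => s E Bs.
  by apply: Br; exact: etrans (esym E) Bs.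
apply: M_connected.
- by exists p.
- by exists B => //; rewrite setTI.
- by exists B; [rewrite -[B]setCK; exact: open_closedC|rewrite setTI].
Qed.

Lemma derive0_constant (h : M -> R) : smooth_map S h ->
  (forall c, atlas S c -> forall x, crange c x -> forall v,
     'D_v (h \o cinv c) x = 0) -> forall p q, h q = h p.
Proof.
move=> sh Dh; apply: locally_constant_constant => p.
have [c ac cp] := atlas_cover S p.
apply: (near_chart (Q := fun q => h q = h p) cp).
have := derive0_near_constant (@crange_open _ _ c) (crange_cfun cp)
  (fun y Uy => smooth_diff (sh c ac) Uy) (fun y v Uy => Dh c ac y Uy v).
by apply: filterS => x /= ->; rewrite (cfunK cp).
Qed.

Lemma constant_sign (h : M -> R) : continuous h -> (forall p, h p != 0) ->
  (forall p, 0 < h p) \/ (forall p, h p < 0).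
Proof.
move=> ch h0; have lc p : \forall q \near p, (0 < h q) = (0 < h p).
  have [hp|hp] := boolP (0 < h p).
    apply: (ch p [set z | 0 < z]); apply: open_nbhs_nbhs.
    by split; [exact: open_gt|exact: hp].
  have hn : h p < 0 by rewrite lt_neqAle h0 leNgt.
  have : \forall q \near p, h q < 0.
    apply: (ch p [set z | z < 0]); apply: open_nbhs_nbhs.
    by split; [exact: open_lt|exact: hn].
  by apply: filterS => q hq; apply/negbTE; rewrite -leNgt ltW.
have [p _] := surface_nonempty S; have E := locally_constant_constant lc p.
have [hp|hp] := boolP (0 < h p); [left|right] => q; have := E q.
  by rewrite hp.
by rewrite (negPf hp) => /negbT; rewrite -leNgt lt_neqAle h0.
Qed.

End Charts.

Section ChartPatch.
Context {R : realType} {M : topologicalType}.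
Variables (S : @surface R M) (L : R) (phi xi : M -> 'rV[R]_4).
Hypotheses (L_gt0 : 0 < L).
Hypotheses (sph : spacelike_immersion S L phi) (un : unit_normal S phi xi).

Lemma chart_patch c : atlas S c ->
  spacelike_patch L (crange c) (phi \o cinv c) (xi \o cinv c).
Proof.
move=> ac; split.
- exact: lt0r_neq0.
- exact: crange_open.
- exact: (simm_smooth sph ac).
- exact: (unormal_smooth un ac).
- by move=> x _; exact: (simm_ads sph).
- by move=> x _; exact: (unormal_tangent un).
- by move=> x cx v; exact: (unormal_normal un ac).
- by move=> x _; exact: (unormal_unit un).
- by move=> x cx v v0; exact: (simm_spacelike sph ac).
Qed.

End ChartPatch.

(** A map into AdS that an isometry carries to the standard plane, read in the
    coordinates [X_2], [X_3] of that plane. *)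
Section Model.
Context {R : realType} {M : topologicalType}.
Variables (S : @surface R M) (L : R) (phi : M -> 'rV[R]_4).
Variables (T : 'M[R]_4) (psi : M -> 'rV[R]_2).
Hypotheses (L_gt0 : 0 < L) (iT : ambient_isometry T).
Hypotheses (sphi : smooth_map S phi) (spsi : smooth_map S psi).
Hypothesis phiT : forall p, phi p *m T = std_immersion L (psi p).

Lemma model_pullback c x : atlas S c -> crange c x ->
  let J := jacobian (psi \o cinv c) x in
  induced_metric phi c x = J *m std_metric L (psi (cinv c x)) *m J^T.
Proof.
move=> ac cx; have df := smooth_diff (sphi ac) cx.
have dp := smooth_diff (spsi ac) cx.
have ds := smooth_diff (smooth_std L_gt0) (I : setT (psi (cinv c x))).
rewrite /= -(pullback_comp dp ds) /induced_metric -(pullback_isometry iT df).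
by congr (pullback_mx _ x); apply/funext => y /=; exact: phiT.
Qed.

(** The coordinate map is a local homeomorphism, and the standard plane is a
    graph over its coordinates. *)
Lemma model_local_homeomorphism p :
  (forall c, atlas S c -> forall x, crange c x ->
     \det (induced_metric phi c x) != 0) ->
  exists U : set M, [/\ open U, U p,
    (forall q r, U q -> U r -> phi q *m T = phi r *m T -> q = r) &
    (forall V : set M, open V -> V `<=` U ->
       exists2 W : set 'rV[R]_4, open W &
         [set phi q *m T | q in V] = std_plane L `&` W)].
Proof.
move=> det0; have [c ac cp] := atlas_cover S p; have px := crange_cfun cp.
have JU : jacobian (psi \o cinv c) (cfun c p) \in unitmx.
  rewrite unitmxE unitfE; have := det0 c ac _ px; rewrite model_pullback//.
  by rewrite !det_mulmx !mulf_eq0 !negb_or => /andP[/andP[]].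
have [B [oB Bp BU injB opB]] :=
  local_homeomorphism (@crange_open _ _ c) (spsi ac) px JU.
have psiE q : psi q = phi q *m T *m std_coords by rewrite phiT std_immersionK.
have preimage_open (O : set M) : open O -> open (crange c `&` cinv c @^-1` O).
  move=> oO; rewrite openE => x [cx Ox]; apply: filterI.
    by apply: open_nbhs_nbhs; split=> //; exact: crange_open.
  by apply: (cinv_continuous cx); apply: open_nbhs_nbhs; split.
exists (cdom c `&` cfun c @^-1` B); split=> //.
- rewrite openE => q [cq Bq]; apply: filterI.
    by apply: open_nbhs_nbhs; split=> //; exact: cdom_open.
  by apply: (cfun_continuous cq); apply: open_nbhs_nbhs; split.
- move=> q r [cq Bq] [cr Br] qr; rewrite -(cfunK cq) -(cfunK cr).
  by congr (cinv c _); apply: injB => //=; rewrite !cfunK// !psiE qr.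
move=> V oV VU; pose O := (psi \o cinv c) @` (B `&` (crange c `&` cinv c @^-1` V)).
have oO : open O.
  by apply: opB; [apply: openI => //; exact: preimage_open|exact: subIsetl].
exists ((mulmxr (std_coords (R := R)) : 'rV[R]_4 -> 'rV[R]_2) @^-1` O).
  by apply: open_comp => // X _; exact: continuous_mulmxr.
have OV q : V q -> O (psi q).
  move=> Vq; have [cq Bq] := VU q Vq; exists (cfun c q); last by rewrite /= cfunK.
  by split=> //; split; [exact: crange_cfun|rewrite /= cfunK].
apply/seteqP; split=> [X [q Vq <-]|X [pX [x [Bx [cx Vx]] xX]]].
  split; first by rewrite phiT; exact: std_immersion_plane.
  by rewrite /= -psiE; exact: OV.
exists (cinv c x) => //; rewrite phiT.
by rewrite -(std_coordsK L_gt0 pX); congr (std_immersion L _); exact: xX.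
Qed.

End Model.

Section Forward.
Context {R : realType} {M : topologicalType}.
Variables (S : @surface R M) (L : R) (gbar : riemannian_metric S).
Variables (phi xi : M -> 'rV[R]_4) (lam : M -> R) (H : R).
Hypotheses (L_gt0 : 0 < L) (M_connected : connected [set: M]).
Hypothesis bcc : biharmonic_conformal_cmc L gbar phi xi lam H.

Let sph := bcc_immersion bcc.
Let un := bcc_two_sided bcc.
Let conf := bcc_conformal bcc.

Lemma smooth_dilation_sqr c : atlas S c ->
  smooth_on (crange c) (fun x => lam (cinv c x) ^+ 2).
Proof.
move=> ac; have sl := dilation_smooth conf ac.
exact: (smoothM (@crange_open _ _ c) sl sl).
Qed.

Lemma chart_trace2 c x : atlas S c -> crange c x ->
  trace2 (phi \o cinv c) (xi \o cinv c) x = 2 * H.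
Proof.
move=> ac cx; have P := chart_patch L_gt0 sph un ac.
have := bcc_cmc bcc ac cx; rewrite (mean_curvature_patch P cx) /= => E.
have : xi (cinv c x) != 0.
  apply/eqP => x0; have := unormal_unit un (cinv c x).
  by rewrite x0 mink0l => /eqP; rewrite eq_sym oppr_eq0 oner_eq0.
move: E => /eqP; rewrite -subr_eq0 -scalerBl scaler_eq0 => /orP[|/eqP -> /eqP//].
by rewrite subr_eq0 => /eqP <- _; rewrite mulrA divff ?mul1r// pnatr_eq0.
Qed.

Lemma chart_classification c x v : atlas S c -> crange c x ->
  [/\ H ^+ 2 = L ^- 2, 'D_v (xi \o cinv c) x = H *: 'D_v (phi \o cinv c) x &
      'D_v (fun x => lam (cinv c x) ^+ 2) x = 0].
Proof.
move=> ac cx; have P := chart_patch L_gt0 sph un ac.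
have l0 y : crange c y -> 0 < lam (cinv c y) ^+ 2.
  by move=> _; rewrite exprn_gt0// (dilation_gt0 conf).
have t0 : 2 * H != 0 by rewrite mulf_neq0 ?pnatr_eq0// (bcc_cmc_neq0 bcc).
have [t2 Dn Dw] := local_classification P (smooth_dilation_sqr ac) l0
  (conformal_eq conf ac) t0 (fun y => @chart_trace2 c y ac)
  (bcc_biharmonic bcc ac) v cx.
split=> //; last by rewrite Dn; congr (_ *: _); field.
by apply: (mulfI (x := 4)); rewrite ?pnatr_eq0// -t2; ring.
Qed.

Lemma cmc_sqr : H ^+ 2 = L ^- 2.
Proof.
have [p _] := surface_nonempty S; have [c ac cp] := atlas_cover S p.
by have [] := chart_classification 0 ac (crange_cfun cp).
Qed.

Let Dxi c x v (ac : atlas S c) (cx : crange c x) :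
  'D_v (xi \o cinv c) x = H *: 'D_v (phi \o cinv c) x.
Proof. by have [] := @chart_classification c x v ac cx. Qed.

Lemma dilation_constant p q : lam q = lam p.
Proof.
have sl : smooth_map S (fun p => lam p ^+ 2).
  by move=> c ac; exact: smooth_dilation_sqr.
have E : lam q ^+ 2 = lam p ^+ 2.
  apply: (derive0_constant M_connected sl) => c ac x cx v.
  by have [] := chart_classification v ac cx.
by apply/eqP; rewrite -(eqrXn2 (n := 2))// ?E// ltW// (dilation_gt0 conf).
Qed.

(** In every chart [D xi = H D phi]. *)
Lemma normal_constant p q : xi q - H *: phi q = xi p - H *: phi p.
Proof.
apply/rowP => i.
have sh : smooth_map S (fun p => (xi p - H *: phi p) 0 i).
  move=> c ac; have oc := @crange_open _ _ c; apply: (smooth_coord oc).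
  apply: (@smooth_ext _ _ _ oc _ (fun x => (- H) *: phi (cinv c x) + xi (cinv c x))).
    by move=> x _ /=; rewrite addrC scaleNr.
  apply: (smoothD oc); last exact: (unormal_smooth un ac).
  exact: (smoothZ oc (smooth_cst oc (- H)) (simm_smooth sph ac)).
apply: (derive0_constant M_connected sh) => c ac x cx v.
have oc := @crange_open _ _ c.
have df := smooth_derivable (v := v) (simm_smooth sph ac) cx.
have dn := smooth_derivable (v := v) (unormal_smooth un ac) cx.
have dh := derive_comb (- H) df dn.
rewrite (Dxi v ac cx) in dh.
have zero (X : 'rV[R]_4) : - H *: X + H *: X = 0 by rewrite scaleNr addNr.
rewrite zero in dh; have [dd D0] := dh.
apply: (etrans (y := ('D_v (fun y => - H *: (phi \o cinv c) y + (xi \o cinv c) y) x) 0 i)).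
  rewrite -(derive_coord 0 i dd); congr ('D_v _ x); apply/funext => y /=.
  by rewrite addrC scaleNr.
by rewrite D0 mxE.
Qed.

Let s := - H * L.
Local Notation e0 := (delta_mx 0 (inord 0) : 'rV[R]_4).
Local Notation e1 := (delta_mx 0 (inord 1) : 'rV[R]_4).

Lemma cmc_sign : s = 1 \/ s = -1.
Proof.
have L0 := lt0r_neq0 L_gt0.
have : s ^+ 2 = 1 by rewrite exprMn sqrrN cmc_sqr mulVf// expf_neq0.
by move=> /eqP; rewrite sqrf_eq1 => /orP[] /eqP; [left|right].
Qed.

(** The constant vector [s (xi - H phi)] has norm [- 2], so an isometry moves it
    to [sqrt 2 e1]; this makes the coordinate [X_1] of [phi] constant. *)
Lemma normalizing_isometry : exists T, [/\ ambient_isometry T,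
  (forall p, (s *: xi p) *m T = std_normal L (phi p *m T)),
  (forall p, (phi p *m T) 0 (inord 1) = L / Num.sqrt 2) &
  (forall p, (phi p *m T) 0 (inord 0) != 0)].
Proof.
have L0 := lt0r_neq0 L_gt0; have H2 := cmc_sqr.
have s2 : Num.sqrt 2 ^+ 2 = 2 :> R by rewrite sqr_sqrtr// ler0n.
have s0 : Num.sqrt 2 != 0 :> R by rewrite gt_eqF// sqrtr_gt0.
have ss : s ^+ 2 = 1 by rewrite exprMn sqrrN H2 mulVf// expf_neq0.
have sH : s * H = - L^-1.
  apply: (mulfI L0); rewrite mulrN divff// /s.
  have -> : L * (- H * L * H) = - (H ^+ 2 * L ^+ 2) by ring.
  by rewrite H2 mulVf// expf_neq0.
have [p0 _] := surface_nonempty S.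
(* The sign [s] makes the coefficient of [phi] in [s *: xi] that of the standard
   normal. *)
pose a := s *: (xi p0 - H *: phi p0); pose b := Num.sqrt 2 *: e1.
have aE p : s *: xi p = a + (- L^-1) *: phi p.
  by rewrite /a (normal_constant p p0) scalerBr scalerA sH subrK.
have bb : mink b b = - 2.
  by rewrite minkZl minkZr mink_e1 mxE !eqxx /= mulrN1 mulrN -expr2 s2.
have aa : mink a a = mink b b.
  rewrite bb minkZl minkZr mulrA -expr2 ss mul1r.
  rewrite !(minkDl, minkDr, minkNl, minkNr, minkZl, minkZr).
  rewrite (minkC (phi p0)) (unormal_unit un) (unormal_tangent un) (simm_ads sph p0).
  have := H2; move: (L ^+ 2) (expf_neq0 2 L0) => l l0 h.
  have -> : -1 - H * 0 + (- (H * 0) - H * - (H * - l)) = - 1 - H ^+ 2 * l by ring.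
  by rewrite h mulVf// -opprD.
have a0 : mink a a != 0 by rewrite aa bb oppr_eq0 pnatr_eq0.
have [T [iT aT]] := isometry_transitive aa a0.
have Y1 p : (phi p *m T) 0 (inord 1) = L / Num.sqrt 2.
  have : mink (phi p *m T) b = - L.
    rewrite -aT iT.
    have -> : a = s *: xi p - (- L^-1) *: phi p by rewrite aE addrK.
    rewrite minkDr minkNr !minkZr (minkC _ (xi p)) (unormal_tangent un).
    by rewrite (simm_ads sph p) mulr0 add0r; field.
  rewrite minkZr mink_e1 mulrN => /oppr_inj E.
  by apply: (mulfI s0); rewrite E mulrCA divff ?mulr1.
exists T; split=> // p.
  by rewrite aE mulmxDl aT -scalemxAl std_normal_affine addrC.
apply/eqP => Y0; have := simm_ads sph p; rewrite /ads /= -iT mink4 Y0 Y1.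
have : (L / Num.sqrt 2) ^+ 2 = L ^+ 2 / 2 by rewrite exprMn exprVn s2.
have := exprn_gt0 2 L_gt0.
move: (L / Num.sqrt 2) (L ^+ 2) ((phi p *m T) 0 (inord 2)) ((phi p *m T) 0 (inord 3)).
move=> l k x y k0 lk E; have := sqr_ge0 x; have := sqr_ge0 y.
by move: lk E; rewrite !expr2; lra.
Qed.

(** By connectedness [X_0] has a constant sign; if it is negative, the reflection
    in [e0] changes it and fixes [e1]. *)
Lemma std_isometry_exists : exists T, [/\ ambient_isometry T,
  (forall p, (s *: xi p) *m T = std_normal L (phi p *m T)) &
  (forall p, std_plane L (phi p *m T))].
Proof.
have [T [iT nT Y1 Y0]] := normalizing_isometry.
have adsT T' p : ambient_isometry T' -> ads L (phi p *m T').
  by move=> iT'; rewrite /ads /= iT' (simm_ads sph p).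
have cY : continuous (fun p => (phi p *m T) 0 (inord 0)).
  apply: (smooth_map_continuous (S := S)) => c ac; have oc := @crange_open _ _ c.
  exact: (smooth_coord oc _ _ (smooth_map_mulmxr T (simm_smooth sph) ac)).
have [pos|neg] := constant_sign S M_connected cY Y0.
  by exists T; split=> // p; split; [exact: adsT|exact: pos|exact: Y1].
have n0 : mink e0 e0 = -1 by rewrite mink_delta inordK// mxE !eqxx mulr1.
have iR : ambient_isometry (reflection e0).
  by apply: reflection_isometry; rewrite n0 oppr_eq0 oner_eq0.
have RE (X : 'rV[R]_4) : X *m reflection e0 = X - (2 * X 0 (inord 0)) *: e0.
  rewrite mul_reflection n0 mink_delta inordK//; congr (_ - _ *: _).
  by rewrite invrN invr1 mulrN1 mulN1r mulrN opprK.
have i01 : (inord 1 == inord 0 :> 'I_4) = false.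
  by rewrite -val_eqE /= !inordK.
exists (T *m reflection e0); split=> [|p|p]; first exact: isometryM.
  rewrite !mulmxA nT /std_normal mulmxBl -!scalemxAl; congr (_ *: _ - _).
  by rewrite RE mxE eqxx eq_sym i01 mulr0 scale0r subr0.
have iTR := isometryM iT iR.
rewrite mulmxA; split; first by rewrite -mulmxA; exact: adsT.
  rewrite RE; have := neg p; move: (phi p *m T) => X X0.
  by rewrite !mxE !eqxx /= mulr1; lra.
rewrite RE -(Y1 p); move: (phi p *m T) => X.
by rewrite !mxE i01 andbF mulr0 oppr0 addr0.
Qed.

Lemma forward_shape c x : atlas S c -> crange c x ->
  shape_operator L phi xi c x = (s / L)%:M.
Proof.
move=> ac cx; have P := chart_patch L_gt0 sph un ac.
have -> : s / L = - H by rewrite /s mulfK// lt0r_neq0.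
apply: (umbilical_shape P (fun y v cy => Dxi v ac cy) cx).
exact: (simm_immersion sph ac).
Qed.

Lemma forward_gauss c x : atlas S c -> crange c x ->
  gauss_curvature (induced_metric phi c) x = - (2 / L ^+ 2).
Proof.
move=> ac cx; have P := chart_patch L_gt0 sph un ac.
exact: (umbilical_gauss_curvature P cmc_sqr (fun y v cy => Dxi v ac cy) cx).
Qed.

Lemma forward_biharmonic : biharmonic S L (induced_metric phi) phi.
Proof.
move=> c ac; have P := chart_patch L_gt0 sph un ac.
have oc := @crange_open _ _ c.
apply: (umbilical_biharmonic P cmc_sqr (fun y v cy => Dxi v ac cy)
  (smooth_cst oc (1 : R))) => [x _|x _|x v _].
- exact: ltr01.
- by rewrite scale1r.
- exact: derive_cst.
Qed.

Lemma forward_congruent : exists (T : 'M[R]_4) (eps : R),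
  [/\ ambient_isometry T, eps = 1 \/ eps = -1 &
      congruent_to_std L phi xi T eps].
Proof.
have [T [iT nT pT]] := std_isometry_exists.
exists T, s; split=> //; first exact: cmc_sign.
move=> p; split; first exact: nT.
apply: (model_local_homeomorphism (psi := fun p => phi p *m T *m std_coords)
  L_gt0 iT (simm_smooth sph)).
- by do 2! apply: smooth_map_mulmxr; exact: (simm_smooth sph).
- by move=> q; rewrite (std_coordsK L_gt0 (pT q)).
move=> c ac x cx; apply: lt0r_neq0.
exact: (pullback_det (chart_patch L_gt0 sph un ac) cx).
Qed.

Lemma forward_homothetic : exists lam0 : R,
  [/\ 0 < lam0, forall p, lam p = lam0 &
      homothetic_reparametrization L gbar phi lam0].
Proof.
have [T [iT nT pT]] := std_isometry_exists.
have [p0 _] := surface_nonempty S; exists (lam p0); split.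
- exact: (dilation_gt0 conf).
- by move=> p; exact: dilation_constant.
have spsi : smooth_map S (fun p => phi p *m T *m std_coords).
  by do 2! apply: smooth_map_mulmxr; exact: (simm_smooth sph).
have phiT p : phi p *m T = std_immersion L (phi p *m T *m std_coords).
  by rewrite (std_coordsK L_gt0 (pT p)).
exists T, (fun p => phi p *m T *m std_coords); split=> // c ac x cx J.
rewrite -(model_pullback L_gt0 iT (simm_smooth sph) spsi phiT ac cx).
by rewrite (conformal_eq conf ac cx) (dilation_constant p0).
Qed.

End Forward.

Section Converse.
Context {R : realType} {M : topologicalType}.
Variables (S : @surface R M) (L : R) (gbar : riemannian_metric S).
Variables (phi : M -> 'rV[R]_4) (lam0 : R).
Hypotheses (L_gt0 : 0 < L) (lam0_gt0 : 0 < lam0).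

(** The unit normal is the pull-back of the standard one, an affine function of
    the position, so that the immersion is umbilical in every chart. *)
Lemma homothetic_biharmonic : homothetic_reparametrization L gbar phi lam0 ->
  exists (xi : M -> 'rV[R]_4) (H : R),
    biharmonic_conformal_cmc L gbar phi xi (fun=> lam0) H.
Proof.
move=> [T [psi [iT spsi phiT Jeq]]]; have L0 := lt0r_neq0 L_gt0.
have TU := isometry_unit iT.
have pT p : std_plane L (phi p *m T) by rewrite phiT; exact: std_immersion_plane.
pose a := Num.sqrt 2 *: (delta_mx 0 (inord 1) : 'rV[R]_4) *m invmx T.
pose xi p := (- L^-1) *: phi p + a.
have xiT p : xi p *m T = std_normal L (phi p *m T).
  by rewrite std_normal_affine mulmxDl mulmxKV// scalemxAl.
have sphi : smooth_map S phi.
  move=> c ac; have oc := @crange_open _ _ c.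
  apply: (@smooth_ext _ _ _ oc _
    (fun x => (std_immersion L \o (psi \o cinv c)) x *m invmx T)).
    by move=> x _ /=; rewrite -phiT mulmxK.
  apply: (smooth_mulmx oc) (smooth_cst oc _).
  exact: (smooth_std_immersion L_gt0 oc (spsi c ac)).
have ind c x : atlas S c -> crange c x ->
    induced_metric phi c x = lam0 ^+ 2 *: gbar c x.
  by move=> ac cx; rewrite (model_pullback L_gt0 iT sphi spsi phiT ac cx) Jeq.
have space c x v : atlas S c -> crange c x -> v != 0 ->
    0 < gip (induced_metric phi c) x v v.
  move=> ac cx v0; rewrite /gip (ind c x ac cx) -scalemxAr -scalemxAl mxE.
  by rewrite pmulr_rgt0 ?exprn_gt0//; exact: (metric_pos gbar ac cx).
have free c x : atlas S c -> crange c x -> row_free (jacobian (phi \o cinv c) x).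
  move=> ac cx; apply: row_free_pullback => [|v v0]; last exact: space.
  exact: (smooth_diff (sphi c ac) cx).
have imm : spacelike_immersion S L phi.
  split=> //; [|by move=> c ac x cx; exact: free|by move=> c ac x cx v; exact: space].
  by move=> p; rewrite /ads /= -iT; have [] := pT p.
have xiE c : forall x, crange c x ->
    (xi \o cinv c) x = (- L^-1) *: (phi \o cinv c) x + a by [].
have un : unit_normal S phi xi.
  split.
  - move=> c ac; have oc := @crange_open _ _ c.
    apply: (smoothD oc) (smooth_cst oc a).
    exact: (smoothZ oc (smooth_cst oc (- L^-1)) (sphi c ac)).
  - by move=> p; rewrite -iT xiT std_normal_tangent.
  - move=> c ac x cx v; have oc := @crange_open _ _ c.
    have [_ DT] := derive_mulmxr T v (smooth_diff (sphi c ac) cx).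
    rewrite -iT xiT -DT.
    apply: (std_normal_orth v oc _ (fun y _ => pT (cinv c y)) cx).
    exact: (smooth_map_mulmxr T sphi ac).
  - by move=> p; rewrite -iT xiT std_normal_unit.
have m2 : (- L^-1) ^+ 2 = L ^- 2 by rewrite sqrrN exprVn.
have Dxi c x v : atlas S c -> crange c x ->
    'D_v (xi \o cinv c) x = (- L^-1) *: 'D_v (phi \o cinv c) x.
  move=> ac; apply: (derive_affine v (@crange_open _ _ c) (sphi c ac)).
  exact: xiE.
exists xi, (- L^-1); split=> //.
- split=> [c ac|p|c ac x cx] //; first exact: (smooth_cst (@crange_open _ _ c)).
  exact: ind.
- move=> c ac; have P := chart_patch L_gt0 imm un ac.
  have oc := @crange_open _ _ c.
  apply: (umbilical_biharmonic P m2 (fun y v cy => Dxi c y v ac cy)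
    (smooth_cst oc (lam0 ^+ 2))) => [x _|x cx|x v _].
  + exact: exprn_gt0.
  + exact: ind.
  + exact: derive_cst.
- move=> c ac x cx; have P := chart_patch L_gt0 imm un ac.
  exact: (umbilical_mean_curvature P (fun y v cy => Dxi c y v ac cy) cx).
- by rewrite oppr_eq0 invr_eq0.
Qed.

End Converse.

Section StandardExample.
Context {R : realType}.
Variable L : R.
Hypothesis L_gt0 : 0 < L.

Let P := std_patch L_gt0.
Let L0 : L != 0. Proof. exact: lt0r_neq0. Qed.

Let m2 : (- L^-1) ^+ 2 = L ^- 2. Proof. by rewrite sqrrN exprVn. Qed.

Let Dn x v : setT x -> 'D_v (std_normal L \o std_immersion L) x
  = (- L^-1) *: 'D_v (std_immersion L) x.
Proof.
apply: (derive_affine v openT (smooth_std L_gt0)) => y _.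
exact: std_normal_affine.
Qed.

Let one_smooth : smooth_on setT (cst 1 : 'rV[R]_2 -> R).
Proof. exact: (smooth_cst openT). Qed.

Lemma std_biharmonic : biharmonic_on L (std_metric L) (std_immersion L) setT.
Proof.
apply: (umbilical_biharmonic P m2 Dn one_smooth) => [x _|x _|x v _].
- exact: ltr01.
- by rewrite scale1r.
- exact: derive_cst.
Qed.

Lemma std_not_harmonic :
  ~ harmonic_on L (std_metric L) (std_immersion L) setT.
Proof.
move=> /(_ 0 I).
rewrite (tension_conformal P one_smooth) => [|x _|x _|];
  [|exact: ltr01|by rewrite scale1r|by []].
rewrite (umbilical_trace2 P Dn)// mul1r => /eqP; rewrite scaler_eq0 => /orP[|/eqP n0].
  by rewrite mulf_eq0 pnatr_eq0 oppr_eq0 invr_eq0 (negPf L0).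
have := patch_unit P (I : setT (0 : 'rV[R]_2)).
by rewrite n0 mink0l => /eqP; rewrite eq_sym oppr_eq0 oner_eq0.
Qed.

Lemma std_shape u :
  shape_mx L (std_immersion L) (std_normal L \o std_immersion L) u = L^-1%:M.
Proof.
rewrite (umbilical_shape P Dn)// ?opprK//.
apply: row_free_pullback => [|v]; last exact: std_metric_pos.
exact: (smooth_diff (smooth_std L_gt0) (I : setT u)).
Qed.

Lemma std_gauss u : gauss_curvature (std_metric L) u = - (2 / L ^+ 2).
Proof. exact: (umbilical_gauss_curvature P m2 Dn (I : setT u)). Qed.

End StandardExample.

Theorem corollary3p2 (R : realType) (L : R) (M : topologicalType)
    (S : @surface R M) (gbar : riemannian_metric S) (phi : M -> 'rV[R]_4)
    (L_gt0 : 0 < L) (M_connected : connected [set: M]) :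
  [/\ (forall (xi : M -> 'rV[R]_4) (lam : M -> R) (H : R),
        biharmonic_conformal_cmc L gbar phi xi lam H ->
        [/\ biharmonic S L (induced_metric phi) phi,
            locally_totally_umbilical S L phi xi,
            (exists2 s : R, s = 1 \/ s = -1 &
               H = - s / L /\
               forall c, atlas S c -> forall x, crange c x ->
                 shape_operator L phi xi c x = (s / L)%:M /\
                 gauss_curvature (induced_metric phi c) x = - (2 / L ^+ 2)),
            (exists (T : 'M[R]_4) (eps : R),
               [/\ ambient_isometry T, eps = 1 \/ eps = -1 &
                   congruent_to_std L phi xi T eps]) &
            (exists lam0 : R,
               [/\ 0 < lam0, forall p, lam p = lam0 &
                   homothetic_reparametrization L gbar phi lam0])]),
      (forall lam0 : R, 0 < lam0 ->
        homothetic_reparametrization L gbar phi lam0 ->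
        exists (xi : M -> 'rV[R]_4) (H : R),
          biharmonic_conformal_cmc L gbar phi xi (fun=> lam0) H) &
      [/\ biharmonic_on L (std_metric L) (std_immersion L) [set: 'rV[R]_2],
          ~ harmonic_on L (std_metric L) (std_immersion L) [set: 'rV[R]_2] &
          forall u : 'rV[R]_2,
            [/\ forall v, v != 0 -> 0 < gip (std_metric L) u v v,
                shape_mx L (std_immersion L) (std_normal L \o std_immersion L) u
                  = L^-1%:M &
                gauss_curvature (std_metric L) u = - (2 / L ^+ 2)]]].
Proof.
have L0 := lt0r_neq0 L_gt0; split=> [xi lam H bcc|lam0 l0 hom|].
- have cs := cmc_sign L_gt0 bcc; split.
  + exact: (forward_biharmonic L_gt0 bcc).
  + move=> p; exists setT; split=> //; first exact: openT.
    exists (fun=> - H * L / L) => c ac x cx _.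
    exact: (forward_shape L_gt0 bcc ac cx).
  + exists (- H * L); first exact: cs.
    split; first by rewrite mulNr mulfK// opprK.
    move=> c ac x cx; split; first exact: (forward_shape L_gt0 bcc ac cx).
    exact: (forward_gauss L_gt0 bcc ac cx).
  + exact: (forward_congruent L_gt0 M_connected bcc).
  + exact: (forward_homothetic L_gt0 M_connected bcc).
- exact: homothetic_biharmonic.
split; [exact: std_biharmonic|exact: std_not_harmonic|move=> u].
split=> [v v0||]; [exact: std_metric_pos|exact: std_shape|exact: std_gauss].
Qed.
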